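(* Let $\{Z_n\}_{n\ge 0}$ be the branching process with time-dependent immigration $Z_0=0$, $Z_n=\sum_{i=1}^{Z_{n-1}}X_{n,i}+\xi_n$ ($n\ge1$), with offspring variables $X_{n,i}$ and immigration variables $\xi_n$ as described in the context. Assume: (A) $\mathrm{E}X_{1,1}=1$ and $\mathrm{E}X_{1,1}^4<\infty$. (B) $\alpha_n:=\mathrm{E}\xi_n$, $\beta_n^2:=\mathrm{Var}\,\xi_n$ and $\gamma_n^4:=\mathrm{Var}\big((\xi_n-\alpha_n)^2\big)$ are finite for every $n$, and $\alpha_n=n^{\alpha}L_\alpha(n)$, $\beta_n^2=n^{\beta}L_\beta(n)$, $\gamma_n^4=n^{\gamma}L_\gamma(n)$, where $\alpha,\beta,\gamma\ge 0$ and $L_\alpha,L_\beta,L_\gamma$ are slowly varying at infinity. (C) $\lim_{n\to\infty}\alpha_n=\infty$. (D) Either (i) $\lim_{n\to\infty}\frac{\beta_n^2}{n\alpha_n}=0$, or (ii) $\lim_{n\to\infty}\frac{\beta_n^2}{n\alpha_n^2}=0$ and $\lim_{n\to\infty}\frac{n\alpha_n\beta_n^2}{\gamma_n^4}=0$. (E) With $\widetilde\eta_n:=(\xi_n-\alpha_n)^2-\beta_n^2$ and $\tau_n^2:=\sum_{k=1}^n\gamma_k^4$, the Lindeberg condition holds: for every $\varepsilon>0$, $$\lim_{n\to\infty}\frac1{\tau_n^2}\sum_{k=1}^n \mathrm{E}\big(\widetilde\eta_k^2\,\chi(|\widetilde\eta_k|>\varepsilon\tau_n)\big)=0.$$ (F)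 With $A_n:=\mathrm{E}Z_n$ and $\theta_n:=\frac{nA_n^2}{nA_n^2+\tau_n^2}$, the limit $\theta:=\lim_{n\to\infty}\theta_n\in[0,1]$ exists. Let $b^2:=\mathrm{Var}\,X_{1,1}$ and let $$\widehat{b_n^2}:=\frac{\sum_{k=1}^n\big((Z_k-Z_{k-1}-\alpha_k)^2-\beta_k^2\big)Z_{k-1}}{\sum_{k=1}^n Z_{k-1}^2}.$$ Then, as $n\to\infty$, $$(\theta_n n)^{1/2}\big(\widehat{b_n^2}-b^2\big)\ \text{ converges in distribution to }\ N(0,\sigma^2),$$ a normal random variable with mean zero and variance $$\sigma^2=(2\alpha+3)^2\left(\theta\,\frac{2b^4}{4\alpha+5}+(1-\theta)\,\frac{\gamma+1}{2\alpha+3+\gamma}\right).$$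
   Context: All random variables live on one probability space $(\Omega,\mathfrak F,P)$. $\{X_{n,i}\}_{n,i\ge1}$ and $\{\xi_n\}_{n\ge1}$ are families of independent, non-negative, integer-valued random variables, independent of each other; the $X_{n,i}$ have a common distribution for all $n,i$, while the $\xi_n$ need not be identically distributed. A function $L$ that is positive (for large argument) is slowly varying at infinity if $\lim_{x\to\infty}L(cx)/L(x)=1$ for every $c>0$. $\chi(A)$ is the indicator of the event $A$. The letters $\alpha,\beta,\gamma$ without index denote the regular variation exponents; $\alpha_n,\beta_n^2,\gamma_n^4$ denote the moment sequences. $N(0,0)$ means the point mass at $0$. The estimator $\widehat{b_n^2}$ is the conditional least squares estimator of $b^2$; it is defined on the event where its denominator is positive (its value on the complementary event may be set to $0$).
   Formalization: The slowly varying functions L_α, L_β, L_γ are additionally assumed measurable on some half-line (a,∞), as is standard; without measurability the stated variance can fail. *)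

(* Defs.v *)
From HB Require Import structures.
From mathcomp Require Import all_boot all_order all_algebra finmap.
From mathcomp Require Import all_classical all_reals all_analysis.

Set Implicit Arguments.
Unset Strict Implicit.
Unset Printing Implicit Defensive.

Import Order.TTheory GRing.Theory Num.Theory.
Import numFieldNormedType.Exports.

Local Open Scope classical_set_scope.
Local Open Scope ring_scope.

(* Measurability near infinity is part of the usual notion.  Without it, a
   Hamel basis of R over Q containing the logarithms of the primes gives a
   function with the limit property and the values
   L(n) = log log n + (number of prime divisors of n), for which Karamata's
   theorem on sums of the n^rho L(n) fails. *)
Definition slowly_varying (R : realType) (L : R -> R) : Prop :=
  (exists a : R, measurable_fun `]a, +oo[ L /\ forall x, a < x -> 0 < L x) /\
  (forall c : R, 0 < c -> L (c * x) / L x @[x --> +oo] --> (1 : R)).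

Section independence.
Context d (T : measurableType d) (R : realType) (P : probability T R).
Context d' (T' : measurableType d').

Definition independent_RVs (I : choiceType) (D : set I)
    (Y : I -> {RV P >-> T'}) : Prop :=
  forall (J : {fset I}) (B : I -> set T'),
    [set` J] `<=` D -> (forall i, measurable (B i)) ->
    P (\bigcap_(i in [set` J]) Y i @^-1` B i) =
    (\prod_(i <- J) P (Y i @^-1` B i))%E.

Definition sigma_family (I : choiceType) (D : set I)
    (Y : I -> {RV P >-> T'}) : set (set T) :=
  <<s [set A | exists i, exists B,
         [/\ D i, measurable B & A = Y i @^-1` B]] >>.

Definition independent_families (I I' : choiceType) (D : set I) (D' : set I')
    (Y : I -> {RV P >-> T'}) (Y' : I' -> {RV P >-> T'}) : Prop :=
  forall A B, sigma_family D Y A -> sigma_family D' Y' B ->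
    P (A `&` B) = (P A * P B)%E.

End independence.

Definition converges_in_distribution d (T : measurableType d) (R : realType)
    (P : probability T R) (Y : nat -> T -> R) (mu : set R -> \bar R) : Prop :=
  forall x : R, {for x, continuous (fun y : R => mu `]-oo, y]%classic)} ->
    P (Y n @^-1` `]-oo, x]%classic) @[n --> \oo] --> mu `]-oo, x]%classic.

(* normal_prob is parametrized by the standard deviation, and normal_prob m 0
   is the uniform law on [0, 1], not the point mass at m. *)
Definition centered_normal (R : realType) (v : R) : set R -> \bar R :=
  if v == 0 then \d_(0 : R) else normal_prob 0 (Num.sqrt v).

Section branching_process.
Context d (T : measurableType d) (R : realType) (P : probability T R).
(* Only the indices n, i >= 1 are meaningful. *)
Variables (X : nat -> nat -> {RV P >-> nat}) (xi : nat -> {RV P >-> nat}).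

Fixpoint Z (n : nat) (w : T) : nat :=
  if n is m.+1 then
    ((\sum_(1 <= i < (Z m w).+1) X m.+1 i w) + xi m.+1 w)%N
  else 0%N.

Definition offspring_variance : R :=
  fine 'V_P[fun w => (X 1%N 1%N w)%:R].

Definition immigration_mean (n : nat) : R :=
  fine 'E_P[fun w => (xi n w)%:R].

Definition immigration_variance (n : nat) : R :=
  fine 'V_P[fun w => (xi n w)%:R].

(* gamma_n ^ 4 *)
Definition immigration_gamma4 (n : nat) : R :=
  fine 'V_P[fun w => ((xi n w)%:R - immigration_mean n) ^+ 2].

Definition eta (n : nat) (w : T) : R :=
  ((xi n w)%:R - immigration_mean n) ^+ 2 - immigration_variance n.

(* tau_n ^ 2 *)
Definition tau2 (n : nat) : R :=
  \sum_(1 <= k < n.+1) immigration_gamma4 k.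

Definition population_mean (n : nat) : R :=
  fine 'E_P[fun w => (Z n w)%:R].

Definition theta_seq (n : nat) : R :=
  n%:R * population_mean n ^+ 2 /
  (n%:R * population_mean n ^+ 2 + tau2 n).

(* Equal to 0 where the denominator vanishes, since x / 0 = 0. *)
Definition b2_estimator (n : nat) (w : T) : R :=
  (\sum_(1 <= k < n.+1)
     (((Z k w)%:R - (Z k.-1 w)%:R - immigration_mean k) ^+ 2
        - immigration_variance k) * (Z k.-1 w)%:R) /
  (\sum_(1 <= k < n.+1) (Z k.-1 w)%:R ^+ 2).

Definition lindeberg_condition : Prop :=
  forall eps : R, 0 < eps ->
    (((tau2 n)^-1)%:E *
     \sum_(1 <= k < n.+1)
       'E_P[fun w => (eta k w ^+ 2 *
              \1_[set w' | eps * Num.sqrt (tau2 n) < `|eta k w'|] w)%R])%E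
    @[n --> \oo] --> 0%E.

End branching_process.

(* Main.v *)
(** Write b^2 for the offspring variance, A_n = E Z_n and R_n for the numerator
    of the estimator minus b^2 times its denominator.  With U_k the centered
    offspring sum of generation k and e_k = xi_k - alpha_k, the square
    (U_k + e_k)^2 = U_k^2 + 2 U_k e_k + e_k^2 shows that R_n is a martingale
    with increments Z_{k-1} (2 L_k + Q_k + 2 U_k e_k + eta_k), where L_k is the
    sum of the products of two distinct centered offspring numbers and Q_k that
    of their centered squares.  Kolmogorov's inequality keeps Z within
    del * A_n of its mean up to time n, and on that event an L^2 bound for
    martingale transforms replaces R_n by the sum of the independent variables
    A_{k-1} (2 L_k(m_k) + eta_k), where L_k(m_k) only involves the first
    m_k = floor(A_{k-1}) individuals.  Their variances are summed by Karamata's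
    theorem.  The Lindeberg condition is assumed for eta_k; for L_k it follows
    from sixth moments after truncating the offspring numbers.  The central
    limit theorem is obtained by Lindeberg's replacement argument with test
    functions u -> Phi (u / sqrt s), which solve the heat equation in (s, u). *)
Require Import Defs.
From HB Require Import structures.
From mathcomp Require Import all_boot all_order all_algebra finmap.
From mathcomp Require Import all_classical all_reals all_analysis.
From mathcomp Require Import measurable_realfun ring lra.

Set Implicit Arguments.
Unset Strict Implicit.
Unset Printing Implicit Defensive.

Import Order.TTheory GRing.Theory Num.Theory.
Import numFieldNormedType.Exports.

Local Open Scope classical_set_scope.
Local Open Scope ring_scope.

(** * The heat kernel of the normal law *)

Section calculus.
Context {R : realType}.

(** Conditional expectations are avoided throughout. The population [Z k] takes values in [nat] and
    depends on generations up to [k], of which generation [k.+1] is independent; an expectation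
    given the past is therefore computed by splitting along the values of [Z k]. Freezing the number
    of individuals at [m_k] makes the summands functions of disjoint generations, so that a limit
    theorem for rows of independent variables is enough.

    The normalisation [norm2] is n A_n^4 + A_n^2 tau_n^2, the order of the offspring noise plus that
    of the immigration noise, and theta_n is the share of the former. The weighted cross terms U_k
    e_k have a total variance of order A_n^3 times the sum of the beta_k^2; the two alternatives in
    (D) make it negligible against one or the other part of [norm2].

    The limit variance vanishes when b = 0 and theta = 1, so nothing may be divided by it. A
    smoothing variance a^4 is added to it, and a tends to 0 only after n has tended to infinity. For
    this reason the test functions carry the variance as a parameter, with bounds uniform above a
    positive level. *)

Lemma scale_regE (a b : R) : a *: (b : R^o) = a * b.
Proof. by []. Qed.

Lemma is_derive_affine (f : R -> R) (f1 a b t : R) :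
  is_derive (a + b * t) 1 f f1 ->
  is_derive t 1 (fun s => f (a + b * s)) (f1 * b).
Proof.
move=> h.
have h2 : is_derive t 1 (fun s : R => a + b * s) b.
  by apply: is_derive_eq; rewrite /GRing.scale /= ?(mulr0, addr0, add0r, mulr1) mul1r.
have := @is_derive1_comp _ f (fun s : R => a + b * s) t f1 b h h2.
by [].
Qed.

Lemma mvt_bound (f f1 : R -> R) (h B : R) :
  (forall x : R, is_derive x 1 f (f1 x)) -> f 0 = 0 ->
  (forall t : R, `|t| <= `|h| -> `|f1 t| <= B) -> `|f h| <= B * `|h|.
Proof.
move=> df f0 fB.
have cf (a b : R) : {within `[a, b], continuous f}.
  apply: derivable_within_continuous => x _.
  exact: (@ex_derive _ _ _ _ _ _ _ (df x)).
have [h0|h0|->] := ltgtP h 0; last by rewrite f0 !normr0 mulr0.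
- have [c] := @MVT _ f f1 h 0 h0 (fun x _ => df x) (cf _ _).
  rewrite in_itv /= => /andP[hc c0] fE.
  have -> : f h = f1 c * h by move: fE; rewrite f0; lra.
  rewrite normrM ler_wpM2r// fB//.
  by rewrite !ltr0_norm//; lra.
- have [c] := @MVT _ f f1 0 h h0 (fun x _ => df x) (cf _ _).
  rewrite in_itv /= => /andP[hc c0] fE.
  have -> : f h = f1 c * h by move: fE; rewrite f0; lra.
  rewrite normrM ler_wpM2r// fB//.
  by rewrite !gtr0_norm//; lra.
Qed.

Lemma lipschitz_mvt (f f1 : R -> R) (B : R) :
  (forall x : R, is_derive x 1 f (f1 x)) -> (forall t : R, `|f1 t| <= B) ->
  forall x y, `|f y - f x| <= B * `|y - x|.
Proof.
move=> df fB x y.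
have := @mvt_bound (fun t => f (x + 1 * t) - f x) (fun t => f1 (x + 1 * t)) (y - x) B.
have -> : x + 1 * (y - x) = y by ring.
apply.
- move=> t; have := is_derive_affine (df (x + 1 * t)).
  rewrite mulr1 => h; apply: is_derive_eq. by rewrite subr0.
- by rewrite mulr0 addr0 subrr.
- by move=> t _; exact: fB.
Qed.

(** A one-sided version for the variance variable of the heat kernel: derivatives exist there at
    positive arguments only, so the hypotheses are confined to the segment from [s] to [s + h]. *)
Lemma mvt_bound_ge0 (f f1 : R -> R) (s h B : R) : 0 <= h ->
  (forall t : R, 0 <= t <= h -> is_derive (s + 1 * t) 1 f (f1 (s + 1 * t))) ->
  (forall t : R, 0 <= t <= h -> `|f1 (s + 1 * t)| <= B) ->
  `|f (s + 1 * h) - f s| <= B * h.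
Proof.
move=> h0 df fB.
pose g t := f (s + 1 * t).
have dg (t : R) : 0 <= t <= h -> is_derive t 1 g (f1 (s + 1 * t)).
  by move=> th; have := is_derive_affine (df _ th); rewrite mulr1.
have cg : {within `[0, h], continuous g}.
  apply: derivable_within_continuous => x; rewrite in_itv /= => xh.
  exact: (@ex_derive _ _ _ _ _ _ _ (dg x xh)).
have [|c] := @MVT_segment _ g (fun t => f1 (s + 1 * t)) 0 h h0 _ cg.
  by move=> x; rewrite in_itv /= => /andP[hc c0]; apply: dg; rewrite !ltW.
rewrite in_itv /= => ch; rewrite /g mulr0 addr0 subr0 => ->.
by rewrite normrM (ger0_norm h0) ler_wpM2r// fB.
Qed.

(** The mean value bound is applied to [f] minus its tangent and then to [f1]; the factor 1/2 of
    Taylor's formula is given away. *)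
Lemma taylor1_bound (f f1 f2 : R -> R) (s h B : R) : 0 <= h -> 0 <= B ->
  (forall t : R, 0 <= t <= h -> is_derive (s + 1 * t) 1 f (f1 (s + 1 * t))) ->
  (forall t : R, 0 <= t <= h -> is_derive (s + 1 * t) 1 f1 (f2 (s + 1 * t))) ->
  (forall t : R, 0 <= t <= h -> `|f2 (s + 1 * t)| <= B) ->
  `|f (s + h) - f s - f1 s * h| <= B * h ^+ 2.
Proof.
move=> h0 B0 df df1 fB.
pose g t := f t - f1 s * t.
pose g1 t := f1 t - f1 s.
have dg (t : R) : 0 <= t <= h -> is_derive (s + 1 * t) 1 g (g1 (s + 1 * t)).
  move=> th; have H := df _ th; apply: is_derive_eq.
  by rewrite !scale_regE mulr1.
have gB (t : R) : 0 <= t <= h -> `|g1 (s + 1 * t)| <= B * h.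
  move=> /andP[t0 th]; apply: (@le_trans _ _ (B * t)); last by rewrite ler_wpM2l.
  apply: (mvt_bound_ge0 t0 (f1 := f2)).
    by move=> r /andP[r0 rt]; apply: df1; rewrite r0 (le_trans rt).
  by move=> r /andP[r0 rt]; apply: fB; rewrite r0 (le_trans rt).
have := mvt_bound_ge0 h0 dg gB; rewrite /g mul1r -mulrA -expr2.
by congr (`|_| <= _); ring.
Qed.

(** Stated with the oscillation of [f2] around [u], so that it yields both the cubic remainder, when
    [f2] is Lipschitz, and the quadratic one, when [f2] is bounded. *)
Lemma taylor2_bound (f f1 f2 : R -> R) (B u h : R) :
  (forall x : R, is_derive x 1 f (f1 x)) -> (forall x : R, is_derive x 1 f1 (f2 x)) ->
  (forall t : R, `|t| <= `|h| -> `|f2 (u + 1 * t) - f2 u| <= B) ->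
  `|f (u + h) - f u - f1 u * h - f2 u / 2 * h ^+ 2| <= B * `|h| ^+ 2.
Proof.
move=> df df1 fB.
pose g t := f (u + 1 * t) - f u - f1 u * t - f2 u / 2 * t ^+ 2.
pose g1 t := f1 (u + 1 * t) - f1 u - f2 u * t.
have dg (t : R) : is_derive t 1 g (g1 t).
  have := is_derive_affine (df (u + 1 * t)).
  rewrite mulr1 /g /g1 => H; apply: is_derive_eq.
  by rewrite !scale_regE !mulr1 !subr0; field.
have g0 : g 0 = 0 by rewrite /g !mulr0 addr0 subrr expr0n /= mulr0 !subr0.
have -> : f (u + h) - f u - f1 u * h - f2 u / 2 * h ^+ 2 = g h.
  by rewrite /g mul1r.
rewrite expr2 mulrA; apply: mvt_bound dg g0 _ => t th.
have -> : g1 t = f1 (u + t) - f1 u - f2 u * t by rewrite /g1 mul1r.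
pose k s := f1 (u + 1 * s) - f1 u - f2 u * s.
have dk (s : R) : is_derive s 1 k (f2 (u + 1 * s) - f2 u).
  have := is_derive_affine (df1 (u + 1 * s)).
  rewrite mulr1 /k => H; apply: is_derive_eq.
  by rewrite !scale_regE !mulr1 !subr0.
have k0 : k 0 = 0 by rewrite /k !mulr0 addr0 subrr subr0.
have -> : f1 (u + t) - f1 u - f2 u * t = k t by rewrite /k mul1r.
have B0 : 0 <= B by apply: le_trans (fB 0 _); rewrite ?normr0.
apply: (@le_trans _ _ (B * `|t|)); last by rewrite ler_wpM2l.
by apply: mvt_bound dk k0 _ => s st; apply: fB; rewrite (le_trans st).
Qed.

End calculus.

Section standard_normal.
Context {R : realType}.
Implicit Types x u s : R.

Definition phi x : R := normal_pdf 0 1 x.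
Definition Phi x : R := fine (normal_prob 0 1 `]-oo, x]%classic).

Lemma phiE x : phi x = normal_peak 1 * expR (- (x ^+ 2) / 2).
Proof.
rewrite /phi normal_pdfE ?oner_neq0// /normal_fun subr0 expr1n.
by rewrite -mulr_natr mul1r.
Qed.

Lemma is_derive_normal_prob (c x : R) : c != 0 ->
  is_derive x 1 (fun y => fine (normal_prob 0 c `]-oo, y]%classic)) (normal_pdf 0 c x).
Proof.
move=> c0.
have [|||d1 d2] := @continuous_FTC1 R (normal_pdf 0 c) (-oo)%O x (x + 1) _ _ (ltNyr x).
- by rewrite ltrDl.
- apply: (@integrableS _ _ _ _ setT) => //.
  exact: integrable_normal_pdf.
- by apply: continuous_normal_pdf.
apply: DeriveDef; first exact: d1.
by rewrite -derive1E.
Qed.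

(** [psi] and [psi'] are the first and second derivatives of [phi]. *)
Definition psi x : R := - x * phi x.
Definition psi' x : R := (x ^+ 2 - 1) * phi x.

Lemma is_derive_Phi x : is_derive x 1 (Phi : R -> R) (phi x).
Proof. by apply: is_derive_normal_prob; rewrite oner_neq0. Qed.

Lemma is_derive_phi x : is_derive x 1 (phi : R -> R) (psi x).
Proof.
have -> : phi = (fun x => normal_peak 1 * expR (- (x ^+ 2) / 2)) :> (R -> R).
  by apply/funext => y; exact: phiE.
have h : is_derive x 1 (fun x : R => - (x ^+ 2) / 2) (- x).
  by apply: is_derive_eq; rewrite !scale_regE !mulr1; field.
have h2 := @is_derive1_comp _ (@expR R) (fun x : R => - (x ^+ 2) / 2) x _ _ (is_derive_expR _) h.
apply: is_derive_eq.
by rewrite scale_regE /psi phiE; ring.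
Qed.

Lemma is_derive_psi x : is_derive x 1 (psi : R -> R) (psi' x).
Proof.
have h := is_derive_phi x.
apply: is_derive_eq.
by rewrite !scale_regE /psi' /psi; ring.
Qed.

Lemma phi_ge0 x : 0 <= phi x. Proof. exact: normal_pdf_ge0. Qed.

(** Squaring [1 + x ^+ 2 / 4 <= expR (x ^+ 2 / 4)] gives decay of order 4, enough for the products
    of [phi] with polynomials that occur below. The peak is at most 1 because pi is at least 2. *)
Lemma phi_le x : phi x * (1 + x ^+ 2 / 4) ^+ 2 <= 1.
Proof.
have p1 : normal_peak 1 <= 1 :> R.
  rewrite /normal_peak invf_le1 ?sqrtr_gt0.
    rewrite -[leLHS]sqrtr1 ler_sqrt.
      by have := @pi_ge2 R; rewrite expr1n mul1r; lra.
    by have := @pi_ge2 R; rewrite expr1n mul1r; lra.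
  by have := @pi_ge2 R; rewrite expr1n mul1r; lra.
have := expR_ge1Dx (x ^+ 2 / 4) => e1.
have e2 : (1 + x ^+ 2 / 4) ^+ 2 <= expR (x ^+ 2 / 2).
  apply: (@le_trans _ _ (expR (x ^+ 2 / 4) ^+ 2)).
    by rewrite ler_pXn2r// nnegrE ?expR_ge0// addr_ge0// divr_ge0// sqr_ge0.
  rewrite -expRM_natl ler_expR. lra.
rewrite phiE.
apply: (@le_trans _ _ (1 * expR (- (x ^+ 2) / 2) * expR (x ^+ 2 / 2))).
  apply: ler_pM => //.
  - by rewrite mulr_ge0 ?normal_peak_ge0 ?expR_ge0.
  - exact: sqr_ge0.
  - by rewrite ler_wpM2r ?expR_ge0.
by rewrite mul1r -expRD mulNr addNr expR0.
Qed.

Lemma phi_bound x a : 0 <= a -> a <= 16 * (1 + x ^+ 2 / 4) ^+ 2 -> a * phi x <= 16.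
Proof.
move=> a0 ha; have := phi_le x; have := phi_ge0 x.
move: ha; set b := (1 + _) ^+ 2; nra.
Qed.

Lemma norm_phi_bound x a : `|a| <= 16 * (1 + x ^+ 2 / 4) ^+ 2 -> `|a * phi x| <= 16.
Proof.
by move=> h; rewrite normrM (ger0_norm (phi_ge0 x)); exact: phi_bound.
Qed.

Lemma psi_bound x : `|psi x| <= 16.
Proof.
apply: norm_phi_bound; rewrite normrN.
have := sqr_ge0 (`|x| - 1); have := real_normK (num_real x).
have := sqr_ge0 (x ^+ 2); nra.
Qed.

Lemma psi'_bound x : `|psi' x| <= 16.
Proof.
apply: norm_phi_bound; rewrite ler_norml.
have := sqr_ge0 x; have := sqr_ge0 (x ^+ 2) => h1 h2; apply/andP; split; nra.
Qed.

Lemma mul_psi'_bound x : `|x * psi' x| <= 16.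
Proof.
rewrite /psi' mulrA; apply: norm_phi_bound; rewrite normrM.
have h2 := real_normK (num_real x).
have h3 : `|x ^+ 2 - 1| <= x ^+ 2 + 1.
  rewrite ler_norml; have := sqr_ge0 x => h1; apply/andP; split; lra.
apply: (le_trans (ler_wpM2l _ h3)) => //.
rewrite -h2; move: `|x| (normr_ge0 x) => y y0.
have := sqr_ge0 (y ^+ 2 - y); have := sqr_ge0 (y-1); nra.
Qed.

(** H s u is the probability that a centered normal variable of variance s is at
   most u; it solves the heat equation. *)
Definition H s u : R := Phi (u / Num.sqrt s).

Lemma is_derive_divr (w u : R) : is_derive u 1 (fun v : R => v / w) (w^-1).
Proof.
by apply: is_derive_eq; rewrite !scale_regE !mulr1 ?mulr0 ?addr0 ?add0r.
Qed.

Lemma is_derive_H s u : is_derive u 1 (H s) (phi (u / Num.sqrt s) / Num.sqrt s).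
Proof.
exact: (@is_derive1_comp _ Phi (fun v => v / Num.sqrt s) u _ _
  (is_derive_Phi _) (is_derive_divr _ _)).
Qed.

Lemma is_derive2_H s u : 0 < s -> is_derive u 1 (fun u => phi (u / Num.sqrt s) / Num.sqrt s)
   (psi (u / Num.sqrt s) / s).
Proof.
move=> s0.
have h := (@is_derive1_comp _ phi (fun v => v / Num.sqrt s) u _ _
  (is_derive_phi _) (is_derive_divr _ _)).
have -> : psi (u / Num.sqrt s) / s =
  (Num.sqrt s)^-1 *: (psi (u / Num.sqrt s) * (Num.sqrt s)^-1 : R^o).
  rewrite scale_regE mulrCA -invfM -expr2 sqr_sqrtr//. exact: ltW.
have -> : (fun u => phi (u / Num.sqrt s) / Num.sqrt s) =
   (Num.sqrt s)^-1 *: (phi \o (fun v => v / Num.sqrt s) : R -> R^o).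
  by apply/funext => v; rewrite /= mulrC.
exact: is_deriveZ.
Qed.

Lemma is_derive_rsqrt s u : 0 < s ->
  is_derive s 1 (fun s => u / Num.sqrt s) (- (u / Num.sqrt s) / (2 * s)).
Proof.
move=> s0.
have q0 : Num.sqrt s != 0 by rewrite gt_eqF// sqrtr_gt0.
have h := is_derive1_sqrt s0.
apply: is_derive_eq.
rewrite !scale_regE -[X in _ = _ / (2 * X)](sqr_sqrtr (ltW s0)).
by field.
Qed.

(** Half the second derivative in [u] found in [is_derive2_H]: this is the heat equation. *)
Lemma is_derive_H_time s u : 0 < s ->
  is_derive s 1 (fun s => H s u) (psi (u / Num.sqrt s) / s / 2).
Proof.
move=> s0.
have h := (@is_derive1_comp _ Phi (fun s => u / Num.sqrt s) s _ _
  (is_derive_Phi _) (is_derive_rsqrt u s0)).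
have -> : psi (u / Num.sqrt s) / s / 2 = phi (u / Num.sqrt s) * (- (u / Num.sqrt s) / (2 * s)).
  have q0 : Num.sqrt s != 0 by rewrite gt_eqF// sqrtr_gt0.
  have s1 : s != 0 by rewrite gt_eqF.
  by rewrite /psi; field; rewrite ?q0 ?s1.
exact: h.

Qed.

Lemma is_derive_div_id (f : R -> R) f1 s : s != 0 -> is_derive s 1 f f1 ->
  is_derive s 1 (fun s => f s / s / 2) ((f1 - f s / s) / s / 2).
Proof.
move=> s0 h.
have -> : (f1 - f s / s) / s / 2 = (f1 * s^-1 + f s * (- s ^- 2)) / 2.
  by field.
have hV : is_derive s 1 (fun x : R => x^-1) (- s ^- 2).
  have := @is_deriveV R id s 1 1 s0 (is_derive_id _ _).
  by rewrite scale_regE mulr1.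
have hM := is_deriveM h hV.
have hZ := is_deriveZ (2^-1) hM.
have -> : (fun s => f s / s / 2) =
    2^-1 *: ((f * (fun x : R => x^-1)) : R -> R^o).
  by apply/funext => x; rewrite mulrC.
apply: is_derive_eq.
by rewrite !scale_regE; ring.
Qed.

Lemma is_derive2_H_time s u : 0 < s ->
  is_derive s 1 (fun s => psi (u / Num.sqrt s) / s / 2)
   (- (u / Num.sqrt s * psi' (u / Num.sqrt s) / 2 + psi (u / Num.sqrt s)) / s ^+ 2 / 2).
Proof.
move=> s0.
have s1 : s != 0 by rewrite gt_eqF.
have q0 : Num.sqrt s != 0 by rewrite gt_eqF// sqrtr_gt0.
have h : is_derive s 1 (fun s => psi (u / Num.sqrt s)) _ :=
 (@is_derive1_comp _ psi (fun s => u / Num.sqrt s) s _ _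
  (is_derive_psi _) (is_derive_rsqrt u s0)).
have := is_derive_div_id s1 h.
congr is_derive.
by field; rewrite ?q0 ?s1.
Qed.

(** For [s >= e] the powers of [1 / s] are bounded by powers of [1 / e], so one constant serves all
    bounds. Of the two remainders in [w], the cubic one is meant for small increments and the
    quadratic one for the truncated part in Lindeberg's condition. *)
Lemma H_bounds (e : R) : 0 < e -> exists2 K : R, 0 <= K &
  forall s u w v : R, e <= s -> 0 <= v ->
  [/\ `|H s (u - w) - H s u + phi (u / Num.sqrt s) / Num.sqrt s * w
        - psi (u / Num.sqrt s) / s / 2 * w ^+ 2| <= K * `|w| ^+ 3,
     `|H s (u - w) - H s u + phi (u / Num.sqrt s) / Num.sqrt s * w
        - psi (u / Num.sqrt s) / s / 2 * w ^+ 2| <= K * w ^+ 2,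
     `|H (s + v) u - H s u - psi (u / Num.sqrt s) / s / 2 * v| <= K * v ^+ 2,
     `|phi (u / Num.sqrt s) / Num.sqrt s| <= K &
     `|psi (u / Num.sqrt s) / s| <= K].
Proof.
move=> e0; set c := e^-1.
have c0 : 0 < c by rewrite invr_gt0.
(* Dominates the constants [16 * (1 + c) * c], [32 * c], [12 * c ^+ 2], [16 * (1 + c)] and [16 * c]
   of the five bounds. *)
exists (32 * (1 + c) ^+ 2); first by rewrite mulr_ge0// sqr_ge0.
move=> s u w v es v0.
have s0 : 0 < s by exact: lt_le_trans es.
have sc t : e <= t -> 0 <= t^-1 <= c.
  move=> et; have t0 : 0 < t by exact: lt_le_trans et.
  by rewrite invr_ge0 (ltW t0) /= lef_pV2 ?posrE.
have qc : 0 <= (Num.sqrt s)^-1 <= 1 + c.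
  rewrite invr_ge0 sqrtr_ge0 /=.
  have : (Num.sqrt s)^-1 ^+ 2 = s^-1 by rewrite exprVn sqr_sqrtr// ltW.
  by have /andP[_] := sc _ es; have := sqr_ge0 ((Num.sqrt s)^-1 - 1); nra.
have psiB t : `|psi (t / Num.sqrt s) / s| <= 16 * c.
  rewrite normrM ler_pM//; first exact: psi_bound.
  by have /andP[? ?] := sc _ es; rewrite ger0_norm.
have lip t t' : `|psi (t' / Num.sqrt s) / s - psi (t / Num.sqrt s) / s| <=
   16 * (1 + c) * c * `|t' - t|.
  rewrite -mulrBl normrM.
  have := lipschitz_mvt is_derive_psi psi'_bound (t / Num.sqrt s) (t' / Num.sqrt s).
  rewrite -mulrBl normrM.
  have /andP[? ?] := sc _ es; have /andP[? ?] := qc.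
  rewrite (ger0_norm (x := s^-1))// (ger0_norm (x := (Num.sqrt s)^-1))//.
  move: (normr_ge0 (t' - t)).
  move: `|t' - t| (Num.sqrt s)^-1 s^-1 qc (sc s es) => a b q /andP[b0 b1] /andP[q0 q1] a0 h.
  apply: (le_trans (ler_wpM2r q0 h)).
  rewrite -!mulrA ler_wpM2l//.
  rewrite [leLHS]mulrC [leRHS]mulrA.
  by rewrite ler_pM ?mulr_ge0// ler_pM.
have tay (B : R) : (forall t : R, `|t| <= `|- w| ->
    `|psi ((u + 1 * t) / Num.sqrt s) / s - psi (u / Num.sqrt s) / s| <= B) ->
  `|H s (u - w) - H s u + phi (u / Num.sqrt s) / Num.sqrt s * w
        - psi (u / Num.sqrt s) / s / 2 * w ^+ 2| <= B * `|w| ^+ 2.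
  move=> hB.
  have := taylor2_bound (is_derive_H s) (fun u => is_derive2_H u s0) hB.
  by rewrite mulrN opprK sqrrN normrN.
split.
- apply: (le_trans (tay (16 * (1 + c) * c * `|w|) _)).
    move=> t; rewrite normrN => tw; apply: (le_trans (lip _ _)).
    rewrite mul1r addrAC subrr add0r ler_wpM2l//.
    by rewrite !mulr_ge0//; lra.
  by rewrite -[leLHS]mulrA -exprS ler_wpM2r ?exprn_ge0//; nra.
- have := tay (32 * c) _; rewrite real_normK ?num_real// => h.
  apply: (le_trans (h _)).
    move=> t _; apply: (le_trans (ler_normB _ _)).
    by have := psiB u; have := psiB (u + 1 * t); lra.
  by rewrite ler_wpM2r ?sqr_ge0//; nra.
- apply: (@taylor1_bound _ (fun s => H s u) (fun s => psi (u / Num.sqrt s) / s / 2)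
    (fun s => - (u / Num.sqrt s * psi' (u / Num.sqrt s) / 2 +
               psi (u / Num.sqrt s)) / s ^+ 2 / 2) s v) => //.
  + by rewrite mulr_ge0// sqr_ge0.
  + by move=> t /andP[t0 _]; apply: is_derive_H_time; rewrite mul1r ltr_wpDr.
  + by move=> t /andP[t0 _]; apply: is_derive2_H_time; rewrite mul1r ltr_wpDr.
  + move=> t /andP[t0 _].
    have : e <= s + 1 * t by rewrite mul1r ler_wpDr.
    move: (s + 1 * t) => r er.
    have /andP[r0 r1] := sc _ er.
    have := mul_psi'_bound (u / Num.sqrt r); have := psi_bound (u / Num.sqrt r).
    rewrite -exprVn.
    set x := psi _; set y := _ * psi' _ => hx hy.
    rewrite -mulrA mulNr normrN normrM (ger0_norm (x := r^-1 ^+ 2 / 2)); last first.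
      by rewrite mulr_ge0 ?sqr_ge0.
    have : `|y / 2 + x| <= 24.
      apply: (le_trans (ler_normD _ _)); rewrite normrM (ger0_norm (x := 2^-1))//.
      by lra.
    have : r^-1 ^+ 2 <= c ^+ 2 by rewrite ler_pXn2r// nnegrE// ltW.
    move: (sqr_ge0 r^-1) (normr_ge0 (y / 2 + x)).
    move: `|y / 2 + x| (r^-1 ^+ 2) => a b; nra.
- rewrite normrM (ger0_norm (x := (Num.sqrt s)^-1)); last by case/andP: qc.
  have := @norm_phi_bound (u / Num.sqrt s) 1 _; rewrite mul1r => h.
  apply: (@le_trans _ _ (16 * (1 + c))); last by nra.
  case/andP: qc => ? ?; rewrite ler_pM// h// normr1.
  by have := sqr_ge0 (u / Num.sqrt s); nra.
- by apply: (le_trans (psiB u)); nra.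
Qed.

Lemma Phi_itv x : normal_prob 0 1 `]-oo, x]%classic = (Phi x)%:E.
Proof.
rewrite /Phi fineK//.
exact: (@fin_num_measure _ _ _ (normal_prob 0 1)).
Qed.

Lemma Phi_ge0 x : 0 <= Phi x.
Proof. by rewrite fine_ge0. Qed.

Lemma Phi_le1 x : Phi x <= 1.
Proof.
by rewrite -lee_fin -Phi_itv; exact: (@probability_le1 _ _ _ (normal_prob 0 1)).
Qed.

Lemma Phi_nd x y : x <= y -> Phi x <= Phi y.
Proof.
move=> xy; rewrite -lee_fin -!Phi_itv; apply: le_measure; rewrite ?inE//.
by move=> z /=; rewrite !in_itv /= => /le_trans; apply.
Qed.

(** The identity is made a random variable on the line, so that the limits of distribution functions
    apply to a probability measure on the line itself. *)
Let idTR : measurableTypeR R -> R := idfun.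

#[local] HB.instance Definition _ :=
  @isMeasurableFun.Build _ _ _ _ idTR (@measurable_id _ _ setT).

Lemma probability_itvNy_cvgNy (P : probability (measurableTypeR R) R) :
  fine (P `]-oo, x]%classic) @[x --> -oo] --> (0 : R).
Proof. exact/fine_cvg/(cvg_cdfNy0 (idTR : {RV P >-> R})). Qed.

Lemma probability_itvNy_cvgy (P : probability (measurableTypeR R) R) :
  fine (P `]-oo, x]%classic) @[x --> +oo] --> (1 : R).
Proof. exact/fine_cvg/(cvg_cdfy1 (idTR : {RV P >-> R})). Qed.

Lemma Phi_cvgNy : Phi x @[x --> -oo] --> (0 : R).
Proof. exact: (@probability_itvNy_cvgNy (normal_prob 0 1)). Qed.

Lemma Phi_cvgy : Phi x @[x --> +oo] --> (1 : R).
Proof. exact: (@probability_itvNy_cvgy (normal_prob 0 1)). Qed.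

(** Both sides have the same derivative in [x], so they differ by a constant, and both vanish at
    minus infinity. *)
Lemma H_normal_prob v (x : R) : 0 < v ->
  normal_prob 0 (Num.sqrt v) `]-oo, x]%classic = (H v x)%:E.
Proof.
move=> v0.
have p0 : 0 < Num.sqrt v by rewrite sqrtr_gt0.
have q0 : Num.sqrt v != 0 by rewrite gt_eqF.
pose F (y : R) := fine (normal_prob 0 (Num.sqrt v) `]-oo, y]%classic).
suff -> : H v x = F x.
  by rewrite /F fineK//; exact: (@fin_num_measure _ _ _ (normal_prob 0 (Num.sqrt v))).
have dE (y : R) : normal_pdf 0 (Num.sqrt v) y = phi (y / Num.sqrt v) / Num.sqrt v.
  rewrite phiE normal_pdfE// /normal_fun subr0 /normal_peak expr1n mul1r.
  rewrite -mulrnAr sqrtrM ?sqr_ge0// sqrtr_sqr gtr0_norm// invfM.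
  rewrite -[RHS]mulrAC [_ / Num.sqrt v]mulrC; congr (_ * expR _).
  by rewrite -mulr_natr; field.
have dF (y : R) : is_derive y 1 (fun y => H v y - F y) (0 : R).
  have h1 := is_derive_H v y.
  have h2 : is_derive y 1 (F : R -> R) (normal_pdf 0 (Num.sqrt v) y).
    exact: is_derive_normal_prob.
  by apply: is_derive_eq; rewrite dE subrr.
have cst (y : R) : H v y - F y = H v x - F x.
  apply/eqP; rewrite -subr_eq0 -normr_le0.
  have := @lipschitz_mvt _ (fun y => H v y - F y) (fun=> 0) 0 dF.
  by move=> /(_ _ x y); rewrite mul0r; apply => t; rewrite normr0.
have FNy : F y @[y --> -oo] --> (0 : R).
  exact: (@probability_itvNy_cvgNy (normal_prob 0 (Num.sqrt v))).
have HNy : H v y @[y --> -oo] --> (0 : R).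
  apply: (@cvg_comp _ _ _ (fun y => y / Num.sqrt v) Phi _ (-oo)); last exact: Phi_cvgNy.
  apply/cvgrNyPle => A; near=> t.
  rewrite ler_pdivrMr//; near: t; exact: nbhs_ninfty_le.
have := cvgB HNy FNy.
rewrite (_ : [eta H v] - [eta F] = (fun=> H v x - F x)); last by apply/funext => y; exact: cst.
rewrite subr0 => h.
apply/eqP; rewrite -subr_eq0; apply/eqP.
apply: (cvg_unique _ (@cvg_cst R _ _ (-oo : set_system R) _) (h _)).
exact: Rhausdorff.
Unshelve. all: end_near.
Qed.

Lemma H_continuous s u : 0 < s -> {for s, continuous (fun s => H s u)}.
Proof.
move=> s0; apply: differentiable_continuous; apply/derivable1_diffP.
exact: (@ex_derive _ _ _ _ _ _ _ (is_derive_H_time u s0)).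
Qed.

Lemma measurable_H s : measurable_fun setT (H s).
Proof.
apply: continuous_measurable_fun => u.
apply: differentiable_continuous; apply/derivable1_diffP.
exact: (@ex_derive _ _ _ _ _ _ _ (is_derive_H s u)).
Qed.

Lemma H_continuous2 s : continuous (H s).
Proof.
move=> u.
apply: differentiable_continuous; apply/derivable1_diffP.
exact: (@ex_derive _ _ _ _ _ _ _ (is_derive_H s u)).
Qed.

Lemma measurable_H1 s : 0 < s -> measurable_fun setT (fun u => phi (u / Num.sqrt s) / Num.sqrt s).
Proof.
move=> s0; apply: continuous_measurable_fun => u.
apply: differentiable_continuous; apply/derivable1_diffP.
exact: (@ex_derive _ _ _ _ _ _ _ (is_derive2_H u s0)).
Qed.

Lemma measurable_H2 s : 0 < s -> measurable_fun setT (fun u => psi (u / Num.sqrt s) / s).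
Proof.
move=> s0; apply: continuous_measurable_fun => u.
apply: differentiable_continuous; apply/derivable1_diffP.
have h := (@is_derive1_comp _ psi (fun v => v / Num.sqrt s) u _ _
  (is_derive_psi _) (is_derive_divr _ _)).
have -> : (fun u => psi (u / Num.sqrt s) / s) =
   s^-1 *: (psi \o (fun v => v / Num.sqrt s) : R -> R^o).
  by apply/funext => v; rewrite /= mulrC.
exact: (@ex_derive _ _ _ _ _ _ _ (is_deriveZ _ h)).
Qed.

End standard_normal.

(** * Vanishing smoothing, including a degenerate limit law *)

Section smoothing.
Variable R : realType.
Implicit Types s x k : R.

Lemma Phi_continuous : continuous (@Phi R).
Proof.
have -> : @Phi R = H 1 by apply/funext => u; rewrite /H sqrtr1 divr1.
exact: H_continuous2.
Qed.

Lemma smoothing_pos s x k : 0 < s -> H (a ^+ 4 + s) (x + k * a) @[a --> 0^'+] --> H s x.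
Proof.
move=> s0; rewrite /H.
suff h : (x + k * a) / Num.sqrt (a ^+ 4 + s) @[a --> (0 : R)] --> x / Num.sqrt s.
  by apply: cvg_at_right_filter; exact: (continuous_cvg _ (@Phi_continuous _) h).
have sq : Num.sqrt (a ^+ 4 + s) @[a --> (0 : R)] --> Num.sqrt s.
  have h : a ^+ 4 + s @[a --> (0 : R)] --> s.
    rewrite -[X in _ --> X]add0r -[X in _ --> X + s](expr0n R 4).
    by apply: cvgD; [exact: exprn_continuous|exact: cvg_cst].
  exact: (cvg_comp _ _ h (@sqrt_continuous R s)).
apply: cvgM.
  rewrite -[X in _ --> X]addr0 -[X in _ --> x + X](mulr0 k).
  by apply: cvgD; [exact: cvg_cst|apply: cvgM; [exact: cvg_cst|exact: cvg_id]].
by apply: cvgV => //; rewrite gt_eqF// sqrtr_gt0.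
Qed.

Lemma smoothing_ratio x k : 0 < x -> (x + k * a) / a ^+ 2 @[a --> 0^'+] --> +oo.
Proof.
move=> x0; apply/cvgryPge => M; near=> a.
have a0 : 0 < a by near: a; exact: nbhs_right_gt.
rewrite ler_pdivlMr ?exprn_gt0//.
have ka : - (k * a) <= x / 2.
  rewrite -mulNr; apply: (@le_trans _ _ ((`|k| + 1) * a)).
    by rewrite ler_wpM2r ?(ltW a0)// (le_trans (ler_norm _))// normrN lerDl.
  rewrite -ler_pdivlMl ?ltr_wpDl// mulrC; near: a; apply: nbhs_right_le.
  by rewrite !divr_gt0// ltr_wpDl.
have Ma : M * a ^+ 2 <= x / 2.
  have a1 : a <= 1 by near: a; exact: nbhs_right_le.
  apply: (@le_trans _ _ ((`|M| + 1) * a)).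
    apply: (@le_trans _ _ ((`|M| + 1) * a ^+ 2)).
      by rewrite ler_wpM2r ?sqr_ge0// (le_trans (ler_norm _))// lerDl.
    by rewrite ler_wpM2l ?addr_ge0// expr2 ler_piMr// ltW.
  rewrite -ler_pdivlMl ?ltr_wpDl// mulrC; near: a; apply: nbhs_right_le.
  by rewrite !divr_gt0// ltr_wpDl.
lra.
Unshelve. all: by end_near.
Qed.

Lemma sqrt_pow4 (y : R) : Num.sqrt (y ^+ 4 + 0) = y ^+ 2.
Proof. by rewrite addr0 (exprM y 2 2) sqrtr_sqr ger0_norm ?sqr_ge0. Qed.

Lemma smoothing_zero_pos x k : 0 < x -> H (a ^+ 4 + 0) (x + k * a) @[a --> 0^'+] --> (1 : R).
Proof.
move=> x0; rewrite /H; under eq_fun do rewrite sqrt_pow4.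
exact: (cvg_comp _ _ (smoothing_ratio k x0) (@Phi_cvgy R)).
Qed.

Lemma smoothing_zero_neg x k : x < 0 -> H (a ^+ 4 + 0) (x + k * a) @[a --> 0^'+] --> (0 : R).
Proof.
move=> x0; rewrite /H; under eq_fun do rewrite sqrt_pow4.
have h : (x + k * a) / a ^+ 2 @[a --> (0 : R)^'+] --> -oo.
  apply/cvgNry; have := @smoothing_ratio (- x) (- k); rewrite oppr_gt0 => /(_ x0).
  apply: cvg_trans; apply: near_eq_cvg; apply: nearW => a.
  by change ((- x + - k * a) / a ^+ 2 = - ((x + k * a) / a ^+ 2)); ring.
exact: (cvg_comp _ _ h (@Phi_cvgNy R)).
Qed.

(** For [s = 0] the standard deviation [a ^+ 2] of the smoothing is small against any [x] other than
    0, so the step function is recovered there. *)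
Lemma smoothing_limit s x k : 0 <= s ->
  {for x, continuous (fun y : R => centered_normal s `]-oo, y]%classic)} ->
  H (a ^+ 4 + s) (x + k * a) @[a --> 0^'+] --> fine (centered_normal s `]-oo, x]%classic).
Proof.
rewrite le_eqVlt => /orP[/eqP <-|s0] cx; last first.
  by rewrite /centered_normal (gt_eqF s0) H_normal_prob//; exact: smoothing_pos.
have E y : centered_normal (0 : R) `]-oo, y]%classic = ((0 <= y)%R%:R)%:E.
  rewrite /centered_normal eqxx diracE; congr ((nat_of_bool _)%:R%:E).
  by apply/idP/idP => [|h]; [rewrite inE /= in_itv|rewrite inE /= in_itv].
rewrite E /=; have [x0|x0|x0] := ltgtP 0 x.
- exact: smoothing_zero_pos.
- exact: smoothing_zero_neg.
(* At 0 the distribution function of the point mass has left limit 0 and value 1, so 0 is not a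
   continuity point. *)
exfalso; move: cx; rewrite -x0 /prop_for /continuous_at => cx.
have : centered_normal (0 : R) `]-oo, y]%classic @[y --> 0^'-] --> 1%:E.
  have := cvg_at_left_filter cx; rewrite E lexx; exact.
under eq_fun do rewrite E.
move=> /fine_cvgP [_] /= h.
have : (0 : R) @[y --> (0 : R)^'-] --> (1 : R).
  apply: cvg_trans h; apply: near_eq_cvg; near=> y.
  have : y < 0 by near: y; exact: nbhs_left_lt.
  by rewrite ltNge => /negbTE /= ->.
move=> /(cvg_lim (@norm_hausdorff _ R)); rewrite lim_cst//.
by move/eqP; rewrite eq_sym oner_eq0.
Unshelve. all: by end_near.
Qed.

End smoothing.

(** * Integrable functions and independence *)

Section expectation_kit.
Context d (T : measurableType d) (R : realType) (P : probability T R).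
Implicit Types f g h : T -> R.

(** [fine] sends an infinite integral to 0, so integrability travels separately as [L1]. *)
Definition Ex f : R := fine (\int[P]_w (f w)%:E)%E.
Definition L1 f := P.-integrable setT (EFin \o f).
(** Measurability is a separate conjunct because a measurable square does not make [f]
    measurable. *)
Definition L2 f := measurable_fun setT f /\ L1 (fun w => f w ^+ 2).

Lemma ExE f : L1 f -> (\int[P]_w (f w)%:E)%E = (Ex f)%:E.
Proof. by move=> h; rewrite /Ex fineK// integrable_fin_num. Qed.

Lemma L1_measurable f : L1 f -> measurable_fun setT f.
Proof. by move=> /measurable_int /measurable_EFinP. Qed.

Lemma L1D f g : L1 f -> L1 g -> L1 (fun w => f w + g w).
Proof. by move=> hf hg; exact: (integrableD _ hf hg). Qed.

Lemma L1Z (k : R) f : L1 f -> L1 (fun w => k * f w).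
Proof. by move=> hf; exact: (integrableZl _ k hf). Qed.

Lemma L1_cst (k : R) : L1 (fun=> k).
Proof. exact: finite_measure_integrable_cst. Qed.

Lemma L1N f : L1 f -> L1 (fun w => - f w).
Proof.
move=> /(L1Z (-1)); congr L1; apply/funext => w; by rewrite mulN1r.
Qed.

Lemma L1B f g : L1 f -> L1 g -> L1 (fun w => f w - g w).
Proof. by move=> hf hg; apply: L1D => //; exact: L1N. Qed.

Lemma L1_dom f g : measurable_fun setT f -> (forall w, `|f w| <= g w) -> L1 g -> L1 f.
Proof.
move=> mf fg hg; apply: le_integrable hg => //.
  exact/measurable_EFinP.
by move=> w _ /=; rewrite lee_fin (le_trans (fg w))// ler_norm.
Qed.

Lemma L1_norm f : L1 f -> L1 (fun w => `|f w|).
Proof. by move=> hf; exact: (integrable_norm hf). Qed.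

Lemma L1_bounded f (K : R) : measurable_fun setT f -> (forall w, `|f w| <= K) -> L1 f.
Proof. by move=> mf fK; exact: L1_dom (L1_cst K). Qed.

Lemma L1_bmul (c f : T -> R) (K : R) : measurable_fun setT c -> (forall w, `|c w| <= K) ->
  L1 f -> L1 (fun w => c w * f w).
Proof.
move=> mc cK hf; apply: (@L1_dom _ (fun w => K * `|f w|)).
- by apply: measurable_funM => //; exact: L1_measurable.
- by move=> w; rewrite normrM ler_wpM2r.
- by apply: L1Z; exact: L1_norm.
Qed.

Lemma ExD f g : L1 f -> L1 g -> Ex (fun w => f w + g w) = Ex f + Ex g.
Proof.
move=> hf hg; apply: EFin_inj; rewrite EFinD -!ExE//; last exact: L1D.
by rewrite -integralD.
Qed.

Lemma ExZ (k : R) f : L1 f -> Ex (fun w => k * f w) = k * Ex f.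
Proof.
move=> hf; apply: EFin_inj; rewrite EFinM -!ExE//; last exact: L1Z.
by rewrite -integralZl.
Qed.

Lemma Ex_cst (k : R) : Ex (fun=> k) = k.
Proof.
by rewrite /Ex integral_cst//= probability_setT mule1.
Qed.

Lemma ExN f : L1 f -> Ex (fun w => - f w) = - Ex f.
Proof.
move=> hf; rewrite -mulN1r -ExZ//; congr Ex; apply/funext => w; by rewrite mulN1r.
Qed.

Lemma ExB f g : L1 f -> L1 g -> Ex (fun w => f w - g w) = Ex f - Ex g.
Proof. by move=> hf hg; rewrite ExD ?ExN//; exact: L1N. Qed.

Lemma Ex_ge0 f : (forall w, 0 <= f w) -> 0 <= Ex f.
Proof. by move=> f0; rewrite fine_ge0// integral_ge0// => w _; rewrite lee_fin. Qed.

Lemma Ex_le f g : L1 f -> L1 g -> (forall w, f w <= g w) -> Ex f <= Ex g.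
Proof.
move=> hf hg fg; rewrite -subr_ge0 -ExB//; apply: Ex_ge0 => w.
by rewrite subr_ge0.
Qed.

Lemma Ex_norm_le f : L1 f -> `|Ex f| <= Ex (fun w => `|f w|).
Proof.
move=> hf; have hn := L1_norm hf; rewrite ler_norml; apply/andP; split.
  rewrite lerNl -ExN//; apply: Ex_le => //; first exact: L1N.
  by move=> w; rewrite lerNl lerNnormlW.
by apply: Ex_le => // w; exact: ler_norm.
Qed.

Lemma Ex_eq f g : (forall w, f w = g w) -> Ex f = Ex g.
Proof. by move=> fg; congr Ex; apply/funext. Qed.

Lemma L1_eq f g : (forall w, f w = g w) -> L1 f -> L1 g.
Proof. by move=> fg; congr L1; apply/funext. Qed.

Lemma L2_L1M f g : L2 f -> L2 g -> L1 (fun w => f w * g w).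
Proof.
move=> [mf hf] [mg hg]; apply: (@L1_dom _ (fun w => f w ^+ 2 + g w ^+ 2)).
- exact: measurable_funM.
- move=> w; rewrite normrM.
  have := sqr_ge0 (`|f w| - `|g w|); have := sqr_ge0 `|f w|; have := sqr_ge0 `|g w|.
  by rewrite sqrrB !real_normK ?num_real//; lra.
- exact: L1D.
Qed.

Lemma L2_cst (k : R) : L2 (fun=> k).
Proof. by split => //; exact: L1_cst. Qed.

Lemma L2_L1 f : L2 f -> L1 f.
Proof. by move=> /(L2_L1M (L2_cst 1)); apply: L1_eq => w; rewrite mul1r. Qed.

Lemma L2D f g : L2 f -> L2 g -> L2 (fun w => f w + g w).
Proof.
move=> hf hg; split; first by apply: measurable_funD; [case: hf|case: hg].
apply: (@L1_eq (fun w => f w ^+ 2 + g w ^+ 2 + 2 * (f w * g w))).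
  by move=> w; ring.
by apply: L1D; [apply: L1D; [case: hf|case: hg]|apply: L1Z; exact: L2_L1M].
Qed.

Lemma L2_bmul (c f : T -> R) (K : R) : measurable_fun setT c -> (forall w, `|c w| <= K) ->
  L2 f -> L2 (fun w => c w * f w).
Proof.
move=> mc cK [mf hf]; split; first exact: measurable_funM.
apply: (@L1_eq (fun w => c w ^+ 2 * f w ^+ 2)); first by move=> w; rewrite exprMn.
apply: (@L1_bmul _ _ (K ^+ 2)) => //; first exact: measurable_funX.
by move=> w; rewrite normrX ler_pXn2r ?nnegrE// (le_trans _ (cK w)).
Qed.

Lemma L2Z (k : R) f : L2 f -> L2 (fun w => k * f w).
Proof. by apply: (@L2_bmul (fun=> k) f `|k|) => //. Qed.

Lemma L2N f : L2 f -> L2 (fun w => - f w).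
Proof.
move=> /(L2Z (-1)); congr L2; apply/funext => w; by rewrite mulN1r.
Qed.

Lemma L2B f g : L2 f -> L2 g -> L2 (fun w => f w - g w).
Proof. by move=> hf hg; apply: L2D => //; exact: L2N. Qed.

Lemma L2_bounded f (K : R) : measurable_fun setT f -> (forall w, `|f w| <= K) -> L2 f.
Proof.
move=> mf fK; have := @L2_bmul f (fun=> 1) K mf fK (L2_cst 1).
by congr L2; apply/funext => w; rewrite mulr1.
Qed.

Lemma Ex_indic (A : set T) : measurable A -> Ex (\1_A : T -> R) = fine (P A).
Proof. by move=> mA; rewrite /Ex integral_indic// setIT. Qed.

Lemma L1_indic (A : set T) : measurable A -> L1 (\1_A : T -> R).
Proof.
move=> mA; apply: (@L1_bounded _ 1); first exact: measurable_indic.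
by move=> w; rewrite indicE; case: (_ \in _); rewrite ?normr1 ?normr0.
Qed.

Lemma markov2 f (e : R) : 0 < e -> L2 f ->
  fine (P [set w | e < `|f w|]) <= Ex (fun w => f w ^+ 2) / e ^+ 2.
Proof.
move=> e0 [mf hf].
have mA : measurable [set w | e < `|f w|].
  have -> : [set w | e < `|f w|] = setT `&` (fun w => `|f w|) @^-1` `]e, +oo[%classic.
    by rewrite setTI; apply/seteqP; split => w /=; rewrite in_itv /= andbT.
  have mn : measurable_fun setT (fun w => `|f w|) by exact: measurableT_comp.
  by apply: mn => //; exact: measurable_itv.
rewrite -Ex_indic// ler_pdivlMr ?exprn_gt0// mulrC -ExZ; last exact: L1_indic.
apply: Ex_le => //; first by apply: L1Z; exact: L1_indic.
move=> w; rewrite indicE; case: (asboolP (e < `|f w|)) => h.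
  rewrite mem_set// mulr1 -(real_normK (num_real (f w))) ler_pXn2r ?nnegrE ?normr_ge0//; exact: ltW.
by rewrite memNset// mulr0 sqr_ge0.
Qed.

Definition indep f g := forall A B : set R, measurable A -> measurable B ->
  P (f @^-1` A `&` g @^-1` B) = (P (f @^-1` A) * P (g @^-1` B))%E.

(** Independence says that the joint law and the product of the marginal laws agree on rectangles,
    hence everywhere. Tonelli's theorem gives integrability under the product law and Fubini's
    theorem factors the integral. *)
Lemma indep_Ex_mul f g : indep f g -> L1 f -> L1 g ->
  L1 (fun w => f w * g w) /\ Ex (fun w => f w * g w) = Ex f * Ex g.
Proof.
move=> ifg hf hg.
have mf := L1_measurable hf; have mg := L1_measurable hg.
pose F : {mfun T >-> R} := HB.pack f (isMeasurableFun.Build _ _ _ _ f mf).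
pose G : {mfun T >-> R} := HB.pack g (isMeasurableFun.Build _ _ _ _ g mg).
have mFG : measurable_fun setT (fun w => (f w, g w)) by exact/measurable_fun_pairP.
pose FG : {mfun T >-> (R * R)%type} := HB.pack (fun w => (f w, g w)) (isMeasurableFun.Build _ _ _ _ (fun w => (f w, g w)) mFG).
pose m1 := distribution P F.
pose m2 := distribution P G.
pose m12 := distribution P FG.
have mE : forall X : set (R * R), measurable X -> (m1 \x m2)%E X = m12 X.
  apply: product_measure_unique => A B mA mB; exact: ifg.
have mm : measurable_fun setT (fun z : R * R => (z.1 * z.2)%:E).
  by apply/measurable_EFinP; exact: measurable_funM.
have int_m1 (h : R -> R) : measurable_fun setT h -> L1 (fun w => h (f w)) ->
    (\int[m1]_x (h x)%:E = (Ex (fun w => h (f w)))%:E)%E.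
  by move=> mh hh; rewrite integral_distribution ?ExE//; exact/measurable_EFinP.
have int_m2 (h : R -> R) : measurable_fun setT h -> L1 (fun w => h (g w)) ->
    (\int[m2]_x (h x)%:E = (Ex (fun w => h (g w)))%:E)%E.
  by move=> mh hh; rewrite integral_distribution ?ExE//; exact/measurable_EFinP.
have idist (D : R * R -> \bar R) : (\int[m12]_z D z = \int[(m1 \x m2)%E]_z D z)%E.
  by apply: eq_measure_integral => A mA _; exact/esym/mE.
have nn2 x : (\int[m2]_y `|(x * y)%:E| = `|x|%:E * (Ex (fun w => `|g w|))%:E)%E.
  under eq_integral do rewrite abse_EFin normrM EFinM.
  rewrite ge0_integralZl//; last by apply/measurable_EFinP; exact: normr_measurable.
  by rewrite int_m2//; exact: L1_norm.
have i12 : (m1 \x m2)%E.-integrable setT (fun z : R * R => (z.1 * z.2)%:E).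
  apply/integrable12ltyP => //=.
  under eq_integral do rewrite nn2.
  rewrite ge0_integralZr//; last 2 first.
    by apply/measurable_EFinP; exact: normr_measurable.
    by rewrite lee_fin Ex_ge0.
  by rewrite int_m1//; [rewrite -EFinM ltry|exact: L1_norm].
have hfg : L1 (fun w => f w * g w).
  apply/integrableP; split; first by apply/measurable_EFinP; exact: measurable_funM.
  move/integrableP: i12 => [_].
  rewrite -idist ge0_integral_distribution//.
  by apply: measurableT_comp.
split => //; apply: EFin_inj; rewrite -ExE//.
transitivity (\int[m12]_z (z.1 * z.2)%:E)%E.
  by rewrite integral_distribution.
rewrite idist -integral12_prod_meas1//=.
have in2 x : (\int[m2]_y (x * y)%:E = x%:E * (Ex g)%:E)%E.
  under eq_integral do rewrite EFinM.
  rewrite integralZl//; first by rewrite int_m2.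
  by apply: (integrable_pushforward mg).
under eq_integral do rewrite /fubini_F /= in2.
rewrite integralZr//; first by rewrite int_m1// EFinM.
by apply: (integrable_pushforward mf).
Qed.

End expectation_kit.

(** * Sigma-algebras generated by subfamilies, and randomly indexed functions *)

Section grouping.
Context d (T : measurableType d) (R : realType) (P : probability T R).
Context d' (T' : measurableType d') (I : choiceType).
Variable Y : I -> {RV P >-> T'}.

(** The family, closed under intersection, from which independence is extended to [sigma_family]. *)
Definition cylinder (D : set I) : set (set T) :=
  [set A | exists (J : {fset I}) (B : I -> set T'),
    [/\ [set` J] `<=` D, (forall i, measurable (B i)) &
       A = \bigcap_(i in [set` J]) Y i @^-1` B i]].

Lemma measurable_preim_RV (i : I) (B : set T') : measurable B -> measurable (Y i @^-1` B).
Proof. by move=> mB; exact: measurable_funPTI. Qed.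

Lemma cylinder_measurable D A : cylinder D A -> measurable A.
Proof.
move=> [J [B [_ mB ->]]]; apply: fin_bigcap_measurable => // i _.
exact: measurable_preim_RV.
Qed.

Lemma cylinderT D : cylinder D setT.
Proof.
exists fset0, (fun=> setT); split.
- by move=> i /=; rewrite inE.
- by [].
- by apply/esym; rewrite -subTset => w _ i /=; rewrite inE.
Qed.

Lemma cylinderI D : setI_closed (cylinder D).
Proof.
move=> _ _ [J [B [JD mB ->]]] [J' [B' [JD' mB' ->]]].
exists (J `|` J')%fset, (fun i => (if i \in J then B i else setT) `&` (if i \in J' then B' i else setT)); split.
- by move=> i /=; rewrite inE => /orP[/JD|/JD'].
- by move=> i; apply: measurableI; case: ifP.
apply/seteqP; split => w.
  move=> [h h'] i /= _; split.
    by case: ifP => // iJ; exact: h.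
  by case: ifP => // iJ; exact: h'.
move=> h; split => i /= iJ; have := h i; rewrite /= !inE iJ ?orbT.
  by move=> /(_ isT)[].
by move=> /(_ isT)[].
Qed.

Lemma sigma_family_cylinder D : sigma_family D Y `<=` <<s cylinder D >>.
Proof.
apply: smallest_sub; first exact: smallest_sigma_algebra.
move=> A [i [B [Di mB ->]]]; apply: sub_sigma_algebra.
exists [fset i]%fset, (fun=> B); split => //.
  by move=> j /=; rewrite inE => /eqP ->.
apply/seteqP; split => w /=.
  by move=> h j /=; rewrite inE => /eqP ->.
by apply; rewrite /= inE.
Qed.

Lemma sigma_family_measurable D A : sigma_family D Y A -> measurable A.
Proof.
apply: smallest_sub; first exact: sigma_algebra_measurable.
by move=> B [i [C [_ mC ->]]]; exact: measurable_preim_RV.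
Qed.

Lemma sigma_family_sub D D' : D `<=` D' -> sigma_family D Y `<=` sigma_family D' Y.
Proof.
move=> DD; apply: smallest_sub; first exact: smallest_sigma_algebra.
move=> A [i [B [Di mB ->]]]; apply: sub_sigma_algebra.
by exists i, B; split => //; exact: DD.
Qed.

(** The finite index sets are disjoint, so the intersection is again a cylinder, over their union,
    and its product formula factors. *)
Lemma indep_cylinder D D1 D2 A B : independent_RVs D Y -> D1 `<=` D -> D2 `<=` D ->
  D1 `&` D2 `<=` set0 -> cylinder D1 A -> cylinder D2 B ->
  P (A `&` B) = (P A * P B)%E.
Proof.
move=> iY D1D D2D D12 [J [BA [JD mB ->]]] [J' [BB [JD' mB' ->]]].
have jj i : i \in J -> i \in J' = false.
  by move=> iJ; apply/negP => iJ'; have := D12 i; apply; split; [exact: JD|exact: JD'].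
pose C i := if i \in J then BA i else BB i.
have -> : \bigcap_(i in [set` J]) Y i @^-1` BA i `&` \bigcap_(i in [set` J']) Y i @^-1` BB i
   = \bigcap_(i in [set` (J `|` J')%fset]) Y i @^-1` C i.
  apply/seteqP; split => w.
    move=> [h h'] i /=; rewrite inE /C => /orP[iJ|iJ].
      by rewrite iJ; exact: h.
    case: ifP => iJ2; last exact: h'.
    by have := jj _ iJ2; rewrite iJ.
  move=> h; split => i /= iJ; have := h i; rewrite /= inE /C iJ ?orbT; first exact.
  case: ifP => [iJ2|_]; last exact.
  by have := jj _ iJ2; rewrite iJ.
rewrite !iY//; last 4 first.
- by move=> i /JD' /D2D.
- by move=> i /JD /D1D.
- by move=> i /=; rewrite inE => /orP[/JD /D1D|/JD' /D2D].
- by move=> i; rewrite /C; case: ifP.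
rewrite (perm_big (enum_fset J ++ enum_fset J')) /=; last first.
  apply: uniq_perm; first exact: fset_uniq.
    rewrite cat_uniq !fset_uniq andbT /=.
    by apply/hasPn => i /=; apply: contraTN => /jj ->.
  by move=> i; rewrite mem_cat inE.
rewrite big_cat /=; congr (_ * _)%E; apply: eq_big_seq => i iJ; rewrite /C.
  by rewrite iJ.
case: ifP => // iJ2; by have := jj _ iJ2; rewrite iJ.
Qed.

Lemma indep_sigma_family D D1 D2 A B : independent_RVs D Y -> D1 `<=` D -> D2 `<=` D ->
  D1 `&` D2 `<=` set0 -> sigma_family D1 Y A -> sigma_family D2 Y B ->
  P (A `&` B) = (P A * P B)%E.
Proof.
move=> iY D1D D2D D12 /sigma_family_cylinder sA /sigma_family_cylinder sB.
(* For fixed [C] both sides are finite measures in [A]. Agreeing on a family closed under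
   intersection, they agree on the sigma-algebra it generates. This is applied once in each
   argument. *)
have pi_ext (G : set (set T)) (C : set T) : G `<=` measurable -> setI_closed G -> G setT -> measurable C ->
    (forall A, G A -> P (A `&` C) = (P A * P C)%E) ->
    forall A, <<s G >> A -> P (A `&` C) = (P A * P C)%E.
  move=> Gm GI GT mC h A' sA'.
  have PC : (fine (P C))%:E = P C by rewrite fineK// fin_num_measure.
  have p0 : 0 <= fine (P C) by rewrite fine_ge0.
  pose p : {nonneg R} := NngNum p0.
  have -> : P (A' `&` C) = mrestr P mC A' by [].
  have -> : (P A' * P C)%E = mscale p P A' by rewrite muleC /mscale /= PC.
  apply: (@g_sigma_algebra_measure_unique _ R T G Gm (fun=> setT)) => //.
  - by rewrite -subTset => w _; exists 0%N.
  - move=> B' GB; change (P (B' `&` C) = (fine (P C))%:E * P B')%E.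
    by rewrite PC muleC; exact: h.
  - move=> k; change (P (setT `&` C) < +oo)%E.
    by rewrite setTI ltey_eq fin_num_measure.
have step A' : <<s cylinder D1 >> A' -> forall B', cylinder D2 B' -> P (A' `&` B') = (P A' * P B')%E.
  move=> sA' B' cB'; apply: (pi_ext (cylinder D1)) => //.
  - exact: cylinder_measurable.
  - exact: cylinderI.
  - exact: cylinderT.
  - exact: cylinder_measurable cB'.
  - by move=> A'' cA; exact: (indep_cylinder iY D1D D2D D12).
have mA : measurable A.
  move: sA; apply: smallest_sub; first exact: sigma_algebra_measurable.
  by move=> ?; exact: cylinder_measurable.
rewrite setIC muleC; apply: (pi_ext (cylinder D2)) => //.
- exact: cylinder_measurable.
- exact: cylinderI.
- exact: cylinderT.
- by move=> B' cB'; rewrite setIC muleC; exact: step.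
Qed.

Definition mD (D : set I) d'' (U : measurableType d'') (f : T -> U) :=
  forall B, measurable B -> sigma_family D Y (f @^-1` B).

(** The sigma-algebra [sigma_family D Y] packaged as a measurable type on the same points, so that
    through [mDP] the closure properties of measurable functions transfer to [mD]. *)
Definition FD (D : set I) := g_sigma_algebraType
  [set A | exists i, exists B, [/\ D i, measurable B & A = Y i @^-1` B]].

Lemma mDP (D : set I) d'' (U : measurableType d'') (f : T -> U) :
  mD D f <-> measurable_fun [set: FD D] (f : FD D -> U).
Proof.
split=> [h _ B mB|h B mB]; first by rewrite setTI; exact: h.
by have := h measurableT B mB; rewrite setTI.
Qed.

Lemma mD_measurable D d'' (U : measurableType d'') (f : T -> U) :
  mD D f -> measurable_fun setT f.
Proof.
by move=> h _ B mB; rewrite setTI; apply: sigma_family_measurable; exact: h.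
Qed.

Lemma mD_sub D D' d'' (U : measurableType d'') (f : T -> U) :
  D `<=` D' -> mD D f -> mD D' f.
Proof. by move=> DD h B mB; apply: (sigma_family_sub DD); exact: h. Qed.

Lemma mD_Y D i : D i -> mD D (Y i).
Proof. by move=> Di B mB; apply: sub_sigma_algebra; exists i, B. Qed.

Lemma mD_comp D d1 (U : measurableType d1) d2 (V : measurableType d2) (f : T -> U) (h : U -> V) :
  measurable_fun setT h -> mD D f -> mD D (fun w => h (f w)).
Proof.
move=> mh hf B mB; have := hf (h @^-1` B) _; apply.
by rewrite -[X in measurable X]setTI; exact: mh.
Qed.

Lemma measurable_nat d1 (U : measurableType d1) (h : nat -> U) : measurable_fun setT h.
Proof. by []. Qed.

Lemma mD_cst D d1 (U : measurableType d1) (u : U) : mD D (fun=> u).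
Proof. by apply/mDP. Qed.

Lemma mDD D (f g : T -> R) : mD D f -> mD D g -> mD D (fun w => f w + g w).
Proof. by move=> /mDP hf /mDP hg; apply/mDP; exact: measurable_funD. Qed.

Lemma mDM D (f g : T -> R) : mD D f -> mD D g -> mD D (fun w => f w * g w).
Proof. by move=> /mDP hf /mDP hg; apply/mDP; exact: measurable_funM. Qed.

Lemma mDB D (f g : T -> R) : mD D f -> mD D g -> mD D (fun w => f w - g w).
Proof. by move=> /mDP hf /mDP hg; apply/mDP; exact: measurable_funB. Qed.

Lemma mDX D (f : T -> R) n : mD D f -> mD D (fun w => f w ^+ n).
Proof. by move=> /mDP hf; apply/mDP; exact: measurable_funX. Qed.

(** A random index with countably many values: the preimage is a countable union over the events
    [Z = z]. *)
Lemma mD_nat_family D d1 (U : measurableType d1) (Z : T -> nat) (F : nat -> T -> U) :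
  mD D Z -> (forall z, mD D (F z)) -> mD D (fun w => F (Z w) w).
Proof.
move=> hZ hF B mB.
have -> : (fun w => F (Z w) w) @^-1` B = \bigcup_z (Z @^-1` [set z] `&` F z @^-1` B).
  apply/seteqP; split => w /=; first by exists (Z w).
  by move=> [z _ [<-]].
apply: (@bigcupT_measurable _ (FD D)) => z.
by apply: (@measurableI _ (FD D)); [exact: hZ|exact: hF].
Qed.

Section independent.
Variable D : set I.
Hypothesis iY : independent_RVs D Y.
Variables D1 D2 : set I.
Hypotheses (D1D : D1 `<=` D) (D2D : D2 `<=` D) (D12 : D1 `&` D2 `<=` set0).

Lemma mD_indep (f g : T -> R) : mD D1 f -> mD D2 g -> indep P f g.
Proof.
move=> hf hg A B mA mB.
by apply: (indep_sigma_family iY D1D D2D D12); [exact: hf|exact: hg].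
Qed.

Lemma Ex_mulD (f g : T -> R) : mD D1 f -> mD D2 g -> L1 P f -> L1 P g ->
  L1 P (fun w => f w * g w) /\ Ex P (fun w => f w * g w) = Ex P f * Ex P g.
Proof. by move=> hf hg; apply: indep_Ex_mul; exact: mD_indep. Qed.

Variable Z : T -> nat.
Hypothesis mZ : mD D1 Z.
Variable Phi : nat -> T -> R.
Hypothesis mPhi : forall z, mD D2 (Phi z).
Hypothesis L1Phi : forall z, L1 P (Phi z).

Let Zeq z := Z @^-1` [set z].
Let mZeq z : measurable (Zeq z).
Proof. by apply: (@sigma_family_measurable D1); exact: mZ. Qed.
Let mDZeq z : mD D1 (\1_(Zeq z) : T -> R).
Proof.
apply/mDP; apply: (@measurable_indic _ (FD D1)); exact: mZ.
Qed.
Let Zcover : \bigcup_z Zeq z = setT.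
Proof. by rewrite -subTset => w _; exists (Z w). Qed.
Let Ztriv : trivIset setT Zeq.
Proof. by apply/trivIsetP => i j _ _ /eqP ij; apply/seteqP; split => // w [/= wi wj]; apply: ij; rewrite -wi -wj. Qed.

Lemma integral_Zeq (f : T -> R) (z : nat) : L1 P (fun w => \1_(Zeq z) w * f w) ->
  (\int[P]_(w in Zeq z) (f w)%:E = (Ex P (fun w => \1_(Zeq z) w * f w))%:E)%E.
Proof.
move=> h; rewrite -ExE// [LHS]integral_mkcond; apply: eq_integral => w _.
by rewrite patchE indicE; case: ifP => _ /=; rewrite ?mul1r ?mul0r.
Qed.

(** In [Phi (Z w) w] the index [Z] may be held fixed when taking expectations,
    because it is independent of the family [Phi]. *)
Lemma freeze0 (C : T -> R) : mD D1 C -> L1 P C -> (forall z, Ex P (Phi z) = 0) ->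
  L1 P (fun w => C w * Phi (Z w) w) -> Ex P (fun w => C w * Phi (Z w) w) = 0.
Proof.
move=> mC hC E0 hL; apply: EFin_inj; rewrite -ExE//.
rewrite -Zcover integral_bigcup//; last by rewrite Zcover.
apply: eseries0 => z _ _.
have hC1 : L1 P (fun w => \1_(Zeq z) w * C w).
  apply: (@L1_bmul _ _ _ _ _ _ 1) => //.
  by move=> w; rewrite indicE; case: (_ \in _); rewrite ?normr1 ?normr0.
have [h1 h2] := Ex_mulD (mDM (mDZeq z) mC) (mPhi z) hC1 (L1Phi z).
transitivity (\int[P]_(w in Zeq z) (C w * Phi z w)%:E)%E.
  by apply: eq_integral => w; rewrite inE => ->.
rewrite integral_Zeq; last by apply: (L1_eq _ h1) => w; rewrite mulrA.
rewrite -[RHS]/(0%:E); congr EFin.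
by rewrite -[RHS](mulr0 (Ex P (fun w => \1_(Zeq z) w * C w))) -(E0 z) -h2; apply: Ex_eq => w; rewrite mulrA.
Qed.

(** Countable additivity over the level sets of [Z]. Nonnegativity allows this before integrability
    of the left side is known; [L1_freeze] then deduces that integrability. *)
Lemma freeze_ge0 : (forall z w, 0 <= Phi z w) ->
  (\int[P]_w (Phi (Z w) w)%:E = \int[P]_w (Ex P (Phi (Z w)))%:E)%E.
Proof.
move=> P0.
have mPZ : measurable_fun setT (fun w => Phi (Z w) w).
  apply: (@mD_measurable D).
  apply: mD_nat_family; first exact: (mD_sub D1D).
  by move=> z; exact: (mD_sub D2D).
have mEZ : measurable_fun setT (fun w => Ex P (Phi (Z w))).
  by apply: (@mD_measurable D1); exact: (mD_comp (measurable_nat (fun z => Ex P (Phi z))) mZ).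
rewrite -Zcover !ge0_integral_bigcup ?Zcover//; last 4 first.
- exact/measurable_EFinP.
- by move=> w _; rewrite lee_fin Ex_ge0.
- exact/measurable_EFinP.
- by move=> w _; rewrite lee_fin.
apply: eq_eseriesr => z _.
have h1 : L1 P (\1_(Zeq z) : T -> R) by exact: L1_indic.
have [h2 h3] := Ex_mulD (mDZeq z) (mPhi z) h1 (L1Phi z).
transitivity (\int[P]_(w in Zeq z) (Phi z w)%:E)%E.
  by apply: eq_integral => w; rewrite inE => ->.
transitivity (\int[P]_(w in Zeq z) (Ex P (Phi z))%:E)%E; last first.
  by apply: eq_integral => w; rewrite inE => ->.
rewrite !integral_Zeq//.
  rewrite h3; congr EFin.
  by have [_ ->] := Ex_mulD (mDZeq z) (@mD_cst D2 _ R (Ex P (Phi z))) h1 (L1_cst P (Ex P (Phi z))); rewrite Ex_cst.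
by have [] := Ex_mulD (mDZeq z) (@mD_cst D2 _ R (Ex P (Phi z))) h1 (L1_cst P (Ex P (Phi z))).
Qed.

Lemma L1_freeze (g : nat -> R) : (forall z w, 0 <= Phi z w) ->
  (forall z, Ex P (Phi z) <= g z) -> L1 P (fun w => g (Z w)) ->
  L1 P (fun w => Phi (Z w) w) /\ Ex P (fun w => Phi (Z w) w) <= Ex P (fun w => g (Z w)).
Proof.
move=> P0 Pg hg.
have mPZ : measurable_fun setT (fun w => Phi (Z w) w).
  apply: (@mD_measurable D).
  apply: mD_nat_family; first exact: (mD_sub D1D).
  by move=> z; exact: (mD_sub D2D).
have mEZ : measurable_fun setT (fun w => Ex P (Phi (Z w))).
  by apply: (@mD_measurable D1); exact: (mD_comp (measurable_nat (fun z => Ex P (Phi z))) mZ).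
have hE : L1 P (fun w => Ex P (Phi (Z w))).
  apply: L1_dom hg => // w; rewrite ger0_norm ?Ex_ge0//.
have hL : L1 P (fun w => Phi (Z w) w).
  apply/integrableP; split; first exact/measurable_EFinP.
  under eq_integral do rewrite abse_EFin ger0_norm//.
  by rewrite freeze_ge0// ExE// ltry.
split => //; rewrite -lee_fin -!ExE// freeze_ge0// ExE// ExE// lee_fin.
exact: Ex_le.
Qed.

End independent.

End grouping.

(** * A central limit theorem for rows of independent variables *)

Lemma cvgr_ge0 (R : realType) (u : nat -> R) (l : R) :
  (forall n, 0 <= u n) -> u n @[n --> \oo] --> l -> 0 <= l.
Proof.
move=> u0 ul; have <- : lim (u n @[n --> \oo]) = l by exact: cvg_lim.
apply: limr_ge; first by apply/cvg_ex; exists l.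
by apply: nearW.
Qed.

(** The choice of [eps] and [l] makes each of the two error terms cost at most [eta / 4]. *)
Lemma swap_error_le (R : realFieldType) (K eps V L s l eta : R) :
  0 <= K -> 0 <= s -> 0 < eps -> eps <= 1 -> 0 <= V -> V <= s + 1 ->
  0 <= L -> L <= l ->
  eps * (8 * (K + 1) * (s + 1)) <= eta -> l * (4 * (K + 1) * (s + 2)) = eta ->
  K * ((eps + eps ^+ 2) * V + (1 + V) * L) <= eta / 2.
Proof.
move=> K0 s0 e0 e1 V0 Vs L0 Ll h1 h2.
have f1 : (eps + eps ^+ 2) * V <= 2 * eps * (s + 1).
  apply: ler_pM => //; first by rewrite addr_ge0 ?sqr_ge0// ltW.
  by rewrite expr2; nra.
have f2 : (1 + V) * L <= (s + 2) * l.
  apply: ler_pM => //; first exact: addr_ge0.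
  by clear -Vs; lra.
apply: (@le_trans _ _ ((K + 1) * (2 * eps * (s + 1) + (s + 2) * l))); last first.
  by clear -h1 h2; lra.
apply: ler_pM => //; last exact: lerD.
  by rewrite addr_ge0// mulr_ge0 ?addr_ge0 ?sqr_ge0// ltW.
by rewrite lerDl.
Qed.

Lemma sandwich_dist_le (R : realFieldType) (G p b Eu El Hu Hl eta : R) :
  p <= Eu + eta / 4 + b -> El - eta / 4 - b <= p ->
  `|G - Hu| <= eta / 4 -> `|G - Hl| <= eta / 4 -> `|0 - b| <= eta / 4 ->
  `|Hu - Eu| <= eta / 4 -> `|Hl - El| <= eta / 4 -> `|G - p| <= eta.
Proof.
move=> h1 h2; rewrite !ler_norml => /andP[? ?] /andP[? ?] /andP[? ?] /andP[? ?] /andP[? ?].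
by apply/andP; split; lra.
Qed.

Section swapping.
Context d (T : measurableType d) (R : realType) (P : probability T R).
Notation Ex := (Ex P).
Notation L1 := (L1 P).
Notation L2 := (L2 P).

Lemma indep_comp (f g : T -> R) (h k : R -> R) : measurable_fun setT h ->
  measurable_fun setT k -> indep P f g ->
  indep P (fun w => h (f w)) (fun w => k (g w)).
Proof.
move=> mh mk ifg A B mA mB.
apply: (ifg (h @^-1` A) (k @^-1` B)); rewrite -[X in measurable X]setTI.
  exact: mh.
exact: mk.
Qed.

(** The integrand of Lindeberg's condition. *)
Definition tail (e x : R) : R := (e < `|x|)%R%:R * x ^+ 2.

Lemma measurable_tail e : measurable_fun setT (tail e).
Proof.
apply: measurable_funM; last exact: measurable_funX.
have -> : (fun x : R => (e < `|x|)%R%:R : R) = \1_[set x | e < `|x|].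
  apply/funext => x; rewrite indicE; congr (nat_of_bool _)%:R.
  by apply/idP/idP => [h|]; [rewrite inE|rewrite inE].
apply: measurable_indic.
have -> : [set x : R | e < `|x|] = setT `&` (fun x : R => `|x|) @^-1` `]e, +oo[%classic.
  by rewrite setTI; apply/seteqP; split => w /=; rewrite in_itv /= andbT.
by apply: normr_measurable => //; exact: measurable_itv.
Qed.

Lemma tail_ge0 e x : 0 <= tail e x.
Proof. by rewrite mulr_ge0// sqr_ge0. Qed.

Lemma tail_le e x : tail e x <= x ^+ 2.
Proof. by rewrite ler_piMl ?sqr_ge0//; case: (_ < _). Qed.

Lemma L1_tail e (f : T -> R) : L2 f -> L1 (fun w => tail e (f w)).
Proof.
move=> [mf hf]; apply: L1_dom hf.
  by apply: measurableT_comp => //; exact: measurable_tail.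
by move=> w; rewrite ger0_norm ?tail_ge0// tail_le.
Qed.

Section row.
Variables (W : nat -> T -> R).
Hypothesis WL2 : forall k, L2 (W k).
Hypothesis W0 : forall k, Ex (W k) = 0.
Let S k w := \sum_(i < k) W i w.
Hypothesis Wi : forall k, indep P (S k) (W k).
Let v k := Ex (fun w => W k w ^+ 2).
Variables (e K : R).
Hypothesis e0 : 0 < e.
Hypothesis K0 : 0 <= K.
Hypothesis HK : forall s u w v : R, e <= s -> 0 <= v ->
  [/\ `|H s (u - w) - H s u + phi (u / Num.sqrt s) / Num.sqrt s * w
        - psi (u / Num.sqrt s) / s / 2 * w ^+ 2| <= K * `|w| ^+ 3,
     `|H s (u - w) - H s u + phi (u / Num.sqrt s) / Num.sqrt s * w
        - psi (u / Num.sqrt s) / s / 2 * w ^+ 2| <= K * w ^+ 2,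
     `|H (s + v) u - H s u - psi (u / Num.sqrt s) / s / 2 * v| <= K * v ^+ 2,
     `|phi (u / Num.sqrt s) / Num.sqrt s| <= K &
     `|psi (u / Num.sqrt s) / s| <= K].

Let mW k : measurable_fun setT (W k). Proof. by case: (WL2 k). Qed.
Let mS k : measurable_fun setT (S k).
Proof. by apply: measurable_sum. Qed.

Lemma L1_H s (f : T -> R) : measurable_fun setT f -> L1 (fun w => H s (f w)).
Proof.
move=> mf; apply: (@L1_bounded _ _ _ _ _ 1).
  by apply: measurableT_comp => //; exact: measurable_H.
by move=> w; rewrite ger0_norm ?Phi_ge0 ?Phi_le1.
Qed.

(** The normal variable that replaces [W k] never appears: adding it to the argument of [H s]
    amounts to raising the variance parameter by [v k]. By independence the first-order term
    vanishes, and by the heat equation the second-order terms of both sides cancel; two Taylor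
    remainders are left. *)
Lemma swap_one (eps s x : R) k : 0 < eps -> e <= s ->
  `|Ex (fun w => H s (x - S k.+1 w)) - Ex (fun w => H (s + v k) (x - S k w))|
  <= K * (eps * v k + Ex (fun w => tail eps (W k w)) + v k ^+ 2).
Proof.
move=> eps0 es.
have s0 : 0 < s by exact: lt_le_trans es.
have v0 : 0 <= v k by apply: Ex_ge0 => w; rewrite sqr_ge0.
pose u w := x - S k w.
have mu : measurable_fun setT u by exact: measurable_funB.
pose h1 w := phi (u w / Num.sqrt s) / Num.sqrt s.
pose h2 w := psi (u w / Num.sqrt s) / s.
have mh1 : measurable_fun setT h1.
  by apply: (measurableT_comp (measurable_H1 s0)).
have mh2 : measurable_fun setT h2.
  by apply: (measurableT_comp (measurable_H2 s0)).
have b1 w : `|h1 w| <= K by have [] := HK (u w) 0 es v0.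
have b2 w : `|h2 w| <= K by have [] := HK (u w) 0 es v0.
(* [r1] is the remainder of the increment in space by [W k], [r2] that of the increment of the
   variance by [v k]. *)
pose r1 w := H s (u w - W k w) - H s (u w) + h1 w * W k w - h2 w / 2 * W k w ^+ 2.
pose r2 w := H (s + v k) (u w) - H s (u w) - h2 w / 2 * v k.
have LW : L1 (W k) by exact: L2_L1.
have LW2 : L1 (fun w => W k w ^+ 2) by case: (WL2 k).
have L1h1W : L1 (fun w => h1 w * W k w) by exact: (L1_bmul mh1 b1).
have L1h2W : L1 (fun w => h2 w * W k w ^+ 2) by exact: (L1_bmul mh2 b2).
have L1h1 : L1 h1 by exact: (L1_bounded P mh1 b1).
have L1h2 : L1 h2 by exact: (L1_bounded P mh2 b2).
have L1Hs : L1 (fun w => H s (u w)) by exact: L1_H.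
have L1Hsv : L1 (fun w => H (s + v k) (u w)) by exact: L1_H.
have L1HsW : L1 (fun w => H s (u w - W k w)) by apply: L1_H; exact: measurable_funB.
have L1h2W' : L1 (fun w => h2 w / 2 * W k w ^+ 2).
  by apply: (L1_eq _ (L1Z 2^-1 L1h2W)) => w; rewrite mulrCA mulrA.
have L1h2v : L1 (fun w => h2 w / 2 * v k).
  by apply: (L1_eq _ (L1Z (v k / 2) L1h2)) => w; rewrite mulrC; ring.
have L1r1 : L1 r1.
  by apply: L1B => //; apply: L1D => //; exact: L1B.
have L1r2 : L1 r2.
  by apply: L1B => //; exact: L1B.
have E1 : Ex (fun w => h1 w * W k w) = 0.
  have i1 : indep P h1 (W k).
    apply: (@indep_comp (S k) (W k) (fun y => phi ((x - y) / Num.sqrt s) / Num.sqrt s) id) => //.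
    apply: (measurableT_comp (measurable_H1 s0)).
    exact: measurable_funB.
  by have [_ ->] := indep_Ex_mul i1 L1h1 LW; rewrite W0 mulr0.
have E2 : Ex (fun w => h2 w / 2 * W k w ^+ 2) = Ex (fun w => h2 w / 2 * v k).
  have i2 : indep P h2 (fun w => W k w ^+ 2).
    apply: (@indep_comp (S k) (W k) (fun y => psi ((x - y) / Num.sqrt s) / s) (fun y => y ^+ 2)) => //.
    apply: (measurableT_comp (measurable_H2 s0)).
    exact: measurable_funB.
  have [_ E] := indep_Ex_mul i2 L1h2 LW2.
  rewrite (@Ex_eq _ _ _ _ _ (fun w => 2^-1 * (h2 w * W k w ^+ 2))); last by move=> w; ring.
  rewrite (@Ex_eq _ _ _ _ (fun w => h2 w / 2 * v k) (fun w => (v k / 2) * h2 w)); last by move=> w; ring.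
  by rewrite !ExZ// E; rewrite -/(v k); ring.
have -> : Ex (fun w => H s (x - S k.+1 w)) - Ex (fun w => H (s + v k) (x - S k w)) = Ex r1 - Ex r2.
  have -> : Ex (fun w => H s (x - S k.+1 w)) = Ex (fun w => H s (u w - W k w)).
    by apply: Ex_eq => w; congr H; rewrite /u /S big_ord_recr /= opprD addrA.
  have -> : Ex r1 = Ex (fun w => H s (u w - W k w)) - Ex (fun w => H s (u w)) + 0 - Ex (fun w => h2 w / 2 * v k).
    rewrite /r1 ExB//; last by apply: L1D => //; exact: L1B.
    by rewrite ExD//; [rewrite ExB// E1 E2|exact: L1B].
  have -> : Ex r2 = Ex (fun w => H (s + v k) (u w)) - Ex (fun w => H s (u w)) - Ex (fun w => h2 w / 2 * v k).
    by rewrite /r2 ExB//; [rewrite ExB|exact: L1B].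
  rewrite -/(u _); move: (Ex _) (Ex _) (Ex _) => a b c.
  by ring.
apply: (le_trans (ler_normB _ _)).
rewrite mulrDr lerD//.
  apply: (le_trans (Ex_norm_le L1r1)).
  rewrite /v -ExZ// -ExD//; last 2 first.
  - exact: L1Z.
  - exact: L1_tail.
  rewrite -ExZ//; last by apply: L1D; [exact: L1Z|exact: L1_tail].
  apply: Ex_le; [exact: L1_norm|apply: L1Z; apply: L1D; [exact: L1Z|exact: L1_tail]|].
  move=> w; have [c3 c2 _ _ _] := HK (u w) (W k w) es v0.
  rewrite /tail; case: ltP => hW; rewrite ?mul1r ?mul0r ?addr0.
    apply: (le_trans c2); rewrite ler_wpM2l// lerDr mulr_ge0 ?sqr_ge0//.
    exact: ltW.
  apply: (le_trans c3); rewrite ler_wpM2l// exprS -(real_normK (num_real (W k w))).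
  by rewrite ler_wpM2r// sqr_ge0.
apply: (le_trans (Ex_norm_le L1r2)).
rewrite -(Ex_cst P (K * _)); apply: Ex_le; [exact: L1_norm|exact: L1_cst|].
by move=> w; have [_ _ c _ _] := HK (u w) 0 es v0.
Qed.

Lemma swap_row (eps x : R) N : 0 < eps ->
  `|Ex (fun w => H e (x - S N w)) - H (e + \sum_(i < N) v i) x|
  <= \sum_(k < N) K * (eps * v k + Ex (fun w => tail eps (W k w)) + v k ^+ 2).
Proof.
move=> eps0.
(* The exchange starts with the last summand, and each exchange raises the variance parameter, so
   the induction needs a general [s]. *)
suff gen s : e <= s ->
  `|Ex (fun w => H s (x - S N w)) - H (s + \sum_(i < N) v i) x|
  <= \sum_(k < N) K * (eps * v k + Ex (fun w => tail eps (W k w)) + v k ^+ 2).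
  exact: gen.
elim: N s => [|N ih] s es.
  rewrite !big_ord0 addr0.
  rewrite (@Ex_eq _ _ _ _ _ (fun=> H s x)).
    by rewrite Ex_cst subrr normr0.
  by move=> w; rewrite /S big_ord0 subr0.
have v0 : 0 <= v N by apply: Ex_ge0 => w; rewrite sqr_ge0.
have := ih (s + v N); rewrite ler_wpDr// => /(_ isT) h.
have := swap_one x N eps0 es => h2.
rewrite !big_ord_recr /=.
have -> : s + (\sum_(i < N) v i + v N) = s + v N + \sum_(i < N) v i by ring.
move: h h2; set A := Ex _; set B := H _ _; set C := Ex _; set D := \sum_(k < N) _; set F := K * _.
clearbody A B C D F => h h2.
apply: le_trans (lerD h h2).
by rewrite [leRHS]addrC; exact: ler_distD.
Qed.

(** Each variance satisfies [v i <= eps ^+ 2 + Ex (tail eps)], so Lindeberg's condition makes all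
    variances small and the sum of their squares is absorbed by the other two terms. *)
Lemma swap_row_bound (eps x : R) N : 0 < eps ->
  `|Ex (fun w => H e (x - S N w)) - H (e + \sum_(i < N) v i) x|
  <= K * ((eps + eps ^+ 2) * (\sum_(i < N) v i) +
    (1 + \sum_(i < N) v i) * \sum_(i < N) Ex (fun w => tail eps (W i w))).
Proof.
move=> eps0; apply: (le_trans (swap_row x N eps0)).
have v0 k : 0 <= v k by apply: Ex_ge0 => w; rewrite sqr_ge0.
rewrite -mulr_sumr ler_wpM2l// !big_split /= -mulr_sumr.
set V := \sum_(i < N) v i; set L := \sum_(i < N) _.
suff : \sum_(i < N) v i ^+ 2 <= eps ^+ 2 * V + V * L by lra.
rewrite {1 2}/V mulr_sumr mulr_suml -big_split /=.
apply: ler_sum => i _; rewrite expr2.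
have vi : v i <= eps ^+ 2 + Ex (fun w => tail eps (W i w)).
  rewrite -[X in X + _](Ex_cst P) -ExD; [|exact: L1_cst|exact: L1_tail].
  apply: Ex_le; [by case: (WL2 i)|by apply: L1D; [exact: L1_cst|exact: L1_tail]|].
  move=> w; rewrite /tail; case: ltP => hW; rewrite ?mul1r ?mul0r ?addr0.
    by rewrite lerDr sqr_ge0.
  by rewrite -(real_normK (num_real (W i w))) ler_pXn2r// nnegrE// ltW.
have t0 : 0 <= Ex (fun w => tail eps (W i w)) by apply: Ex_ge0 => w; exact: tail_ge0.
have vV : v i <= V.
  by rewrite /V (bigD1 i) //= lerDl sumr_ge0.
have tL : Ex (fun w => tail eps (W i w)) <= L.
  by rewrite /L (bigD1 i) //= lerDl sumr_ge0// => j _; apply: Ex_ge0 => w; exact: tail_ge0.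
have := v0 i.
move: vi t0 tL; set a := v i; set b := Ex _; nra.
Qed.

End row.

(** Off the event [a < |Y - S|], the event [Y <= x] leaves [x + 2 * a - S >= a], that is, [1 / a]
    standard deviations of the smoothing, and the smoothed indicator is within [q] of 1. The lower
    bound is symmetric, with the smoothed indicator within [q] of 0 when [x < Y]. *)
Lemma sandwich (S Y : T -> R) (x a q : R) :
  measurable_fun setT S -> measurable_fun setT Y -> 0 < a ->
  `|0 - Phi (- a^-1)| <= q -> `|1 - Phi (a^-1)| <= q ->
  fine (P (Y @^-1` `]-oo, x]%classic)) <=
    Ex (fun w => H (a ^+ 4) (x + 2 * a - S w)) + q + fine (P [set w | a < `|Y w - S w|]) /\
  Ex (fun w => H (a ^+ 4) (x - 2 * a - S w)) - q - fine (P [set w | a < `|Y w - S w|]) <=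
    fine (P (Y @^-1` `]-oo, x]%classic)).
Proof.
move=> mS mY a0 h3 h4.
have q0 : 0 <= q by exact: le_trans h3.
pose e := a ^+ 4.
have e0 : 0 < e by rewrite exprn_gt0.
have se : Num.sqrt e = a ^+ 2 by rewrite /e (exprM a 2 2) sqrtr_sqr ger0_norm// sqr_ge0.
have ua : a / a ^+ 2 = a^-1 by rewrite expr2 invfM mulrA divff ?mul1r// gt_eqF.
have mYx : measurable (Y @^-1` `]-oo, x]%classic).
  by rewrite -[X in measurable X]setTI; apply: mY => //; exact: measurable_itv.
pose Bad := [set w | a < `|Y w - S w|].
have mBad : measurable Bad.
  have -> : Bad = setT `&` (fun w => `|Y w - S w|) @^-1` `]a, +oo[%classic.
    by rewrite setTI; apply/seteqP; split => w /=; rewrite in_itv /= andbT.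
  have mn : measurable_fun setT (fun w => `|Y w - S w|).
    by apply: measurableT_comp => //; exact: measurable_funB.
  by apply: mn => //; exact: measurable_itv.
have LH y : L1 (fun w => H e (y - S w)).
  by apply: L1_H; exact: measurable_funB.
have LY := L1_indic P mYx.
have LB := L1_indic P mBad.
have good w : ~ Bad w -> - a <= Y w - S w <= a.
  by move=> /negP; rewrite -leNgt ler_norml.
have up : fine (P (Y @^-1` `]-oo, x]%classic)) <=
    Ex (fun w => H e (x + 2 * a - S w)) + q + fine (P Bad).
  rewrite -!Ex_indic// -[X in _ + X + _](Ex_cst P) -!ExD//; last 2 first.
  - by apply: L1D => //; exact: L1_cst.
  - exact: L1_cst.
  apply: Ex_le => //; first by apply: L1D => //; apply: L1D => //; exact: L1_cst.
  move=> w; rewrite !indicE.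
  have H0 := Phi_ge0 ((x + 2 * a - S w) / Num.sqrt e).
  case: (asboolP (Bad w)) => hb.
    by rewrite (mem_set hb) /= /H; case: (_ \in _) => /=; lra.
  rewrite (memNset hb) addr0; case: (asboolP (Y w <= x)) => hY; last first.
    rewrite memNset /=; first by rewrite /H; lra.
    by rewrite in_itv /=.
  rewrite mem_set /=; last by rewrite in_itv.
  have /andP[g1 g2] := good _ hb.
  have : Phi a^-1 <= H e (x + 2 * a - S w).
    apply: Phi_nd; rewrite se -ua ler_wpM2r ?invr_ge0 ?sqr_ge0//; lra.
  move: h4; rewrite ler_norml => /andP[? ?]; lra.
have lo : Ex (fun w => H e (x - 2 * a - S w)) - q - fine (P Bad) <=
   fine (P (Y @^-1` `]-oo, x]%classic)).
  rewrite -!Ex_indic// -[X in _ - X - _](Ex_cst P) -!ExB//; last 2 first.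
  - by apply: L1B => //; exact: L1_cst.
  - exact: L1_cst.
  apply: Ex_le => //; first by apply: L1B => //; apply: L1B => //; exact: L1_cst.
  move=> w; rewrite !indicE.
  have H0 := Phi_le1 ((x - 2 * a - S w) / Num.sqrt e).
  case: (asboolP (Bad w)) => hb.
    by rewrite (mem_set hb) /= /H; case: (_ \in _) => /=; lra.
  rewrite (memNset hb) subr0; case: (asboolP (Y w <= x)) => hY.
    rewrite mem_set /=; first by rewrite /H; lra.
    by rewrite in_itv /=.
  rewrite memNset /=; last by rewrite in_itv.
  have /andP[g1 g2] := good _ hb.
  move/negP: hY; rewrite -ltNge => hY.
  have : H e (x - 2 * a - S w) <= Phi (- a^-1).
    have -> : - a^-1 = (- a) / a ^+ 2 by rewrite mulNr ua.
    apply: Phi_nd; rewrite se ler_wpM2r ?invr_ge0 ?sqr_ge0//; lra.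
  move: h3; rewrite ler_norml => /andP[? ?]; lra.
by split.
Qed.

Section array.
Variables (W : nat -> nat -> T -> R) (s2 : R).
Hypothesis WL2 : forall n k, L2 (W n k).
Hypothesis W0 : forall n k, Ex (W n k) = 0.
Hypothesis Wi : forall n k, indep P (fun w => \sum_(i < k) W n i w) (W n k).
Hypothesis Wv : \sum_(k < n) Ex (fun w => W n k w ^+ 2) @[n --> \oo] --> s2.
Hypothesis Wlind : forall eps : R, 0 < eps ->
  \sum_(k < n) Ex (fun w => tail eps (W n k w)) @[n --> \oo] --> (0 : R).

Lemma lindeberg_smooth (e x : R) : 0 < e ->
  Ex (fun w => H e (x - \sum_(i < n) W n i w)) @[n --> \oo] --> H (e + s2) x.
Proof.
move=> e0; have [K K0 HK] := H_bounds e0.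
have v0 n : 0 <= \sum_(k < n) Ex (fun w => W n k w ^+ 2).
  by apply: sumr_ge0 => k _; apply: Ex_ge0 => w; rewrite sqr_ge0.
have l0 eps n : 0 <= \sum_(k < n) Ex (fun w => tail eps (W n k w)).
  by apply: sumr_ge0 => k _; apply: Ex_ge0 => w; exact: tail_ge0.
have s20 : 0 <= s2.
  exact: cvgr_ge0 Wv.
have cH : H (e + \sum_(k < n) Ex (fun w => W n k w ^+ 2)) x @[n --> \oo] --> H (e + s2) x.
  apply: (@cvg_comp _ _ _ (fun n => e + \sum_(k < n) Ex (fun w => W n k w ^+ 2)) (fun s => H s x) _ (nbhs (e + s2))).
    by apply: cvgD => //; exact: cvg_cst.
  by apply: H_continuous; rewrite ltr_wpDr.
apply/cvgrPdist_le => eta eta0.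
pose eps := Num.min 1 (eta / (8 * (K + 1) * (s2 + 1))).
have den0 : 0 < 8 * (K + 1) * (s2 + 1) by rewrite !mulr_gt0//; lra.
have eps0 : 0 < eps by rewrite lt_min ltr01 divr_gt0.
have eps1 : eps <= 1 by rewrite ge_min lexx.
have eps2 : eps * (8 * (K + 1) * (s2 + 1)) <= eta.
  by rewrite -ler_pdivlMr// ge_min lexx orbT.
pose l := eta / (4 * (K + 1) * (s2 + 2)).
have den1 : 0 < 4 * (K + 1) * (s2 + 2) by rewrite !mulr_gt0//; lra.
have l0' : 0 < l by rewrite divr_gt0.
have lE : l * (4 * (K + 1) * (s2 + 2)) = eta by rewrite /l divfK// gt_eqF.
have eta4 : 0 < eta / 4 by rewrite divr_gt0.
near=> n.
rewrite distrC.
have h1 : `|H (e + s2) x - H (e + \sum_(k < n) Ex (fun w => W n k w ^+ 2)) x| <= eta / 4.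
  by near: n; move/cvgrPdist_le: cH; apply.
have h2 : \sum_(k < n) Ex (fun w => W n k w ^+ 2) <= s2 + 1.
  have : `|s2 - \sum_(k < n) Ex (fun w => W n k w ^+ 2)| <= 1.
    by near: n; move/cvgrPdist_le: Wv; apply.
  by rewrite ler_norml => /andP[? ?]; lra.
have h3 : \sum_(k < n) Ex (fun w => tail eps (W n k w)) <= l.
  have : `|0 - \sum_(k < n) Ex (fun w => tail eps (W n k w))| <= l.
    by near: n; move/cvgrPdist_le: (Wlind eps0); apply.
  by rewrite sub0r normrN ger0_norm.
have h4 := swap_row_bound (WL2 n) (W0 n) (Wi n) e0 K0 HK x n eps0.
move: h1 h2 h3 h4 (v0 n) (l0 eps n).
set V := \sum_(k < n) Ex (fun w => W n k w ^+ 2).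
set L := \sum_(k < n) Ex (fun w => tail eps (W n k w)).
set a := Ex _; set b := H (e + V) x; set c := H (e + s2) x.
clearbody V L a b c => h1 h2 h3 h4 V0 L0.
have e3 : K * ((eps + eps ^+ 2) * V + (1 + V) * L) <= eta / 2.
  exact: (@swap_error_le _ K eps V L s2 l).
clear -h1 h4 e3 eta4.
move: h1 h4; rewrite !ler_norml => /andP[? ?] /andP[? ?]; apply/andP; split; lra.
Unshelve. all: end_near.
Qed.

(** The sandwich uses a smoothing of standard deviation [a ^+ 2] and shifts of
    order [a], so that the Gaussian tail at [a / a ^+ 2] vanishes with [a]. *)
Lemma lindeberg_slutsky (Yn : nat -> T -> R) (x G : R) :
  (forall n, measurable_fun setT (Yn n)) ->
  (forall eps : R, 0 < eps ->
    fine (P [set w | eps < `|Yn n w - \sum_(i < n) W n i w|]) @[n --> \oo] --> (0 : R)) ->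
  H (a ^+ 4 + s2) (x + 2 * a) @[a --> 0^'+] --> G ->
  H (a ^+ 4 + s2) (x - 2 * a) @[a --> 0^'+] --> G ->
  fine (P (Yn n @^-1` `]-oo, x]%classic)) @[n --> \oo] --> G.
Proof.
move=> mY YS Hp Hm.
have inv_large (A : R) : \forall a \near (0:R)^'+, A <= a^-1.
  near=> a.
  have a0 : 0 < a by near: a; exact: nbhs_right_gt.
  have aA : a <= (`|A| + 1)^-1.
    by near: a; apply: nbhs_right_le; rewrite invr_gt0 ltr_wpDl.
  rewrite (le_trans (ler_norm A))// (@le_trans _ _ (`|A| + 1)) ?lerDl//.
  by rewrite -[leLHS]invrK lef_pV2// posrE ?invr_gt0 ltr_wpDl.
have q1 : Phi (- a^-1) @[a --> 0^'+] --> (0 : R).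
  apply: (@cvg_comp _ _ _ (fun a : R => - a^-1) Phi _ (-oo)); last exact: Phi_cvgNy.
  apply/cvgrNyPle => A; near=> a; rewrite lerNl; near: a; exact: inv_large.
have q2 : Phi (a^-1) @[a --> 0^'+] --> (1 : R).
  apply: (@cvg_comp _ _ _ (fun a : R => a^-1) Phi _ (+oo)); last exact: Phi_cvgy.
  by apply/cvgryPge => A; exact: inv_large.
apply/cvgrPdist_le => eta eta0.
have eta4 : 0 < eta / 4 by rewrite divr_gt0.
(* One width [a] is fixed for the accuracy [eta]; only then does [n] grow. *)
have [a [a0 [h1 h2 h3 h4]]] : exists a : R, 0 < a /\
   [/\ `|G - H (a ^+ 4 + s2) (x + 2 * a)| <= eta / 4,
      `|G - H (a ^+ 4 + s2) (x - 2 * a)| <= eta / 4,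
      `|0 - Phi (- a^-1)| <= eta / 4 & `|1 - Phi (a^-1)| <= eta / 4].
  have nr : \forall a \near (0:R)^'+, 0 < a /\
   [/\ `|G - H (a ^+ 4 + s2) (x + 2 * a)| <= eta / 4,
      `|G - H (a ^+ 4 + s2) (x - 2 * a)| <= eta / 4,
      `|0 - Phi (- a^-1)| <= eta / 4 & `|1 - Phi (a^-1)| <= eta / 4].
    near=> a; split; first by near: a; exact: nbhs_right_gt.
    split; near: a.
    - by move/cvgrPdist_le: Hp; apply.
    - by move/cvgrPdist_le: Hm; apply.
    - by move/cvgrPdist_le: q1; apply.
    - by move/cvgrPdist_le: q2; apply.
  by have [a ha] := filter_ex nr; exists a.
have e0 : 0 < a ^+ 4 by rewrite exprn_gt0.
have cp := @lindeberg_smooth (a ^+ 4) (x + 2 * a) e0.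
have cm := @lindeberg_smooth (a ^+ 4) (x - 2 * a) e0.
have {}cp := (cvgrPdist_le _ _).1 cp _ eta4.
have {}cm := (cvgrPdist_le _ _).1 cm _ eta4.
have cP := (cvgrPdist_le _ _).1 (YS _ a0) _ eta4.
apply: filterS3 (cP _) (cp _) (cm _) => n b0 b1 b2.
have mS : measurable_fun setT (fun w => \sum_(i < n) W n i w).
  by apply: measurable_sum => i; case: (WL2 n i).
have [up lo] := sandwich x mS (mY n) a0 h3 h4.
exact: sandwich_dist_le up lo h1 h2 b0 b1 b2.
Unshelve. all: end_near.
Qed.

End array.
End swapping.

(** * Regular variation and Karamata's theorem *)

Section uniform_convergence.
Context {R : realType}.
Notation mu := (@lebesgue_measure R).

Lemma lebesgue_measure_translate (c : R) (A : set R) : measurable A ->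
  mu ((fun x => x + c) @^-1` A) = mu A.
Proof.
move=> mA.
have mc : measurable_fun setT (fun x : measurableTypeR R => (x + c : measurableTypeR R)).
  by apply: measurable_funD.
apply/esym; apply: (@lebesgue_measure_unique R (measure_function_pushforward__canonical__measure_function_Measure mu mc)) => //.
move=> X [[a b] _ <-]; rewrite /= /pushforward.
have -> : (fun x => x + c) @^-1` `]a, b]%classic = `]a - c, b - c]%classic :> set R.
  by apply/seteqP; split => x /=; rewrite !in_itv /= ltrBlDr lerBrDr.
rewrite !lebesgue_measure_itv /= !lte_fin ltrD2r; case: ifP => // _.
by rewrite -!EFinD; congr (_%:E); ring.
Qed.

(** By pointwise convergence the sets [V N] increase to the whole interval from 0 to 2, so their
    measures tend to 2. *)
Lemma eventually_close_measure (h : R -> R) (y : nat -> R) (eta : R) :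
  measurable_fun setT h -> 0 < eta ->
  (forall u, h (y n + u) - h (y n) @[n --> \oo] --> (0 : R)) ->
  exists N, let V := [set v : R | 0 <= v <= 2 /\
      forall m, (N <= m)%N -> `|h (y m + v) - h (y m)| <= eta] in
    measurable V /\ (mu V > (3 / 2)%:E)%E.
Proof.
move=> mh eta0 hy.
pose V N := [set v : R | 0 <= v <= 2 /\
      forall m, (N <= m)%N -> `|h (y m + v) - h (y m)| <= eta].
have mV N : measurable (V N).
  have -> : V N = `[0, 2]%classic `&` \bigcap_m
     [set v | (N <= m)%N -> `|h (y m + v) - h (y m)| <= eta].
    apply/seteqP; split => v /=; rewrite in_itv /=.
      by move=> [v2 hv]; split => // m _ Nm; exact: hv.
    by move=> [v2 hv]; split => // m Nm; exact: (hv m I).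
  apply: measurableI; first exact: measurable_itv.
  apply: bigcap_measurable => // m _.
  case: (leqP N m) => Nm; last first.
    by rewrite (_ : [set _ | _] = setT)//; apply/seteqP; split.
  have -> : [set v | true -> `|h (y m + v) - h (y m)| <= eta] =
     setT `&` (fun v => `|h (y m + v) - h (y m)|) @^-1` `]-oo, eta]%classic.
    by rewrite setTI; apply/seteqP; split => v /=; rewrite in_itv //=; exact.
  have mm : measurable_fun setT (fun v => `|h (y m + v) - h (y m)|).
    apply: measurableT_comp => //; apply: measurable_funB => //.
    by apply: (measurableT_comp mh); exact: measurable_funD.
  by apply: mm => //; exact: measurable_itv.
have ndV : nondecreasing_seq V.
  move=> N M NM; apply/subsetPset => v [v2 hv]; split => // m Mm.
  by apply: hv; exact: leq_trans Mm.
have UV : \bigcup_N V N = `[0, 2]%classic.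
  apply/seteqP; split => v /=; first by move=> [N _ [v2 _]]; rewrite in_itv.
  rewrite in_itv /= => v2.
  have /cvgrPdist_le /(_ _ eta0) [N _ hN] := hy v.
  by exists N => //; split => // m Nm; have := hN m Nm; rewrite sub0r normrN.
have cV : mu (V N) @[N --> \oo] --> (2%:E : \bar R).
  have -> : 2%:E = mu (\bigcup_N V N).
    by rewrite UV lebesgue_measure_itv /= lte_fin ltr0n /= oppr0 adde0.
  apply: nondecreasing_cvg_mu => //.
  by rewrite UV; exact: measurable_itv.
have : \forall N \near \oo, (mu (V N) > (3 / 2)%:E)%E.
  have lt32 : (3 / 2 : R) < 2 by lra.
  apply: filterS (cvgr_gt _ (fine_cvg cV) _ lt32) => N /= hN.
  move: hN; case: (mu (V N)) => [r||] /=; rewrite ?lte_fin ?ltry// => h32.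
  by exfalso; lra.
by move=> /filter_ex[N hN]; exists N; split; [exact: mV|exact: hN].
Qed.

(** Sets of measure more than 3/2 inside an interval of length 3 must meet. *)
Lemma uniform_convergence_additive (h : R -> R) (eta : R) :
  measurable_fun setT h -> 0 < eta ->
  (forall u, h (x + u) - h x @[x --> +oo] --> (0 : R)) ->
  exists x0, forall x u, x0 <= x -> 0 <= u <= 1 -> `|h (x + u) - h x| <= eta.
Proof.
move=> mh eta0 hh; apply: contrapT => nh.
have ex n : exists xu : R * R, [/\ n%:R <= xu.1, 0 <= xu.2 <= 1 &
    eta < `|h (xu.1 + xu.2) - h xu.1|].
  apply: contrapT => nex; apply: nh; exists n%:R => x u nx u1.
  by rewrite leNgt; apply/negP => hu; apply: nex; exists (x, u).
have [xu hxu] := choice ex.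
pose x n := (xu n).1; pose u n := (xu n).2.
have xoo (y : nat -> R) : (forall n, n%:R <= y n) -> y n @[n --> \oo] --> +oo.
  move=> hy; apply/cvgryPge => A.
  near=> n; apply: le_trans (hy n); near: n; exact: nbhs_infty_ger.
have x1 n : n%:R <= x n by have [] := hxu n.
have u01 n : 0 <= u n <= 1 by have [] := hxu n.
have y1 n : n%:R <= x n + u n.
  by rewrite (le_trans (x1 n))// lerDl; have /andP[] := u01 n.
have eta2 : 0 < eta / 2 by rewrite divr_gt0.
have [N1 /= [mV mV32]] := eventually_close_measure mh eta2
  (fun v => cvg_comp _ _ (xoo _ x1) (hh v)).
have [N2 /= [mW mW32]] := eventually_close_measure mh eta2
  (fun v => cvg_comp _ _ (xoo _ y1) (hh v)).
set V := [set v | _] in mV mV32; set W := [set v | _] in mW mW32.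
pose N := maxn N1 N2.
(* Translated back by [u N], the points of [W] are counted from [x N]. A point [v] common to [V] and
   [W'] puts [h (x N + v)] within [eta / 2] of both [h (x N)] and [h (x N + u N)], against the
   choice of [x N] and [u N]. *)
pose W' := (fun v => v + (- u N)) @^-1` W.
have mW' : measurable W'.
  have mm : measurable_fun setT (fun v : R => v + (- u N)) by exact: measurable_funD.
  by rewrite /W' -[X in measurable X]setTI; exact: mm.
have mW'32 : (mu W' > (3 / 2)%:E)%E by rewrite lebesgue_measure_translate.
have [VW0|] := eqVneq (V `&` W') set0.
  have : (mu (V `|` W') <= mu `[0%R, 3%R]%classic)%E.
    apply: le_measure; rewrite ?inE; [exact: measurableU|exact: measurable_itv|].
    move=> v [[/andP[v0 v2] _]|[/andP[v0 v2] _]] /=; rewrite in_itv /=.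
      by rewrite v0 (le_trans v2)// ler_nat.
    have /andP[? ?] := u01 N; apply/andP; split; lra.
  rewrite measureU// lebesgue_measure_itv /= lte_fin ltr0n /= oppr0 adde0.
  rewrite leNgt => /negP; apply.
  have -> : 3%:E = ((3 / 2)%:E + (3 / 2)%:E)%E :> \bar R by rewrite -EFinD; congr EFin; lra.
  by apply: lteD.
move=> /set0P[v [[v2 hV] [w2 hW]]].
have /= h1 := hV N (leq_maxl _ _).
have /= h2 := hW N (leq_maxr _ _).
have [_ _] := hxu N; rewrite ltNge => /negP; apply.
rewrite -/(x N) -/(u N).
have e1 : x N + u N + (v - u N) = x N + v by ring.
move: h1 h2; rewrite e1 => h1 h2.
have -> : h (x N + u N) - h (x N) = (h (x N + v) - h (x N)) - (h (x N + v) - h (x N + u N)) by ring.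
by apply: (le_trans (ler_normB _ _)); lra.
Unshelve. all: end_near.
Qed.

(** Unit steps followed by one fractional step, each costing [eta]. This is Potter's bound in
    additive form. *)
Lemma uniform_increment (h : R -> R) (eta : R) :
  measurable_fun setT h -> 0 < eta ->
  (forall u, h (x + u) - h x @[x --> +oo] --> (0 : R)) ->
  exists x0, forall x y, x0 <= x -> x <= y -> `|h y - h x| <= eta * (1 + (y - x)).
Proof.
move=> mh eta0 hh; have [x0 hx0] := uniform_convergence_additive mh eta0 hh.
exists x0 => x y x0x xy.
have step (k : nat) : `|h (x + k%:R) - h x| <= eta * k%:R.
  elim: k => [|k ih]; first by rewrite addr0 subrr normr0 mulr0.
  have := @hx0 (x + k%:R) 1; rewrite ler01 lexx (le_trans x0x) ?lerDl ?ler0n// => /(_ isT isT) h1.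
  have -> : x + k.+1%:R = x + k%:R + 1 by rewrite -natr1 addrA.
  rewrite -natr1 mulrDr mulr1.
  have -> : h (x + k%:R + 1) - h x = (h (x + k%:R + 1) - h (x + k%:R)) + (h (x + k%:R) - h x) by ring.
  by apply: (le_trans (ler_normD _ _)); lra.
pose k := Num.truncn (y - x).
have yx : 0 <= y - x by rewrite subr_ge0.
have /andP[k1 k2] := truncn_itv yx.
have := @hx0 (x + k%:R) (y - x - k%:R).
have -> : x + k%:R + (y - x - k%:R) = y by ring.
rewrite (le_trans x0x) ?lerDl ?ler0n// => /(_ isT).
have k3 : 0 <= y - x - k%:R <= 1.
  by move: k1 k2; rewrite -/k -natr1 => k1 k2; apply/andP; split; lra.
move=> /(_ k3) h1.
have := step k => h2.
have -> : h y - h x = (h y - h (x + k%:R)) + (h (x + k%:R) - h x) by ring.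
apply: (le_trans (ler_normD _ _)).
have : eta * k%:R <= eta * (y - x) by rewrite ler_pM2l.
lra.
Qed.

End uniform_convergence.

(** * Regularly varying sequences and their sums *)

Section regular_variation.
Context {R : realType}.
Implicit Types (f g : nat -> R) (rho : R).

(** Potter-type formulation of "f is regularly varying of index rho". *)
Definition rvs rho f :=
  (\forall n \near \oo, 0 < f n) /\
  forall eta, 0 < eta -> exists N, forall k n, (N <= k)%N -> (k <= n)%N ->
    `|ln (f n) - ln (f k) - rho * (ln n%:R - ln k%:R)| <=
      eta * (1 + (ln n%:R - ln k%:R)).

Lemma ln_nat_le (k n : nat) : (0 < k)%N -> (k <= n)%N -> ln (k%:R : R) <= ln n%:R.
Proof.
move=> k0 kn; rewrite ler_ln ?posrE ?ltr0n ?ler_nat//.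
exact: leq_trans kn.
Qed.

(** On the logarithmic scale slow variation becomes the vanishing of additive increments, the
    hypothesis of [uniform_increment]. *)
Lemma slowly_varying_additive (L : R -> R) : slowly_varying L ->
  exists h : R -> R, [/\ measurable_fun setT h,
    (forall u, h (x + u) - h x @[x --> +oo] --> (0 : R)) &
    exists a : R, forall x, a < x -> 0 < x -> 0 < L x /\ ln (L x) = h (ln x)].
Proof.
move=> [[a [mL Lpos]] Lc].
(* Measurability of [L] is known beyond [a] only; cutting [L] off there gives a function measurable
   on the whole line. *)
pose L' := L \_ `]a, +oo[%classic.
have mL' : measurable_fun setT L'.
  by apply/(measurable_restrictT L); first exact: measurable_itv.
have L'E x : a < x -> L' x = L x.
  by move=> ax; rewrite /L' patchE mem_set//= in_itv /= andbT.
exists (fun x => ln (L' (expR x))); split.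
- apply: (measurableT_comp (@measurable_ln R)).
  exact: (measurableT_comp mL' (@measurable_expR R)).
- move=> u.
  have e0 : 0 < expR u by exact: expR_gt0.
  have c1 : ln (L (expR u * x) / L x) @[x --> +oo] --> (0 : R).
    rewrite -(@ln1 R); apply: (cvg_comp _ _ (Lc _ e0)).
    by apply: continuous_ln.
  have c2 : ln (L (expR u * expR x) / L (expR x)) @[x --> +oo] --> (0 : R).
    apply: (@cvg_comp _ _ _ expR (fun x => ln (L (expR u * x) / L x)) _ (+oo) _ _ c1).
    apply/cvgryPge => A; near=> x; apply: le_trans (expR_ge1Dx x).
  have : A <= x by near: x; apply: nbhs_pinfty_ge; exact: num_real.
  lra.
  apply: cvg_trans c2; apply: near_eq_cvg; near=> x.
  have ax : a < expR x.
    apply: lt_le_trans (expR_ge1Dx x).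
    have : a <= x by near: x; apply: nbhs_pinfty_ge; exact: num_real.
    lra.
  have axu : a < expR u * expR x.
    rewrite -expRD; apply: lt_le_trans (expR_ge1Dx _).
    have : a - u <= x by near: x; apply: nbhs_pinfty_ge; exact: num_real.
    lra.
  by rewrite (addrC x u) expRD !L'E// ln_div// posrE; exact: Lpos.
- exists a => x ax x0; split; first exact: Lpos.
  by rewrite lnK ?posrE// L'E.
Unshelve. all: end_near.
Qed.

Lemma rvs_slowly_varying rho (L : R -> R) f : slowly_varying L ->
  (forall n, (0 < n)%N -> f n = n%:R `^ rho * L n%:R) -> rvs rho f.
Proof.
move=> /slowly_varying_additive[h [mh hh [a hL]]] fE.
have pos (n : nat) : a < n%:R -> (0 < n)%N -> 0 < f n /\ ln (f n) = rho * ln n%:R + h (ln n%:R).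
  move=> an n0; have n0' : 0 < n%:R :> R by rewrite ltr0n.
  have [Lp LE] := hL _ an n0'.
  have p0 : 0 < n%:R `^ rho :> R by rewrite powR_gt0.
  rewrite fE// mulr_gt0//; split => //.
  by rewrite lnM ?posrE// ln_powR LE.
have large (A : R) : \forall n \near \oo, A <= n%:R :> R by exact: nbhs_infty_ger.
split.
  near=> n; have [] // := pos n.
    have : a + 1 <= n%:R by near: n; exact: large.
    lra.
  by near: n; exact: nbhs_infty_gt.
move=> eta eta0; have [x0 hx0] := uniform_increment mh eta0 hh.
have [N [] N0 N1 N2] : exists N : nat, [/\ (0 < N)%N, a < N%:R & expR x0 <= N%:R].
  have nr : \forall N \near \oo, [/\ (0 < N)%N, a < N%:R & expR x0 <= N%:R].
    near=> N; split.
    - by near: N; exact: nbhs_infty_gt.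
    - have : a + 1 <= N%:R by near: N; exact: large.
      lra.
    - by near: N; exact: large.
  by have [N hN] := filter_ex nr; exists N.
exists N => k n Nk kn.
have Nkr : N%:R <= k%:R :> R by rewrite ler_nat.
have knr : k%:R <= n%:R :> R by rewrite ler_nat.
have k0 : (0 < k)%N by exact: leq_trans Nk.
have n0 : (0 < n)%N by exact: leq_trans kn.
have [_ ->] := pos k (lt_le_trans N1 Nkr) k0.
have [_ ->] := pos n (lt_le_trans N1 (le_trans Nkr knr)) n0.
have -> : rho * ln n%:R + h (ln n%:R) - (rho * ln k%:R + h (ln k%:R)) -
  rho * (ln n%:R - ln k%:R) = h (ln n%:R) - h (ln k%:R) by ring.
apply: hx0; last exact: ln_nat_le.
by rewrite -[leLHS]expRK ler_ln ?posrE ?expR_gt0 ?ltr0n// (le_trans N2).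
Unshelve. all: end_near.
Qed.

Lemma rvs_mul rho rho' f g : rvs rho f -> rvs rho' g ->
  rvs (rho + rho') (fun n => f n * g n).
Proof.
move=> [fp hf] [gp hg]; split.
  by apply: filterS2 fp gp => n; exact: mulr_gt0.
move=> eta eta0; have eta2 : 0 < eta / 2 by rewrite divr_gt0.
have [N1 h1] := hf _ eta2; have [N2 h2] := hg _ eta2.
have [N3 _ h3] := fp; have [N4 _ h4] := gp.
exists (maxn (maxn N1 N2) (maxn N3 N4)) => k n.
rewrite !geq_max => /andP[/andP[k1 k2] /andP[k3 k4]] kn.
have fk := h3 _ k3; have gk := h4 _ k4.
have fn := h3 _ (leq_trans k3 kn); have gn := h4 _ (leq_trans k4 kn).
rewrite !lnM ?posrE//.
have := h1 _ _ k1 kn; have := h2 _ _ k2 kn; rewrite !ler_norml.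
by move=> /andP[? ?] /andP[? ?]; apply/andP; split; lra.
Qed.

Lemma rvs_equiv rho f g (c : R) : 0 < c -> rvs rho f ->
  g n / f n @[n --> \oo] --> c -> rvs rho g.
Proof.
move=> c0 [fp hf] gf.
have gp : \forall n \near \oo, 0 < g n.
  apply: filterS2 fp (cvgr_gt _ gf _ c0) => n fn gn.
  by rewrite -(divfK (lt0r_neq0 fn) (g n)) mulr_gt0.
split => // eta eta0; have eta2 : 0 < eta / 4 by rewrite divr_gt0.
have [N1 h1] := hf _ eta2.
have lgf : ln (g n / f n) @[n --> \oo] --> ln c.
  by apply: (cvg_comp _ _ gf); exact: continuous_ln.
have /cvgrPdist_le /(_ _ eta2) [N2 _ h2] := lgf.
have [N3 _ h3] := fp; have [N4 _ h4] := gp.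
exists (maxn (maxn N1 N2) (maxn N3 (maxn N4 1))) => k n.
rewrite !geq_max => /andP[/andP[k1 k2] /andP[k3 /andP[k4 k0]]] kn.
have fk := h3 _ k3; have gk := h4 _ k4.
have fn := h3 _ (leq_trans k3 kn); have gn := h4 _ (leq_trans k4 kn).
have := h2 _ k2; have := h2 _ (leq_trans k2 kn) => /=.
rewrite !ln_div ?posrE//.
have dl : 0 <= eta * (ln n%:R - ln k%:R) by rewrite mulr_ge0 ?subr_ge0 ?ln_nat_le// ltW.
have := h1 _ _ k1 kn; rewrite !ler_norml.
by move=> /andP[? ?] /andP[? ?] /andP[? ?]; apply/andP; split; lra.
Qed.

(** The exponential is the power [(1 - y) ^ t]. Both sides follow from [ln (1 + x) <= x], applied at
    [- y] and at [y / (1 - y)]. *)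
Lemma one_sub_pow_bounds (t y : R) : 0 < t -> 0 < y -> y < 1 ->
  t * y * (1 - t * y) <= 1 - expR (t * ln (1 - y)) <= t * y / (1 - y).
Proof.
move=> t0 y0 y1.
have z0 : 0 < 1 - y by rewrite subr_gt0.
have l1 : ln (1 - y) <= - y by apply: le_ln1Dx; rewrite ltrN2.
have l2 : - (y / (1 - y)) <= ln (1 - y).
  rewrite lerNl -lnV ?posrE//.
  rewrite [X in ln X](_ : _ = 1 + y / (1 - y)); last by field; rewrite gt_eqF.
  by apply: le_ln1Dx; rewrite (@lt_le_trans _ _ 0)// divr_ge0// ltW.
apply/andP; split.
  have e1 : expR (t * ln (1 - y)) <= expR (- (t * y)).
    by rewrite ler_expR -mulrN ler_pM2l.
  have ty : 0 < t * y by rewrite mulr_gt0.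
  (* From [expR z >= 1 + z] and [(1 - z + z ^+ 2) * (1 + z) = 1 + z ^+ 3 >= 1], with [z = t * y]. *)
  have e2 : expR (- (t * y)) <= 1 - t * y + (t * y) ^+ 2.
    have := expR_ge1Dx (t * y) => h.
    rewrite expRN -div1r ler_pdivrMr ?expR_gt0//.
    have h0 : 0 <= 1 - t * y + (t * y) ^+ 2.
      by have := sqr_ge0 (t * y - 2^-1); rewrite sqrrB; nra.
    apply: le_trans (ler_wpM2l h0 h).
    have -> : (1 - t * y + (t * y) ^+ 2) * (1 + t * y) = 1 + (t * y) ^+ 3 by ring.
    by rewrite lerDl exprn_ge0// ltW.
  by move: e1 e2; rewrite expr2; lra.
have := expR_ge1Dx (t * ln (1 - y)).
have : t * - (y / (1 - y)) <= t * ln (1 - y) by rewrite ler_pM2l.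
by rewrite mulrN mulrA; lra.
Qed.

(** Writing [k - 1 = k * (1 - y)] with [y = 1 / k] reduces the increment of the power to
    [one_sub_pow_bounds]. [N] is large enough for [t * y <= eta] and [1 / (1 - y) <= 1 + eta]. *)
Lemma pow_increment_bounds (t eta : R) : 0 < t -> 0 < eta -> eta < 1 ->
  exists N, (1 < N)%N /\ forall k : nat, (N <= k)%N ->
   (1 - eta) * (t * expR ((t - 1) * ln k%:R)) <=
     expR (t * ln k%:R) - expR (t * ln k.-1%:R) <=
   (1 + eta) * (t * expR ((t - 1) * ln k%:R)).
Proof.
move=> t0 eta0 eta1.
have [N [N1 N2 N3]] : exists N : nat, [/\ (1 < N)%N, t / eta <= N%:R & (1 + eta) / eta <= N%:R].
  have nr : \forall N \near \oo, [/\ (1 < N)%N, t / eta <= N%:R & (1 + eta) / eta <= N%:R].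
    near=> N; split; near: N; [exact: nbhs_infty_gt|exact: nbhs_infty_ger|exact: nbhs_infty_ger].
  by have [N hN] := filter_ex nr; exists N.
exists N; split => // k Nk.
have k1 : (1 < k)%N by exact: leq_trans Nk.
have Nkr : N%:R <= k%:R :> R by rewrite ler_nat.
have kr0 : 0 < k%:R :> R by rewrite ltr0n (ltn_trans _ k1).
have kr1 : 1 < k%:R :> R by rewrite ltr1n.
pose y : R := k%:R^-1.
have y0 : 0 < y by rewrite invr_gt0.
have y1 : y < 1 by rewrite invf_lt1.
have ky : k%:R * y = 1 by rewrite divff// gt_eqF.
have kp : k.-1%:R = k%:R * (1 - y) :> R.
  by rewrite mulrBr ky mulr1 -subn1 natrB// ltnW.
have lk : ln k.-1%:R = ln k%:R + ln (1 - y) :> R.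
  by rewrite kp lnM ?posrE// subr_gt0.
have e1 : expR ((t - 1) * ln k%:R) = expR (t * ln k%:R) * y.
  by rewrite mulrBl mul1r expRB lnK ?posrE.
have -> : expR (t * ln k%:R) - expR (t * ln k.-1%:R) = expR (t * ln k%:R) * (1 - expR (t * ln (1 - y))).
  by rewrite lk mulrDr expRD mulrBr mulr1.
have /andP[b1 b2] := one_sub_pow_bounds t0 y0 y1.
have ty : t * y <= eta.
  have := le_trans N2 Nkr; rewrite ler_pdivrMr// => h.
  by rewrite -(ler_pM2l kr0) mulrCA ky mulr1.
have z0 : 0 < 1 - y by rewrite subr_gt0.
have oy : (1 - y)^-1 <= 1 + eta.
  rewrite -div1r ler_pdivrMr//.
  have := le_trans N3 Nkr; rewrite ler_pdivrMr// => h.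
  have : y * (1 + eta) <= eta by rewrite -(ler_pM2l kr0) mulrA ky mul1r.
  by lra.
have tyy : 0 < t * y by rewrite mulr_gt0.
rewrite e1; apply/andP; split.
  rewrite (_ : (1 - eta) * _ = expR (t * ln k%:R) * (t * y * (1 - eta))); last by ring.
  rewrite ler_pM2l ?expR_gt0//; apply: le_trans b1.
  by rewrite ler_pM2l//; lra.
rewrite (_ : (1 + eta) * _ = expR (t * ln k%:R) * (t * y * (1 + eta))); last by ring.
rewrite ler_pM2l ?expR_gt0//; apply: (le_trans b2).
by rewrite ler_pM2l.
Unshelve. all: end_near.
Qed.

(** Telescoping of the increments of [k ^ t], in place of a comparison with an integral. *)
Lemma pow_sum_bounds (t eta : R) : 0 < t -> 0 < eta -> eta < 1 ->
  exists N, (1 < N)%N /\ forall M n, (N <= M)%N -> (M <= n)%N ->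
   (1 - eta) * (t * \sum_(M <= k < n.+1) expR ((t - 1) * ln k%:R)) <= expR (t * ln n%:R) /\
   expR (t * ln n%:R) - expR (t * ln M%:R) <=
   (1 + eta) * (t * \sum_(M <= k < n.+1) expR ((t - 1) * ln k%:R)).
Proof.
move=> t0 eta0 eta1; have [N [N1 hN]] := pow_increment_bounds t0 eta0 eta1.
exists N; split => // M n NM Mn.
have M0 : (0 < M)%N by apply: leq_trans NM; exact: ltnW.
have tel : \sum_(M <= k < n.+1) (expR (t * ln k%:R) - expR (t * ln k.-1%:R)) =
   expR (t * ln n%:R) - expR (t * ln M.-1%:R) :> R.
  have Mn1 : (M.-1 <= n)%N by apply: leq_trans (leq_pred _) Mn.
  rewrite -(telescope_sumr (fun k => expR (t * ln k%:R)) Mn1).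
  rewrite -{1}(prednK M0) big_add1 /=.
  by apply: eq_bigr => k _.
have le1 : (1 - eta) * (t * \sum_(M <= k < n.+1) expR ((t - 1) * ln k%:R)) <=
   expR (t * ln n%:R) - expR (t * ln M.-1%:R).
  rewrite -tel !mulr_sumr; apply: ler_sum_nat => k /andP[Mk _].
  by have /andP[] := hN k (leq_trans NM Mk).
have le2 : expR (t * ln n%:R) - expR (t * ln M.-1%:R) <=
   (1 + eta) * (t * \sum_(M <= k < n.+1) expR ((t - 1) * ln k%:R)).
  rewrite -tel !mulr_sumr; apply: ler_sum_nat => k /andP[Mk _].
  by have /andP[] := hN k (leq_trans NM Mk).
split.
  by have := expR_ge0 (t * ln M.-1%:R); lra.
apply: le_trans le2; rewrite lerD2l lerN2 ler_expR ler_pM2l//.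
apply: ln_nat_le; last exact: leq_pred.
by rewrite -ltnS prednK// (leq_trans N1).
Qed.

Lemma expR_neg_ln_cvg0 (t : R) : 0 < t -> expR (- (t * ln n%:R)) @[n --> \oo] --> (0 : R).
Proof.
move=> t0; apply/cvgrPdist_le => e e0; near=> n.
rewrite sub0r normrN ger0_norm ?expR_ge0//.
have n0 : 0 < n%:R :> R by rewrite ltr0n; near: n; exact: nbhs_infty_gt.
rewrite -[leRHS]lnK ?posrE// ler_expR lerNl -ler_pdivrMl//.
rewrite -[leLHS]expRK ler_ln ?posrE ?expR_gt0//.
near: n; exact: nbhs_infty_ger.
Unshelve. all: end_near.
Qed.

Lemma karamata_constants (rho e : R) : 0 <= rho -> 0 < e ->
  exists eta : R, [/\ 0 < eta, eta < 1, eta <= 1 / 2,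
   expR eta / ((1 - eta) * (rho + 1 - eta)) <= (rho + 1)^-1 + e &
   (rho + 1)^-1 - e <= expR (- eta) / ((1 + eta) * (rho + 1 + eta))].
Proof.
move=> r0 e0.
have r1 : rho + 1 != 0 by rewrite gt_eqF// ltr_wpDl.
have c1 : expR x / ((1 - x) * (rho + 1 - x)) @[x --> (0:R)^'+] --> (rho + 1)^-1.
  apply: (@cvg_at_right_filter _ _ (fun x : R => expR x / ((1 - x) * (rho + 1 - x)))).
  have -> : (rho + 1)^-1 = expR 0 / ((1 - 0) * (rho + 1 - 0)).
    by rewrite expR0 !subr0 !mul1r.
  apply: cvgM; first exact: continuous_expR.
  apply: cvgV; first by rewrite !subr0 mul1r.
  by apply: cvgM; apply: cvgB; [exact: cvg_cst|exact: cvg_id|exact: cvg_cst|exact: cvg_id].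
have c2 : expR (- x) / ((1 + x) * (rho + 1 + x)) @[x --> (0:R)^'+] --> (rho + 1)^-1.
  apply: (@cvg_at_right_filter _ _ (fun x : R => expR (- x) / ((1 + x) * (rho + 1 + x)))).
  have -> : (rho + 1)^-1 = expR (- 0) / ((1 + 0) * (rho + 1 + 0)).
    by rewrite oppr0 expR0 !addr0 !mul1r.
  apply: cvgM.
    apply: (@cvg_comp _ _ _ -%R expR _ (nbhs (- 0 : R))); last exact: continuous_expR.
    by apply: cvgN; exact: cvg_id.
  apply: cvgV; first by rewrite !addr0 mul1r.
  by apply: cvgM; apply: cvgD; [exact: cvg_cst|exact: cvg_id|exact: cvg_cst|exact: cvg_id].
have /cvgrPdist_le /(_ _ e0) h1 := c1.
have /cvgrPdist_le /(_ _ e0) h2 := c2.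
have h3 : \forall x \near (0:R)^'+, 0 < x by exact: nbhs_right_gt.
have h4 : \forall x \near (0:R)^'+, x <= 1 / 2 by apply: nbhs_right_le; rewrite divr_gt0.
have nr : \forall x \near (0:R)^'+, [/\
    `|(rho + 1)^-1 - expR x / ((1 - x) * (rho + 1 - x))| <= e,
    `|(rho + 1)^-1 - expR (- x) / ((1 + x) * (rho + 1 + x))| <= e,
    0 < x & x <= 1 / 2].
  by near=> x; split; near: x.
have [x [hx1 hx2 hx3 hx4]] := @filter_ex _ _ (at_right_proper_filter (0 : R)) _ nr.
exists x; split => //.
- by lra.
- by move: hx1; rewrite ler_norml => /andP[? ?]; lra.
- by move: hx2; rewrite ler_norml => /andP[? ?]; lra.
Unshelve. all: end_near.
Qed.

(** Potter's bounds squeeze [f k / f n], for [M <= k <= n], between [expR (- eta)] times [k / n] to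
    the power [rho + eta] and [expR eta] times [k / n] to the power [rho - eta]. The powers are
    summed by [pow_sum_bounds], and [karamata_constants] supplies an [eta] for which both ends are
    close to the limit. *)
Lemma karamata rho f : 0 <= rho -> (forall k, 0 <= f k) -> rvs rho f ->
  (\sum_(1 <= k < n.+1) f k) / (n%:R * f n) @[n --> \oo] --> (rho + 1)^-1.
Proof.
move=> r0 f0 [fp hf]; apply/cvgrPdist_le => e e0.
have e2 : 0 < e / 2 by rewrite divr_gt0.
have [eta [eta0 eta1 eta12 up lo]] := karamata_constants r0 e2.
pose t := rho + 1 - eta; pose t' := rho + 1 + eta.
have t0 : 0 < t by rewrite /t; lra.
have t'0 : 0 < t' by rewrite /t'; lra.
have [N1 h1] := hf _ eta0.
have [N2 [_ h2]] := pow_sum_bounds t0 eta0 eta1.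
have [N3 [_ h3]] := pow_sum_bounds t'0 eta0 eta1.
have [N4 _ h4] := fp.
pose M := maxn (maxn N1 N2) (maxn N3 (maxn N4 1)).
have := leqnn M; rewrite {1}/M !geq_max.
move=> /andP[/andP[M1 M2] /andP[M3 /andP[M4 M5]]].
have fM : 0 < f M by exact: h4.
pose C := \sum_(1 <= k < M) f k.
have C0 : 0 <= C by rewrite sumr_ge0.
have comp k n : (M <= k)%N -> (k <= n)%N ->
   f n * expR (- eta) * expR ((t' - 1) * ln k%:R) * expR (- ((t' - 1) * ln n%:R)) <= f k <=
   f n * expR eta * expR ((t - 1) * ln k%:R) * expR (- ((t - 1) * ln n%:R)).
  move=> Mk kn.
  have fk : 0 < f k by apply: h4; exact: leq_trans Mk.
  have fn : 0 < f n by apply: h4; exact: (leq_trans M4 (leq_trans Mk kn)).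
  have := h1 k n (leq_trans M1 Mk) kn; rewrite ler_norml => /andP[b1 b2].
  have fnE : f n = expR (ln (f n)) by rewrite lnK.
  have fkE : f k = expR (ln (f k)) by rewrite lnK.
  move: b1 b2 fnE fkE; set a := ln (f n); set b := ln (f k) => b1 b2 -> ->.
  rewrite -!expRD !ler_expR /t /t'.
  by apply/andP; split; lra.
have nE s n : (0 < n)%N -> expR (- ((s - 1) * ln n%:R)) = n%:R * expR (- (s * ln n%:R)) :> R.
  move=> n0; have -> : - ((s - 1) * ln n%:R) = ln n%:R - s * ln n%:R :> R by ring.
  by rewrite expRD lnK// posrE ltr0n.
(* The terms below [M] form a constant, whereas [n * f n] grows at least like [n ^ t] by
   [comp M n]. *)
have cC : C * (expR eta * expR ((t - 1) * ln M%:R) / f M) * expR (- (t * ln n%:R)) @[n --> \oo] --> (0 : R).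
  by rewrite -[X in _ --> X](mulr0 (C * (expR eta * expR ((t - 1) * ln M%:R) / f M))); apply: cvgM; [exact: cvg_cst|exact: expR_neg_ln_cvg0].
(* The loss in the lower bound from starting the telescoping sum at [M]. *)
have cD : expR (t' * ln M%:R) * expR (- (t' * ln n%:R)) @[n --> \oo] --> (0 : R).
  by rewrite -[X in _ --> X](mulr0 (expR (t' * ln M%:R))); apply: cvgM; [exact: cvg_cst|exact: expR_neg_ln_cvg0].
have {}cC := (cvgrPdist_le _ _).1 cC _ e2.
have {}cD := (cvgrPdist_le _ _).1 cD _ e2.
have cM : \forall n \near \oo, (M <= n)%N by exact: nbhs_infty_ge.
apply: filterS3 (cC _) (cD _) cM => n; rewrite !sub0r !normrN.
set cn := expR (- (t * _)); set dn := expR (- (t' * _)) => hC hD Mn.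
have n0 : (0 < n)%N by exact: leq_trans Mn.
have fn : 0 < f n by apply: h4; exact: leq_trans Mn.
have nr0 : 0 < n%:R :> R by rewrite ltr0n.
have nf0 : 0 < n%:R * f n by rewrite mulr_gt0.
have M0 : (0 < M)%N by [].
rewrite (big_cat_nat M0 (leqW Mn)) /= -/C.
have [s1 _] := h2 M n M2 Mn.
have [_ s2] := h3 M n M3 Mn.
pose St := \sum_(M <= k < n.+1) expR ((t - 1) * ln k%:R) : R.
pose St' := \sum_(M <= k < n.+1) expR ((t' - 1) * ln k%:R) : R.
have cnE : expR (t * ln n%:R) * cn = 1 by rewrite -expRD subrr expR0.
have dnE : expR (t' * ln n%:R) * dn = 1 by rewrite -expRD subrr expR0.
have cn0 : 0 < cn by exact: expR_gt0.
have dn0 : 0 < dn by exact: expR_gt0.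
have su : (\sum_(M <= k < n.+1) f k) / (n%:R * f n) <= expR eta / ((1 - eta) * t).
  rewrite ler_pdivrMr//.
  apply: (@le_trans _ _ (f n * expR eta * n%:R * cn * St)).
    rewrite /St mulr_sumr; apply: ler_sum_nat => k /andP[Mk kn].
    have /andP[_] := comp k n Mk kn; rewrite (nE t)//.
    by congr (_ <= _); rewrite -/cn; ring.
  have s3 : cn * St <= ((1 - eta) * t)^-1.
    rewrite -[leRHS]mul1r ler_pdivlMr; last by rewrite mulr_gt0// subr_gt0.
    rewrite -[leRHS]cnE [leRHS]mulrC -mulrA ler_pM2l//.
    by rewrite mulrC -mulrA; exact: s1.
  have a0 : 0 <= f n * expR eta * n%:R by rewrite !mulr_ge0 ?expR_ge0// ltW.
  have := ler_wpM2l a0 s3; rewrite mulrA => /le_trans; apply.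
  by rewrite le_eqVlt; apply/orP; left; apply/eqP; ring.
have sl : expR (- eta) / ((1 + eta) * t') * (1 - expR (t' * ln M%:R) * dn) <= (\sum_(M <= k < n.+1) f k) / (n%:R * f n).
  rewrite ler_pdivlMr//.
  apply: (@le_trans _ _ (f n * expR (- eta) * n%:R * dn * St')); last first.
    rewrite /St' mulr_sumr; apply: ler_sum_nat => k /andP[Mk kn].
    have /andP[+ _] := comp k n Mk kn; rewrite (nE t')//.
    by congr (_ <= _); rewrite -/dn; ring.
  have s3 : (1 - expR (t' * ln M%:R) * dn) / ((1 + eta) * t') <= dn * St'.
    rewrite ler_pdivrMr; last by rewrite mulr_gt0// addr_gt0.
    rewrite -[X in X - _ <= _]dnE -mulrBl mulrC -[leRHS]mulrA ler_pM2l//.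
    by rewrite [leRHS]mulrC -mulrA; exact: s2.
  have a0 : 0 <= f n * expR (- eta) * n%:R by rewrite !mulr_ge0 ?expR_ge0// ltW.
  rewrite -[leRHS]mulrA; apply: le_trans (ler_wpM2l a0 s3).
  by rewrite le_eqVlt; apply/orP; left; apply/eqP; ring.
have iC : C / (n%:R * f n) <= e / 2.
  apply: le_trans (le_trans (ler_norm _) hC).
  have /andP[_] := comp M n (leqnn M) Mn; rewrite (nE t)// -/cn => hM.
  rewrite ler_pdivrMr// (_ : _ * cn * (n%:R * f n) =
    C * ((f n * expR eta * expR ((t - 1) * ln M%:R) * (n%:R * cn)) / f M)); last by ring.
  by rewrite ler_peMr// ler_pdivlMr// mul1r.
have iC0 : 0 <= C / (n%:R * f n) by rewrite divr_ge0// ltW.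
have l0 : 0 <= expR (- eta) / ((1 + eta) * t') <= 1.
  have tt : 0 < (1 + eta) * t' by rewrite mulr_gt0// addr_gt0.
  rewrite (divr_ge0 (expR_ge0 _) (ltW tt)) /= ler_pdivrMr// mul1r.
  apply: (@le_trans _ _ 1); first by rewrite -[leRHS]expR0 ler_expR lerNl oppr0 ltW.
  by rewrite /t'; nra.
have dd0 : 0 <= expR (t' * ln M%:R) * dn by rewrite mulr_ge0 ?expR_ge0// ltW.
rewrite mulrDl.
move: hD iC iC0 su sl up lo l0 dd0; rewrite -/t -/t'.
set x1 := expR (- eta) / _; set x2 := expR eta / _; set x3 := (rho + 1)^-1.
set x4 := C / _; set x5 := _ / (n%:R * f n); set x6 := expR _ * dn.
clearbody x1 x2 x3 x4 x5 x6; clear -e0.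
move=> hD iC iC0 su sl up lo /andP[l0 l1] dd0.
have : x1 * x6 <= x6 by rewrite ler_piMl.
move: hD; rewrite ger0_norm// ler_norml => hD h; apply/andP; split; lra.
Qed.

Lemma rvs_sum rho f : 0 <= rho -> (forall k, 0 <= f k) -> rvs rho f ->
  rvs (rho + 1) (fun n => \sum_(1 <= k < n.+1) f k).
Proof.
move=> r0 f0 hf.
have hn : rvs 1 (fun n => n%:R : R).
  split; first by near=> n; rewrite ltr0n; near: n; exact: nbhs_infty_gt.
  move=> eta eta0; exists 1%N => k n k0 kn.
  rewrite mul1r subrr normr0 mulr_ge0//; first exact: ltW.
  by rewrite addr_ge0// subr_ge0 ln_nat_le.
have hnf := rvs_mul hn hf; rewrite addrC.
apply: (rvs_equiv _ hnf (karamata r0 f0 hf)).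
by rewrite invr_gt0 ltr_wpDl.
Unshelve. all: end_near.
Qed.

(** Since [ln n - ln n.-1] tends to 0, the bound in [rvs] leaves an arbitrarily small constant.
    Shifts occur because the weight of generation [k] is the mean of generation [k.-1]. *)
Lemma rvs_pred rho f : rvs rho f -> f n.-1 / f n @[n --> \oo] --> (1 : R).
Proof.
move=> [[N0 _ fp] hf].
have ll : ln n%:R - ln n.-1%:R @[n --> \oo] --> (0 : R).
  apply/cvgrPdist_le => e e0; near=> n.
  have n1 : (1 < n)%N by near: n; exact: nbhs_infty_gt.
  have n0 : 0 < n.-1%:R :> R by rewrite ltr0n -subn1 subn_gt0.
  have nE : n%:R = n.-1%:R + 1 :> R by rewrite natr1 prednK// (ltn_trans _ n1).
  rewrite sub0r normrN ger0_norm; last first.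
    by rewrite subr_ge0 ln_nat_le ?leq_pred// -subn1 subn_gt0.
  rewrite -ln_div ?posrE//; last by rewrite nE addr_gt0.
  have -> : n%:R / n.-1%:R = 1 + n.-1%:R^-1 :> R.
    by rewrite nE mulrDl divff ?mul1r// gt_eqF.
  apply: (le_trans (le_ln1Dx _)).
    by rewrite (@lt_trans _ _ 0)// ?invr_gt0.
  rewrite -[leRHS]invrK lef_pV2 ?posrE ?invr_gt0//.
  have : e^-1 + 1 <= n%:R by near: n; exact: nbhs_infty_ger.
  by rewrite nE; lra.
have lf : ln (f n) - ln (f n.-1) @[n --> \oo] --> (0 : R).
  apply/cvgrPdist_le => e e0.
  pose eta := e / 4.
  have eta0 : 0 < eta by rewrite divr_gt0.
  have [N hN] := hf _ eta0.
  pose b := Num.min 1 (e / (4 * (`|rho| + 1))).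
  have r1 : 0 < `|rho| + 1 by rewrite ltr_wpDl.
  have b0 : 0 < b by rewrite lt_min ltr01 divr_gt0// mulr_gt0.
  have b1 : b <= 1 by rewrite ge_min lexx.
  have b2 : (`|rho| + 1) * b <= e / 4.
    have : b <= e / (4 * (`|rho| + 1)) by rewrite ge_min lexx orbT.
    by rewrite ler_pdivlMr ?mulr_gt0//; lra.
  have {}ll := (cvgrPdist_le _ _).1 ll _ b0.
  near=> n.
  have Nn : (N.+1 <= n)%N by near: n; exact: nbhs_infty_ge.
  have n1 : (1 < n)%N by near: n; exact: nbhs_infty_gt.
  have h1 := hN n.-1 n _ (leq_pred n).
  have {h1} : `|ln (f n) - ln (f n.-1) - rho * (ln n%:R - ln n.-1%:R)| <= eta * (1 + (ln n%:R - ln n.-1%:R)).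
    by apply: h1; rewrite -ltnS prednK// (ltn_trans _ n1).
  have h2 : `|0 - (ln n%:R - ln n.-1%:R)| <= b by near: n; exact: ll.
  move: h2; rewrite !sub0r !normrN.
  set dl := _ - _; set df := ln (f n) - _ => h2 h1.
  have h3 : `|rho * dl| <= e / 4.
    rewrite normrM; apply: le_trans b2; apply: ler_pM => //; lra.
  have : dl <= 1 by apply: le_trans (le_trans (ler_norm _) h2) _.
  move: h1 h3; rewrite /eta !ler_norml => /andP[? ?] /andP[? ?] dl1.
  have : e / 4 * (1 + dl) <= e / 4 * 2 by rewrite ler_pM2l ?divr_gt0//; lra.
  by move=> ?; apply/andP; split; lra.
have : expR (- (ln (f n) - ln (f n.-1))) @[n --> \oo] --> (1 : R).
  rewrite -[X in _ --> X](@expR0 R) -oppr0.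
  apply: (@cvg_comp _ _ _ (fun n => - (ln (f n) - ln (f n.-1))) expR _ (nbhs (- 0 : R))).
    exact: cvgN.
  exact: continuous_expR.
apply: cvg_trans; apply: near_eq_cvg; near=> n.
have Nn : (N0.+1 <= n)%N by near: n; exact: nbhs_infty_ge.
have fn : 0 < f n by apply: fp; exact: ltnW.
have fn1 : 0 < f n.-1 by apply: fp => /=; rewrite -ltnS prednK// (leq_ltn_trans _ Nn).
by rewrite opprB expRB !lnK.
Unshelve. all: end_near.
Qed.

End regular_variation.

(** * Sums over the offspring of one generation *)

Section joint_family.
Context d (T : measurableType d) (R : realType) (P : probability T R).
Variables (X : nat -> nat -> {RV P >-> nat}) (xi : nat -> {RV P >-> nat}).

(** Offspring and immigration variables are merged into one family: the pair
    (k, 0) stands for the immigrants of generation k, and (k, i) with 0 < i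
    for the offspring X k i. *)
Definition merged (p : nat * nat) : {RV P >-> nat} :=
  if p.2 is i.+1 then X p.1 i.+1 else xi p.1.

Hypothesis X_indep : independent_RVs [set p : nat * nat | (0 < p.1)%N /\ (0 < p.2)%N]
               (fun p : nat * nat => X p.1 p.2).
Hypothesis xi_indep : independent_RVs [set n : nat | (0 < n)%N] xi.
Hypothesis X_xi_indep : independent_families
     [set p : nat * nat | (0 < p.1)%N /\ (0 < p.2)%N] [set n : nat | (0 < n)%N]
     (fun p : nat * nat => X p.1 p.2) xi.

Lemma sigma_family_bigcap (I : choiceType) (D : set I) (Y : I -> {RV P >-> nat})
    (J : {fset I}) (B : I -> set nat) : [set` J] `<=` D ->
  sigma_family D Y (\bigcap_(i in [set` J]) Y i @^-1` B i).
Proof.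
move=> JD; apply: (@fin_bigcap_measurable _ (FD Y D)) => // i iJ.
by apply: (@mD_Y _ _ _ _ _ _ _ Y) => //; exact: JD.
Qed.

(** A finite index set splits according to whether the second coordinate vanishes. Independence of
    the two families separates the halves, and independence within each family factors them. *)
Lemma merged_indep : independent_RVs [set p : nat * nat | (0 < p.1)%N] merged.
Proof.
move=> J B JD mB.
pose JX := [fset p in J | p.2 != 0%N]%fset.
pose J0 := [fset p in J | p.2 == 0%N]%fset.
pose Jxi := [fset p.1 | p in J0]%fset.
have JXD : [set` JX] `<=` [set p : nat * nat | (0 < p.1)%N /\ (0 < p.2)%N].
  move=> p /=; rewrite !inE /= => /andP[pJ p2]; split; first exact: (JD p pJ).
  by rewrite lt0n.
have JxiD : [set` Jxi] `<=` [set n : nat | (0 < n)%N].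
  move=> n /= /imfsetP[p /=]; rewrite !inE => /andP[pJ _] ->; exact: (JD p pJ).
have -> : \bigcap_(i in [set` J]) merged i @^-1` B i =
    (\bigcap_(p in [set` JX]) X p.1 p.2 @^-1` B p) `&`
    (\bigcap_(n in [set` Jxi]) xi n @^-1` B (n, 0%N)).
  apply/seteqP; split => w.
    move=> h; split=> [[k i]|n] /=.
      by rewrite !inE /= => /andP[pJ]; case: i pJ => // i pJ _; exact: (h _ pJ).
    move=> /imfsetP[[k i] /=]; rewrite !inE /= => /andP[pJ /eqP i0] ->.
    by have := h _ pJ; rewrite i0.
  move=> [h1 h2] [k [|i]] /= pJ.
    have := h2 k; apply; apply/imfsetP; exists (k, 0%N) => //=.
    by rewrite !inE /= pJ.
  by have := h1 (k, i.+1); apply; rewrite /= !inE /= pJ.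
rewrite X_xi_indep; last 2 first.
- exact: (@sigma_family_bigcap _ _ (fun p : nat * nat => X p.1 p.2)).
- exact: sigma_family_bigcap.
rewrite (X_indep JXD)// (xi_indep JxiD)//.
rewrite [RHS](bigID (fun p => p.2 != 0%N)) /=; congr (_ * _)%E.
  rewrite -[RHS]big_filter (perm_big [seq p <- J | p.2 != 0%N]) /=.
    apply: eq_big_seq => -[k [|i]]; rewrite mem_filter //=.
  apply: uniq_perm; [exact: fset_uniq|by rewrite filter_uniq// fset_uniq|].
  by move=> p; rewrite mem_filter !inE /= andbC.
rewrite /Jxi big_imfset /=; last first.
  move=> [k i] [k' i']; rewrite !inE /= => /andP[_ /eqP ->] /andP[_ /eqP ->].
  by move=> ->.
rewrite -[RHS]big_filter (perm_big [seq p <- J | ~~ (p.2 != 0%N)]) /=.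
  apply: eq_big_seq => -[k [|i]]; rewrite mem_filter //=.
apply: uniq_perm; [exact: fset_uniq|by rewrite filter_uniq// fset_uniq|].
by move=> p; rewrite mem_filter !inE /= negbK andbC.
Qed.

End joint_family.

(** * Linear and bilinear sums over the first individuals of a generation *)

Section iid_sums.
Context d (T : measurableType d) (R : realType) (P : probability T R).
Variables (X : nat -> nat -> {RV P >-> nat}) (xi : nat -> {RV P >-> nat}).
Notation Y := (merged X xi).
Notation Ex := (Ex P).
Notation L1 := (L1 P).
Notation L2 := (L2 P).
Notation mD := (mD Y).
Let pos := [set p : nat * nat | (0 < p.1)%N].
Hypothesis iY : independent_RVs pos Y.
Hypothesis X_distr : forall n i : nat, (0 < n)%N -> (0 < i)%N ->
     distribution P (X n i) = distribution P (X 1%N 1%N).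

Lemma L1_same (h : nat -> R) n i : (0 < n)%N -> (0 < i)%N ->
  L1 (fun w => h (X 1%N 1%N w)) -> L1 (fun w => h (X n i w)).
Proof.
move=> n0 i0 hL.
have mh : measurable_fun setT (EFin \o h) by [].
apply/integrableP; split.
  by apply/measurable_EFinP; apply: (measurableT_comp (f := h)).
move/integrableP: hL => [_]; apply: le_lt_trans.
have E (k j : nat) : (\int[P]_w `|(EFin \o (fun w => h (X k j w))) w| = \int[distribution P (X k j)]_y `|(h y)%:E|)%E.
  by rewrite ge0_integral_distribution.
by rewrite !E X_distr.
Qed.

Lemma Ex_same (h : nat -> R) n i : (0 < n)%N -> (0 < i)%N ->
  L1 (fun w => h (X 1%N 1%N w)) ->
  Ex (fun w => h (X n i w)) = Ex (fun w => h (X 1%N 1%N w)).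
Proof.
move=> n0 i0 hL.
have mh : measurable_fun setT (EFin \o h) by [].
have E (k j : nat) : (0 < k)%N -> (0 < j)%N -> (\int[P]_w (h (X k j w))%:E = \int[distribution P (X k j)]_y (h y)%:E)%E.
  by move=> k0 j0; rewrite integral_distribution//; exact: L1_same.
by apply: (congr1 fine); rewrite !E// X_distr.
Qed.

Lemma L2_same (h : nat -> R) n i : (0 < n)%N -> (0 < i)%N ->
  L2 (fun w => h (X 1%N 1%N w)) -> L2 (fun w => h (X n i w)).
Proof.
move=> n0 i0 [_ h2]; split; first by apply: (measurableT_comp (f := h)).
exact: (@L1_same (fun y => h y ^+ 2)).
Qed.

Definition first_offspring k q : set (nat * nat) :=
  [set p | p.1 = k /\ (0 < p.2 <= q)%N].

Definition generation k : set (nat * nat) := [set p | p.1 = k].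

Lemma first_offspring_sub k q r : (q <= r)%N -> first_offspring k q `<=` first_offspring k r.
Proof. by move=> qr p [p1 /andP[p2 p3]]; split => //; rewrite p2 (leq_trans p3). Qed.

Lemma first_offspring_pos k q : (0 < k)%N -> first_offspring k q `<=` pos.
Proof. by move=> k0 p [/= p1 _]; rewrite /pos /= p1. Qed.

Lemma mD_offspring k q (h : nat -> R) : mD [set (k, q.+1)] (fun w => h (X k q.+1 w)).
Proof.
apply: (mD_comp (measurable_nat h)).
exact: (@mD_Y _ _ _ _ _ _ _ Y [set (k, q.+1)] (k, q.+1)).
Qed.

(** The coefficient [a q] depends on the first [q] offspring numbers, of which [X k q.+1] is
    independent, so the summands are orthogonal. Constant coefficients give [osum], and
    [a q = osum f k q] gives [cross_sum]; the lower end [m] serves for differences of cross sums. *)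
Lemma sequential_L2 k (a : nat -> T -> R) (g : nat -> R) m z : (0 < k)%N ->
  (forall q, mD (first_offspring k q) (a q)) -> (forall q, L2 (a q)) ->
  L2 (fun w => g (X 1%N 1%N w)) -> Ex (fun w => g (X 1%N 1%N w)) = 0 -> (m <= z)%N ->
  let S w := \sum_(m <= q < z) a q w * g (X k q.+1 w) in
  [/\ mD (first_offspring k z) S, L2 S, Ex S = 0 &
    Ex (fun w => S w ^+ 2) = \sum_(m <= q < z) Ex (fun w => a q w ^+ 2) * Ex (fun w => g (X 1%N 1%N w) ^+ 2)].
Proof.
move=> k0 ma La Lg g0; elim: z => [|z ih] mz.
  move=> S; have SE : S = fun=> 0.
    by apply/funext => w; rewrite /S; move: mz; rewrite leqn0 => /eqP ->; rewrite big_geq.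
  rewrite SE; split; [exact: mD_cst|exact: L2_cst|exact: Ex_cst|].
  rewrite (@Ex_eq _ _ _ _ _ (fun=> 0)) ?Ex_cst; last by move=> w; rewrite expr0n.
  by move: mz; rewrite leqn0 => /eqP ->; rewrite big_geq.
move=> S; move: mz; rewrite leq_eqVlt => /orP[/eqP mz|].
  have SE : S = fun=> 0 by apply/funext => w; rewrite /S mz big_geq.
  rewrite SE; split; [exact: mD_cst|exact: L2_cst|exact: Ex_cst|].
  rewrite (@Ex_eq _ _ _ _ _ (fun=> 0)) ?Ex_cst; last by move=> w; rewrite expr0n.
  by rewrite mz big_geq.
rewrite ltnS => mz; have [mS LS S0 S2] := ih mz.
move: mS LS S0 S2; set S' := fun w => \sum_(m <= q < z) _ => mS LS S0 S2.
have SE w : S w = S' w + a z w * g (X k z.+1 w) by rewrite /S big_nat_recr.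
have Lgz : L2 (fun w => g (X k z.+1 w)) by exact: L2_same.
have D12 : first_offspring k z `&` [set (k, z.+1)] `<=` set0.
  by move=> p [[_ /andP[_ p2]] /= pE]; move: p2; rewrite pE /= ltnn.
have D2p : [set (k, z.+1)] `<=` pos by move=> p ->.
have D1p := @first_offspring_pos k z k0.
have mg := @mD_offspring k z g.
have mg2 : mD [set (k, z.+1)] (fun w => g (X k z.+1 w) ^+ 2) by exact: mDX.
have ma2 : mD (first_offspring k z) (fun w => a z w ^+ 2) by exact: mDX.
have [h1 h2] := Ex_mulD iY D1p D2p D12 ma2 mg2 (La z).2 Lgz.2.
have [h3 h4] := Ex_mulD iY D1p D2p D12 (ma z) mg (L2_L1 (La z)) (L2_L1 Lgz).
have mSa : mD (first_offspring k z) (fun w => S' w * a z w) by exact: mDM.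
have [h5 h6] := Ex_mulD iY D1p D2p D12 mSa mg (L2_L1M LS (La z)) (L2_L1 Lgz).
have Eg : Ex (fun w => g (X k z.+1 w)) = 0 by rewrite Ex_same//; exact: L2_L1.
have Lag : L2 (fun w => a z w * g (X k z.+1 w)).
  split; first by apply: measurable_funM; [case: (La z)|case: Lgz].
  by apply: (L1_eq _ h1) => w; rewrite exprMn.
split.
- have -> : S = fun w => S' w + a z w * g (X k z.+1 w) by apply/funext.
  apply: mDD; first by apply: mD_sub mS; exact: first_offspring_sub.
  apply: mDM; first by apply: mD_sub (ma z); exact: first_offspring_sub.
  by apply: mD_sub mg => p ->; split => //=.
- have -> : S = fun w => S' w + a z w * g (X k z.+1 w) by apply/funext.
  exact: L2D.
- rewrite (Ex_eq _ SE) ExD ?S0 ?h4 ?Eg ?mulr0 ?addr0//; exact: L2_L1.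
- rewrite (@Ex_eq _ _ _ _ _ (fun w => S' w ^+ 2 + a z w ^+ 2 * g (X k z.+1 w) ^+ 2 + 2 * (S' w * a z w * g (X k z.+1 w)))); last first.
    by move=> w; rewrite SE; ring.
  rewrite ExD; [|by apply: L1D => //; case: LS|exact: L1Z].
  rewrite ExD//; last by case: LS.
  rewrite ExZ// h6 Eg !mulr0 addr0 h2 S2 big_nat_recr//=.
  by rewrite (@Ex_same (fun y => g y ^+ 2) k z.+1)//; exact: Lg.2.
Qed.

Definition osum (h : nat -> R) k m w : R := \sum_(0 <= q < m) h (X k q.+1 w).

(** The sum of [f (X k i) * g (X k j)] over the pairs [i < j], written as a martingale transform. *)
Definition cross_sum (f g : nat -> R) k m w : R :=
  \sum_(0 <= q < m) osum f k q w * g (X k q.+1 w).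

Lemma osum_L2 h k m : (0 < k)%N ->
  L2 (fun w => h (X 1%N 1%N w)) -> Ex (fun w => h (X 1%N 1%N w)) = 0 ->
  [/\ mD (first_offspring k m) (osum h k m), L2 (osum h k m), Ex (osum h k m) = 0 &
    Ex (fun w => osum h k m w ^+ 2) = m%:R * Ex (fun w => h (X 1%N 1%N w) ^+ 2)].
Proof.
move=> k0 Lh h0.
have [] := @sequential_L2 k (fun _ _ => 1) h 0 m k0 _ _ Lh h0 (leq0n m).
- by move=> q; exact: mD_cst.
- by move=> q; exact: L2_cst.
have -> : (fun w => \sum_(0 <= q < m) 1 * h (X k q.+1 w)) = osum h k m.
  by apply/funext => w; apply: eq_bigr => q _; rewrite mul1r.
move=> h1 h2 h3 h4; split => //.
transitivity (Ex (fun w => (\sum_(0 <= q < m) 1 * h (X k q.+1 w)) ^+ 2)).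
  by apply: Ex_eq => w; congr (_ ^+ 2); apply: eq_bigr => q _; rewrite mul1r.
rewrite h4.
rewrite (eq_bigr (fun=> Ex (fun w => h (X 1%N 1%N w) ^+ 2))); last first.
  move=> q _; rewrite (@Ex_eq _ _ _ _ _ (fun=> 1)) ?Ex_cst ?mul1r// => w.
  by rewrite expr1n.
by rewrite sumr_const_nat subn0 mulr_natl.
Qed.

(** The number of pairs among [m] individuals, as a real number: the subtraction is exact at
    [m = 0]. *)
Definition pair_count (m : nat) : R := m%:R * (m%:R - 1) / 2.

Lemma sum_pairs m z : (m <= z)%N -> \sum_(m <= q < z) q%:R = pair_count z - pair_count m :> R.
Proof.
move=> mz; rewrite -(telescope_sumr pair_count mz); apply: eq_bigr => q _.
by rewrite /pair_count -natr1; field.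
Qed.

Lemma cross_sum_diff_L2 f g k m z : (0 < k)%N ->
  L2 (fun w => f (X 1%N 1%N w)) -> Ex (fun w => f (X 1%N 1%N w)) = 0 ->
  L2 (fun w => g (X 1%N 1%N w)) -> Ex (fun w => g (X 1%N 1%N w)) = 0 ->
  Ex (fun w => (cross_sum f g k z w - cross_sum f g k m w) ^+ 2) =
   Ex (fun w => f (X 1%N 1%N w) ^+ 2) * Ex (fun w => g (X 1%N 1%N w) ^+ 2) *
     `|pair_count z - pair_count m|.
Proof.
move=> k0 Lf f0 Lg g0.
wlog mz : m z / (m <= z)%N.
  move=> H; case: (leqP m z) => mz; first exact: H.
  rewrite distrC -H; last exact: ltnW.
  by apply: Ex_eq => w; rewrite -sqrrN opprB.
have [||_ _ _] := @sequential_L2 k (osum f k) g m z k0 _ _ Lg g0 mz.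
- by move=> q; have [] := osum_L2 q k0 Lf f0.
- by move=> q; have [] := osum_L2 q k0 Lf f0.
move=> E.
transitivity (Ex (fun w => (\sum_(m <= q < z) osum f k q w * g (X k q.+1 w)) ^+ 2)).
  apply: Ex_eq => w; congr (_ ^+ 2).
  by rewrite /cross_sum (@big_cat_nat _ _ _ m 0 z) //= addrAC subrr add0r.
rewrite E.
rewrite -(sum_pairs mz) ger0_norm; last by rewrite sumr_ge0.
rewrite mulr_sumr; apply: eq_bigr => q _.
by have [_ _ _ ->] := osum_L2 q k0 Lf f0; ring.
Qed.

Lemma cross_sum_L2 f g k m : (0 < k)%N ->
  L2 (fun w => f (X 1%N 1%N w)) -> Ex (fun w => f (X 1%N 1%N w)) = 0 ->
  L2 (fun w => g (X 1%N 1%N w)) -> Ex (fun w => g (X 1%N 1%N w)) = 0 ->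
  [/\ mD (first_offspring k m) (cross_sum f g k m), L2 (cross_sum f g k m),
    Ex (cross_sum f g k m) = 0 &
    Ex (fun w => cross_sum f g k m w ^+ 2) =
     Ex (fun w => f (X 1%N 1%N w) ^+ 2) * Ex (fun w => g (X 1%N 1%N w) ^+ 2) * pair_count m].
Proof.
move=> k0 Lf f0 Lg g0.
have [||h1 h2 h3 _] := @sequential_L2 k (osum f k) g 0 m k0 _ _ Lg g0 (leq0n m).
- by move=> q; have [] := osum_L2 q k0 Lf f0.
- by move=> q; have [] := osum_L2 q k0 Lf f0.
split => //.
have := cross_sum_diff_L2 0 m k0 Lf f0 Lg g0.
have p0 : pair_count 0 = 0 by rewrite /pair_count !mul0r.
rewrite p0 subr0 ger0_norm; last first.
  by have := sum_pairs (leq0n m); rewrite p0 subr0 => <-; exact: sumr_ge0.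
move=> <-; apply: Ex_eq => w; congr (_ ^+ 2).
by rewrite /cross_sum [X in _ - X]big_geq// subr0.
Qed.

Lemma osum_sqr f k m w :
  osum f k m w ^+ 2 = 2 * cross_sum f f k m w + \sum_(0 <= q < m) f (X k q.+1 w) ^+ 2.
Proof.
elim: m => [|m ih]; first by rewrite /osum /cross_sum !big_geq// expr0n /= mulr0 addr0.
rewrite /osum /cross_sum !big_nat_recr//= -/(osum f k m w) -/(cross_sum f f k m w).
by rewrite sqrrD ih; ring.
Qed.

End iid_sums.

(** * Truncated second moments of cross sums *)

Section offspring_tails.
Context d (T : measurableType d) (R : realType) (P : probability T R).
Variables (X : nat -> nat -> {RV P >-> nat}) (xi : nat -> {RV P >-> nat}).
Notation Y := (merged X xi).
Notation Ex := (Ex P).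
Notation L1 := (L1 P).
Notation L2 := (L2 P).
Notation mD := (mD Y).
Notation pairs := (pair_count R).
Notation pos := [set p : nat * nat | (0 < p.1)%N].
Hypothesis iY : independent_RVs pos Y.
Hypothesis X_distr : forall n i : nat, (0 < n)%N -> (0 < i)%N ->
     distribution P (X n i) = distribution P (X 1%N 1%N).

(** The term linear in [y] is kept because its mean vanishes when [y] is centered and independent of
    [S]; the other odd term is absorbed by its even neighbours. [pow6_le] follows the same
    pattern. *)
Lemma pow4_le (K S y : R) : y ^+ 2 <= K ^+ 2 ->
  (S + y) ^+ 4 <= S ^+ 4 + 4 * (S ^+ 3 * y) + 8 * K ^+ 2 * S ^+ 2 + 3 * K ^+ 4.
Proof.
move=> yK.
have -> : K ^+ 4 = (K ^+ 2) ^+ 2 by rewrite -exprM.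
have S2 := sqr_ge0 S; have y2 := sqr_ge0 y.
have y4 : (y ^+ 2) ^+ 2 <= (K ^+ 2) ^+ 2 by rewrite ler_pXn2r// nnegrE sqr_ge0.
have h : 0 <= y ^+ 2 * (S - y) ^+ 2 by rewrite mulr_ge0 ?sqr_ge0.
have h1 := ler_wpM2l S2 yK.
rewrite -subr_ge0 in y4; rewrite -subr_ge0 in h1; rewrite -subr_ge0.
have -> : S ^+ 4 + 4 * (S ^+ 3 * y) + 8 * K ^+ 2 * S ^+ 2 + 3 * (K ^+ 2) ^+ 2 - (S + y) ^+ 4 =
  8 * (S ^+ 2 * K ^+ 2 - S ^+ 2 * y ^+ 2) + 3 * ((K ^+ 2) ^+ 2 - (y ^+ 2) ^+ 2) + 2 * (y ^+ 2 * (S - y) ^+ 2) by ring.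
by rewrite !addr_ge0// mulr_ge0.
Qed.

Lemma pow6_le (K S y : R) : y ^+ 2 <= K ^+ 2 ->
  (S + y) ^+ 6 <= S ^+ 6 + 6 * (S ^+ 5 * y) + 25 * K ^+ 2 * S ^+ 4 + 28 * K ^+ 4 * S ^+ 2 + 4 * K ^+ 6.
Proof.
move=> yK.
have -> : K ^+ 4 = (K ^+ 2) ^+ 2 by rewrite -exprM.
have -> : K ^+ 6 = (K ^+ 2) ^+ 3 by rewrite -exprM.
have S2 := sqr_ge0 S; have y2 := sqr_ge0 y.
have y4 : (y ^+ 2) ^+ 2 <= (K ^+ 2) ^+ 2 by rewrite ler_pXn2r// nnegrE sqr_ge0.
have y6 : (y ^+ 2) ^+ 3 <= (K ^+ 2) ^+ 3 by rewrite ler_pXn2r// nnegrE sqr_ge0.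
have h : 0 <= (S ^+ 2) * y ^+ 2 * (S - y) ^+ 2 by exact: mulr_ge0 (mulr_ge0 S2 y2) (sqr_ge0 _).
have h' : 0 <= (y ^+ 2) ^+ 2 * (S - y) ^+ 2 by rewrite mulr_ge0 ?sqr_ge0.
have h1 := ler_wpM2l (sqr_ge0 (S ^+ 2)) yK.
have h2 := ler_wpM2l S2 y4.
rewrite -subr_ge0 in y6; rewrite -subr_ge0 in h1; rewrite -subr_ge0 in h2; rewrite -subr_ge0.
have -> : S ^+ 6 + 6 * (S ^+ 5 * y) + 25 * K ^+ 2 * S ^+ 4 + 28 * (K ^+ 2) ^+ 2 * S ^+ 2 + 4 * (K ^+ 2) ^+ 3 - (S + y) ^+ 6 =
  25 * ((S ^+ 2) ^+ 2 * K ^+ 2 - (S ^+ 2) ^+ 2 * y ^+ 2)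
  + 28 * (S ^+ 2 * (K ^+ 2) ^+ 2 - S ^+ 2 * (y ^+ 2) ^+ 2) + 4 * ((K ^+ 2) ^+ 3 - (y ^+ 2) ^+ 3)
  + 10 * (S ^+ 2 * y ^+ 2 * (S - y) ^+ 2) + 3 * ((y ^+ 2) ^+ 2 * (S - y) ^+ 2) by ring.
by rewrite !addr_ge0// mulr_ge0.
Qed.

Section bounded.
Variables (h : nat -> R) (K : R).
Hypothesis hK : forall y, `|h y| <= K.
Hypothesis h0 : Ex (fun w => h (X 1%N 1%N w)) = 0.

Lemma measurable_offspring k i : measurable_fun setT (fun w => h (X k i w)).
Proof. exact: (measurableT_comp (measurable_nat h)). Qed.

Lemma L2_bounded_offspring k i : L2 (fun w => h (X k i w)).
Proof. by apply: L2_bounded => //; exact: measurable_offspring. Qed.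

Lemma osum_le k m w : `|osum X h k m w| <= m%:R * K.
Proof.
rewrite /osum; apply: (le_trans (ler_norm_sum _ _ _)).
apply: (le_trans (ler_sum _ (fun q _ => hK _))).
by rewrite sumr_const_nat subn0 mulr_natl.
Qed.

Lemma L1_osum_pow k m j : (0 < k)%N -> L1 (fun w => osum X h k m w ^+ j).
Proof.
move=> k0; have [_ [ms _] _ _] := @osum_L2 _ _ _ _ X xi iY X_distr h k m k0 (L2_bounded_offspring 1 1) h0.
apply: (@L1_bounded _ _ _ _ _ ((m%:R * K) ^+ j)); first exact: measurable_funX.
by move=> w; rewrite normrX lerXn2r ?nnegrE// ?osum_le// (le_trans _ (osum_le k m w)).
Qed.

Lemma osum_pow_next k q j : (0 < k)%N ->
  L1 (fun w => osum X h k q w ^+ j * h (X k q.+1 w)) /\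
  Ex (fun w => osum X h k q w ^+ j * h (X k q.+1 w)) = 0.
Proof.
move=> k0; have [ms _ _ _] := @osum_L2 _ _ _ _ X xi iY X_distr h k q k0 (L2_bounded_offspring 1 1) h0.
have D12 : first_offspring k q `&` [set (k, q.+1)] `<=` set0.
  by move=> p [[_ /andP[_ p2]] /= pE]; move: p2; rewrite pE /= ltnn.
have D2p : [set (k, q.+1)] `<=` pos by move=> p ->.
have L1h := L2_L1 (L2_bounded_offspring k q.+1).
have [h1 h2] := Ex_mulD iY (@first_offspring_pos k q k0) D2p D12 (mDX j ms) (@mD_offspring _ _ _ _ X xi k q h) (L1_osum_pow q j k0) L1h.
split => //; rewrite h2 (@Ex_same _ _ _ _ X X_distr h k q.+1)// ?h0 ?mulr0//.
exact: L2_L1 (L2_bounded_offspring 1 1).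
Qed.

Lemma K_ge0 : 0 <= K. Proof. exact: le_trans (normr_ge0 _) (hK 0%N). Qed.

Lemma sqr_h_le y : h y ^+ 2 <= K ^+ 2.
Proof. by rewrite -(real_normK (num_real (h y))) lerXn2r ?nnegrE// K_ge0. Qed.

Lemma osum_pow2 k m : (0 < k)%N -> Ex (fun w => osum X h k m w ^+ 2) <= m%:R * K ^+ 2.
Proof.
move=> k0; have [_ _ _ ->] := @osum_L2 _ _ _ _ X xi iY X_distr h k m k0 (L2_bounded_offspring 1 1) h0.
rewrite ler_wpM2l// -[leRHS](Ex_cst P); apply: Ex_le; [by case: (L2_bounded_offspring 1 1)|exact: L1_cst|].
by move=> w; exact: sqr_h_le.
Qed.

Lemma osum_next k m w : osum X h k m.+1 w = osum X h k m w + h (X k m.+1 w).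
Proof. by rewrite /osum big_nat_recr. Qed.

(** In units of [K ^+ 4] a step adds at most [8 * m + 3], while the right-hand side grows by
    [16 * m + 8]. *)
Lemma osum_pow4 k m : (0 < k)%N -> Ex (fun w => osum X h k m w ^+ 4) <= 8 * K ^+ 4 * m%:R ^+ 2.
Proof.
move=> k0; elim: m => [|m ih].
  rewrite (@Ex_eq _ _ _ _ _ (fun=> 0)) ?Ex_cst ?expr0n ?mulr0// => w.
  by rewrite /osum big_geq// expr0n.
have [l3 e3] := osum_pow_next m 3 k0.
have b1 := L1Z 4 l3; have b2 := L1Z (8 * K ^+ 2) (L1_osum_pow m 2 k0).
have b3 := L1D (L1_osum_pow m 4 k0) b1; have b4 := L1D b3 b2.
have c4 := L1_cst P (3 * K ^+ 4).
apply: (@le_trans _ _ (Ex (fun w => osum X h k m w ^+ 4 + 4 * (osum X h k m w ^+ 3 * h (X k m.+1 w))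
   + 8 * K ^+ 2 * osum X h k m w ^+ 2 + 3 * K ^+ 4))).
  apply: Ex_le; [exact: L1_osum_pow|exact: L1D|] => w.
  by rewrite osum_next; apply: pow4_le; exact: sqr_h_le.
rewrite ExD// ExD// ExD//; last exact: L1_osum_pow.
rewrite ExZ// ExZ; last exact: L1_osum_pow.
rewrite e3 mulr0 addr0 Ex_cst -(natr1 m).
have e2 := ler_wpM2l (sqr_ge0 K) (osum_pow2 m k0).
have K4 : 0 <= K ^+ 4 by rewrite exprn_ge0 ?K_ge0.
have m0 : 0 <= K ^+ 4 * m%:R by rewrite mulr_ge0.
have EE : K ^+ 2 * (m%:R * K ^+ 2) = K ^+ 4 * m%:R by ring.
rewrite EE in e2.
have -> : 8 * K ^+ 4 * (m%:R + 1) ^+ 2 = 8 * K ^+ 4 * m%:R ^+ 2 + 16 * (K ^+ 4 * m%:R) + 8 * K ^+ 4 by ring.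
by lra.
Qed.

(** In units of [K ^+ 6] a step adds at most [200 * m ^+ 2 + 28 * m + 4], where 200 is 25 times the
    constant of [osum_pow4]; the right-hand side grows by more. *)
Lemma osum_pow6 k m : (0 < k)%N -> Ex (fun w => osum X h k m w ^+ 6) <= 200 * K ^+ 6 * m%:R ^+ 3.
Proof.
move=> k0; elim: m => [|m ih].
  rewrite (@Ex_eq _ _ _ _ _ (fun=> 0)) ?Ex_cst ?expr0n ?mulr0// => w.
  by rewrite /osum big_geq// expr0n.
have [l3 e3] := osum_pow_next m 5 k0.
have b1 := L1Z 6 l3; have b2 := L1Z (28 * K ^+ 4) (L1_osum_pow m 2 k0).
have b3 := L1Z (25 * K ^+ 2) (L1_osum_pow m 4 k0).
have b4 := L1D (L1_osum_pow m 6 k0) b1; have b5 := L1D b4 b3; have b6 := L1D b5 b2.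
have c4 := L1_cst P (4 * K ^+ 6).
apply: (@le_trans _ _ (Ex (fun w => osum X h k m w ^+ 6 + 6 * (osum X h k m w ^+ 5 * h (X k m.+1 w))
   + 25 * K ^+ 2 * osum X h k m w ^+ 4 + 28 * K ^+ 4 * osum X h k m w ^+ 2 + 4 * K ^+ 6))).
  apply: Ex_le; [exact: L1_osum_pow|exact: L1D|] => w.
  by rewrite osum_next; apply: pow6_le; exact: sqr_h_le.
rewrite ExD// ExD// ExD// ExD//; last exact: L1_osum_pow.
rewrite ExZ// ExZ; last exact: L1_osum_pow.
rewrite ExZ; last exact: L1_osum_pow.
rewrite e3 mulr0 addr0 Ex_cst -(natr1 m).
have e2 := ler_wpM2l (exprn_ge0 4 K_ge0) (osum_pow2 m k0).
have e4 := ler_wpM2l (sqr_ge0 K) (osum_pow4 m k0).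
have K6 : 0 <= K ^+ 6 by rewrite exprn_ge0 ?K_ge0.
have m1 : 0 <= K ^+ 6 * m%:R by rewrite mulr_ge0.
have m2 : 0 <= K ^+ 6 * m%:R ^+ 2 by rewrite mulr_ge0 ?sqr_ge0.
have EE : K ^+ 4 * (m%:R * K ^+ 2) = K ^+ 6 * m%:R by ring.
rewrite EE in e2.
have EE4 : K ^+ 2 * (8 * K ^+ 4 * m%:R ^+ 2) = 8 * (K ^+ 6 * m%:R ^+ 2) by ring.
rewrite EE4 in e4.
have -> : 200 * K ^+ 6 * (m%:R + 1) ^+ 3 = 200 * K ^+ 6 * m%:R ^+ 3 + 600 * (K ^+ 6 * m%:R ^+ 2) + 600 * (K ^+ 6 * m%:R) + 200 * K ^+ 6 by ring.
by lra.
Qed.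

Lemma tail_cube (e x : R) : 0 < e -> tail e x <= `|x| ^+ 3 / e.
Proof.
move=> e0; rewrite /tail; case: ltP => ex; rewrite ?mul0r ?mul1r ?divr_ge0 ?exprn_ge0 ?(ltW e0)//.
by rewrite ler_pdivlMr// -(real_normK (num_real x)) [leRHS]exprSr ler_wpM2l ?exprn_ge0// ltW.
Qed.

Lemma cube_sub_le (a b : R) : 0 <= a -> 0 <= b -> `|a - b| ^+ 3 <= a ^+ 3 + b ^+ 3.
Proof.
wlog ab : a b / b <= a.
  move=> H a0 b0; have [ab|/ltW ab] := leP b a; first exact: H.
  by rewrite distrC [leRHS]addrC; exact: H.
move=> a0 b0; rewrite ger0_norm ?subr_ge0//.
apply: (@le_trans _ _ (a ^+ 3)); last by rewrite lerDl exprn_ge0.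
by rewrite lerXn2r ?nnegrE ?subr_ge0// lerBlDr lerDl.
Qed.

(** Twice the cross sum is the square of [osum] minus a sum of squares, which is between 0 and
    [m * K ^+ 2]. *)
Lemma cross_sum_cube k m w :
  `|cross_sum X h h k m w| ^+ 3 <= osum X h k m w ^+ 6 + m%:R ^+ 3 * K ^+ 6.
Proof.
have /eqP := osum_sqr X h k m w; rewrite -subr_eq => /eqP E.
pose q := \sum_(0 <= q < m) h (X k q.+1 w) ^+ 2.
have q0 : 0 <= q by apply: sumr_ge0 => i _; exact: sqr_ge0.
have qK : q <= m%:R * K ^+ 2.
  apply: (@le_trans _ _ (\sum_(0 <= q < m) K ^+ 2)); first by apply: ler_sum => i _; exact: sqr_h_le.
  by rewrite sumr_const_nat subn0 mulr_natl.
have q3 : q ^+ 3 <= m%:R ^+ 3 * K ^+ 6.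
  have -> : m%:R ^+ 3 * K ^+ 6 = (m%:R * K ^+ 2) ^+ 3 by ring.
  by rewrite lerXn2r ?nnegrE// mulr_ge0 ?sqr_ge0.
have := cube_sub_le (sqr_ge0 (osum X h k m w)) q0; rewrite E -exprM normrM exprMn => hh.
have : `|cross_sum X h h k m w| ^+ 3 <= `|2| ^+ 3 * `|cross_sum X h h k m w| ^+ 3.
  by rewrite ler_peMl ?exprn_ge0// ger0_norm// exprn_ege1// ler1n.
by move=> /le_trans; apply; rewrite (le_trans hh)// lerD2l.
Qed.

Lemma cross_sum_tail_bounded k m c e : (0 < k)%N -> 0 < e ->
  Ex (fun w => tail e (c * cross_sum X h h k m w)) <= 201 * K ^+ 6 * `|c| ^+ 3 * m%:R ^+ 3 / e.
Proof.
move=> k0 e0; have L := L2_bounded_offspring 1 1.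
have [_ l2 _ _] := @cross_sum_L2 _ _ _ _ X xi iY X_distr h h k m k0 L h0 L h0.
apply: (@le_trans _ _ (Ex (fun w => `|c| ^+ 3 / e * (osum X h k m w ^+ 6 + m%:R ^+ 3 * K ^+ 6)))).
  apply: Ex_le; [by apply: L1_tail; exact: L2Z|apply: L1Z; apply: L1D; [exact: L1_osum_pow|exact: L1_cst]|].
  move=> w; apply: (le_trans (tail_cube _ e0)).
  rewrite normrM exprMn mulrAC ler_wpM2l ?cross_sum_cube//.
  by rewrite divr_ge0 ?exprn_ge0// ltW.
have l6 := L1_osum_pow m 6 k0; have lc := L1_cst P (m%:R ^+ 3 * K ^+ 6).
rewrite ExZ; last exact: L1D.
rewrite ExD// Ex_cst.
have -> : 201 * K ^+ 6 * `|c| ^+ 3 * m%:R ^+ 3 / e = `|c| ^+ 3 / e * (200 * K ^+ 6 * m%:R ^+ 3 + m%:R ^+ 3 * K ^+ 6) by ring.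
apply: ler_wpM2l; first by rewrite divr_ge0 ?exprn_ge0// ltW.
by rewrite lerD2r osum_pow6.
Qed.

End bounded.

(** The larger of the two summands exceeds [e / 2] in absolute value, and the square of the sum is
    at most 4 times its square. *)
Lemma tail_add e (x y : R) : tail e (x + y) <= 4 * tail (e / 2) x + 4 * tail (e / 2) y.
Proof.
have t0 z : 0 <= 4 * tail (e / 2) z :> R by apply: mulr_ge0 => //; exact: tail_ge0.
rewrite {1}/tail; case: ltP => h; rewrite ?mul1r ?mul0r; last exact: addr_ge0.
wlog xy : x y h / `|y| <= `|x|.
  move=> H; have [xy|/ltW xy] := leP `|y| `|x|; first exact: H.
  by rewrite addrC [leRHS]addrC; apply: H => //; rewrite addrC.
have h2 : e / 2 < `|x|.
  by have := lt_le_trans h (ler_normD x y); lra.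
rewrite {1}/tail h2 mul1r (le_trans (y := 4 * x ^+ 2))// ?lerDl//.
rewrite -(real_normK (num_real (x + y))) -(real_normK (num_real x)).
have -> : 4 * `|x| ^+ 2 = (2 * `|x|) ^+ 2 by ring.
rewrite lerXn2r ?nnegrE ?mulr_ge0//; have := ler_normD x y; lra.
Qed.

Lemma tail_vanish (g : T -> R) (rho : R) : 0 < rho -> L2 g ->
  exists N : nat, Ex (fun w => tail N%:R (g w)) <= rho.
Proof.
move=> rho0 [mg g2].
pose F (n : nat) w : \bar R := (tail n%:R (g w))%:E.
have LF n : L1 (fun w => tail n%:R (g w)) by exact: L1_tail.
have mF n : measurable_fun setT (F n) by exact: (measurable_int P (LF n)).
have F0 : {ae P, forall w, setT w -> F ^~ w @ \oo --> cst 0%E w}.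
  apply: aeW => w _; rewrite /F; apply: cvg_EFin; first exact: nearW.
  have [N gN] : exists N : nat, `|g w| < N%:R.
    by exists (Num.truncn `|g w|).+1; rewrite truncnS_gt.
  apply: cvg_near_cst; near=> n; rewrite /= /tail ltNge.
  rewrite (le_trans (ltW gN)) ?mul0r// ler_nat.
  by near: n; exact: nbhs_infty_ge.
have Fg : {ae P, forall w n, setT w -> (`|F n w| <= (g w ^+ 2)%:E)%E}.
  apply: aeW => w n _; rewrite /F abse_EFin lee_fin ger0_norm ?tail_ge0//; exact: tail_le.
have [_ _] := dominated_convergence measurableT mF (measurable_cst _) F0 g2 Fg.
rewrite integral_cst// mul0e => /fine_cvgP [_ h].
have : \forall n \near \oo, Ex (fun w => tail n%:R (g w)) < rho by exact: (cvgr_lt 0).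
by move=> [N _ /(_ N (leqnn _)) /ltW]; exists N.
Unshelve. all: by end_near.
Qed.

Lemma var_le (g : T -> R) : L2 g -> Ex (fun w => (g w - Ex g) ^+ 2) <= Ex (fun w => g w ^+ 2).
Proof.
move=> Lg; have L1g := L2_L1 Lg.
rewrite (@Ex_eq _ _ _ _ _ (fun w => g w ^+ 2 + ((- (2 * Ex g)) * g w + Ex g ^+ 2))); last by move=> w; ring.
rewrite ExD; [|by case: Lg|by apply: L1D; [exact: L1Z|exact: L1_cst]].
rewrite ExD; [|exact: L1Z|exact: L1_cst].
rewrite ExZ// Ex_cst gerDl.
have -> : - (2 * Ex g) * Ex g + Ex g ^+ 2 = - Ex g ^+ 2 by ring.
by rewrite oppr_le0 sqr_ge0.
Qed.

Lemma pairs_le m : pairs m <= m%:R ^+ 2 / 2.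
Proof. by rewrite /pair_count expr2 ler_pM2r ?invr_gt0// ler_wpM2l// lerBlDr lerDl. Qed.

Lemma pairs_ge0 m : 0 <= pairs m.
Proof.
by case: m => [|m]; rewrite /pair_count ?mul0r// -natr1 addrK divr_ge0// mulr_ge0.
Qed.

(** With [f = h + r], [h] bounded and centered and [r] centered of small variance, the cross sum is
    that of [(r, f)] plus that of [(h, r)] plus that of [(h, h)]. The first two are small in second
    moment; the last has a bounded summand and is treated by [cross_sum_tail_bounded]. *)
Lemma cross_sum_tail (f : nat -> R) (rho : R) : 0 < rho ->
  L2 (fun w => f (X 1%N 1%N w)) -> Ex (fun w => f (X 1%N 1%N w)) = 0 ->
  exists2 C, 0 <= C & forall k m c e, (0 < k)%N -> 0 < e ->
  Ex (fun w => tail e (c * cross_sum X f f k m w)) <=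
    rho * c ^+ 2 * m%:R ^+ 2 + C * `|c| ^+ 3 * m%:R ^+ 3 / e.
Proof.
move=> rho0 Lf f0.
pose v := Ex (fun w => f (X 1%N 1%N w) ^+ 2).
have v0 : 0 <= v by apply: Ex_ge0 => w; exact: sqr_ge0.
(* The variances of the two small cross sums add up to at most [2 * (v + 1)] times this bound per
   pair, that is [rho / 4]; the factor [8 * c ^+ 2] and [pair_count m <= m ^+ 2 / 2] then give
   [rho * c ^+ 2 * m ^+ 2]. *)
have [|N hN] := @tail_vanish (fun w => f (X 1%N 1%N w)) (rho / (8 * (v + 1))) _ Lf.
  by rewrite divr_gt0// mulr_gt0// ltr_wpDl.
(* [z] is the part of [f] beyond [N]. Subtracting its mean gives [r]; the rest [h = y0 + mean] is
   centered and bounded by [2 * N]. *)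
pose z y : R := (N%:R < `|f y|)%R%:R * f y.
pose y0 y : R := f y - z y.
have y0N y : `|y0 y| <= N%:R.
  by rewrite /y0 /z; case: ltP => h; rewrite ?mul1r ?mul0r ?subr0// subrr normr0.
have Lz : L2 (fun w => z (X 1%N 1%N w)).
  apply: (L2_bmul (K := 1) _ _ Lf); last by move=> w; case: (_ < _); rewrite ?normr1 ?normr0.
  exact: (measurableT_comp (measurable_nat (fun y => (N%:R < `|f y|)%R%:R : R))).
pose mean := Ex (fun w => z (X 1%N 1%N w)).
pose r y := z y - mean.
pose h y := f y - r y.
have hE y : h y = y0 y - - mean by rewrite /h /r /y0; ring.
have Ly0 : L2 (fun w => y0 (X 1%N 1%N w)) by exact: L2B.
have m0E : Ex (fun w => y0 (X 1%N 1%N w)) = - mean.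
  by rewrite /y0 ExB ?f0 ?sub0r//; exact: L2_L1.
have meanN : `|mean| <= N%:R.
  rewrite -normrN -m0E; apply: (le_trans (Ex_norm_le (L2_L1 Ly0))).
  rewrite -[leRHS](Ex_cst P); apply: Ex_le => //; [exact: L1_norm (L2_L1 Ly0)|exact: L1_cst].
have hK y : `|h y| <= 2 * N%:R.
  rewrite hE; apply: (le_trans (ler_normB _ _)); rewrite normrN mulr_natl mulr2n.
  by rewrite lerD.
have Lr : L2 (fun w => r (X 1%N 1%N w)) by apply: L2B => //; exact: L2_cst.
have r0 : Ex (fun w => r (X 1%N 1%N w)) = 0.
  by rewrite ExB ?Ex_cst ?subrr//; [exact: L2_L1|exact: L1_cst].
have Lh : L2 (fun w => h (X 1%N 1%N w)) by exact: L2B.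
have h0 : Ex (fun w => h (X 1%N 1%N w)) = 0 by rewrite ExB ?f0 ?r0 ?subrr//; exact: L2_L1.
have vh : Ex (fun w => h (X 1%N 1%N w) ^+ 2) <= v.
  have -> : Ex (fun w => h (X 1%N 1%N w) ^+ 2) = Ex (fun w => (y0 (X 1%N 1%N w) - Ex (fun w => y0 (X 1%N 1%N w))) ^+ 2).
    by apply: Ex_eq => w; rewrite hE m0E.
  apply: (le_trans (var_le Ly0)); apply: Ex_le; [by case: Ly0|by case: Lf|] => w.
  rewrite /y0 /z; case: ltP => _; rewrite ?mul1r ?mul0r ?subr0// subrr expr0n /=; exact: sqr_ge0.
have vr : Ex (fun w => r (X 1%N 1%N w) ^+ 2) <= rho / (8 * (v + 1)).
  apply: (le_trans (var_le Lz)); apply: le_trans hN; apply: Ex_le; [by case: Lz|exact: L1_tail|] => w.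
  by rewrite /tail /z; case: ltP => _; rewrite ?mul1r ?mul0r// expr0n.
(* The factor 4 comes from [tail_add], the last factor 2 from the level [e / 2], and [2 * N] bounds
   [h]. *)
exists (4 * (201 * (2 * N%:R) ^+ 6) * 2); first by rewrite !mulr_ge0// exprn_ge0// mulr_ge0.
move=> k m c e k0 e0.
have [_ l1 _ _] := @cross_sum_L2 _ _ _ _ X xi iY X_distr f f k m k0 Lf f0 Lf f0.
have [_ l2 _ _] := @cross_sum_L2 _ _ _ _ X xi iY X_distr h h k m k0 Lh h0 Lh h0.
have [_ l3 _ e3] := @cross_sum_L2 _ _ _ _ X xi iY X_distr r f k m k0 Lr r0 Lf f0.
have [_ l4 _ e4] := @cross_sum_L2 _ _ _ _ X xi iY X_distr h r k m k0 Lh h0 Lr r0.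
have dE w : cross_sum X f f k m w = (cross_sum X r f k m w + cross_sum X h r k m w) + cross_sum X h h k m w.
  rewrite /cross_sum -!big_split /=; apply: eq_bigr => q _.
  have -> : osum X h k q w = osum X f k q w - osum X r k q w by rewrite /osum -sumrB.
  by rewrite /h; ring.
have Lrf : L2 (fun w => c * (cross_sum X r f k m w + cross_sum X h r k m w)) by apply: L2Z; exact: L2D.
have Lhh : L2 (fun w => c * cross_sum X h h k m w) by exact: L2Z.
have t1 := L1_tail (e / 2) Lrf; have t2 := L1_tail (e / 2) Lhh.
apply: (@le_trans _ _ (4 * Ex (fun w => tail (e / 2) (c * (cross_sum X r f k m w + cross_sum X h r k m w))) +
   4 * Ex (fun w => tail (e / 2) (c * cross_sum X h h k m w)))).
  rewrite -!ExZ// -ExD; [|exact: L1Z|exact: L1Z].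
  apply: Ex_le; [by apply: L1_tail; exact: L2Z|by apply: L1D; exact: L1Z|] => w.
  by rewrite dE mulrDr; exact: tail_add.
have e20 : 0 < e / 2 by rewrite divr_gt0.
apply: lerD; last first.
  have := ler_wpM2l (ler0n R 4) (cross_sum_tail_bounded hK h0 m c k0 e20).
  move=> /le_trans; apply; rewrite le_eqVlt; apply/orP; left; apply/eqP.
  by field; rewrite gt_eqF.
apply: (@le_trans _ _ (4 * (c ^+ 2 * (2 * (Ex (fun w => cross_sum X r f k m w ^+ 2)) + 2 * Ex (fun w => cross_sum X h r k m w ^+ 2))))).
  rewrite ler_pM2l//.
  apply: (@le_trans _ _ (Ex (fun w => c ^+ 2 * (2 * cross_sum X r f k m w ^+ 2 + 2 * cross_sum X h r k m w ^+ 2)))).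
    apply: Ex_le => //; first by apply: L1Z; apply: L1D; apply: L1Z; [case: l3|case: l4].
    move=> w; apply: (le_trans (tail_le _ _)); rewrite exprMn ler_wpM2l ?sqr_ge0//.
    have := sqr_ge0 (cross_sum X r f k m w - cross_sum X h r k m w); rewrite sqrrB sqrrD; lra.
  have a3 := l3.2; have a4 := l4.2.
  rewrite ExZ; last by apply: L1D; exact: L1Z.
  rewrite ExD; [|exact: L1Z|exact: L1Z].
  by rewrite !ExZ.
rewrite e3 e4 -/v.
have P0 := pairs_ge0 m; have P1 := pairs_le m.
move: vh vr; set vh := Ex (fun w => h _ ^+ 2); set vr := Ex (fun w => r _ ^+ 2) => hvh hvr.
have vr0 : 0 <= vr by apply: Ex_ge0 => w; exact: sqr_ge0.
have q1 : vr * v + vh * vr <= rho / 4.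
  apply: (@le_trans _ _ (2 * (v + 1) * vr)).
    have -> : vr * v + vh * vr = (v + vh) * vr by ring.
    by rewrite ler_wpM2r//; lra.
  have := ler_wpM2l (_ : 0 <= 2 * (v + 1)) hvr; rewrite mulr_ge0 ?addr_ge0// => /(_ isT) /le_trans; apply.
  rewrite le_eqVlt; apply/orP; left; apply/eqP; field.
  by rewrite gt_eqF// ltr_wpDl.
have := ler_pM _ P0 q1 P1; rewrite addr_ge0 ?mulr_ge0//; last by apply: Ex_ge0 => w; exact: sqr_ge0.
move=> /(_ isT) q2.
have := ler_wpM2l (_ : 0 <= 8 * c ^+ 2) q2; rewrite mulr_ge0 ?sqr_ge0// => /(_ isT); lra.
Qed.

End offspring_tails.

(** * The branching process *)

Section process.
Context d (T : measurableType d) (R : realType) (P : probability T R).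
Variables (X : nat -> nat -> {RV P >-> nat}) (xi : nat -> {RV P >-> nat}).
Notation Y := (merged X xi).
Notation Ex := (Ex P).
Notation L1 := (L1 P).
Notation L2 := (L2 P).
Notation mD := (mD Y).
Notation pos := [set p : nat * nat | (0 < p.1)%N].
Notation Z := (Z X xi).
Notation pairs := (pair_count R).
Hypothesis iY : independent_RVs pos Y.
Hypothesis X_distr : forall n i : nat, (0 < n)%N -> (0 < i)%N ->
     distribution P (X n i) = distribution P (X 1%N 1%N).
Variables (a bt g4 : nat -> R) (b2 kap : R).
Definition cx (y : nat) : R := y%:R - 1.
Let qx (y : nat) : R := cx y ^+ 2 - b2.
Let eps k w : R := (xi k w)%:R - a k.
Let eta k w : R := eps k w ^+ 2 - bt k.
Hypothesis Hcx : L2 (fun w => cx (X 1%N 1%N w)).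
Hypothesis Hcx0 : Ex (fun w => cx (X 1%N 1%N w)) = 0.
Hypothesis Hcx2 : Ex (fun w => cx (X 1%N 1%N w) ^+ 2) = b2.
Hypothesis Hqx : L2 (fun w => qx (X 1%N 1%N w)).
Hypothesis Hqx0 : Ex (fun w => qx (X 1%N 1%N w)) = 0.
Hypothesis Hqx2 : Ex (fun w => qx (X 1%N 1%N w) ^+ 2) = kap.
Hypothesis Heps : forall k, (0 < k)%N -> [/\ L2 (eps k), Ex (eps k) = 0 &
  Ex (fun w => eps k w ^+ 2) = bt k].
Hypothesis Heta : forall k, (0 < k)%N -> [/\ L2 (eta k), Ex (eta k) = 0 &
  Ex (fun w => eta k w ^+ 2) = g4 k].

Definition past k : set (nat * nat) := [set p | (0 < p.1 <= k)%N].

Lemma mD_addn D (f g : T -> nat) : mD D f -> mD D g -> mD D (fun w => (f w + g w)%N).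
Proof.
move=> mf mg; apply: (@mD_nat_family _ _ _ _ _ _ _ Y D _ _ f (fun z w => (z + g w)%N)) => //.
by move=> z; apply: (mD_comp (measurable_nat (fun y => (z + y)%N))).
Qed.

Lemma mD_xi k (h : nat -> R) : mD [set (k, 0%N)] (fun w => h (xi k w)).
Proof.
apply: (mD_comp (measurable_nat h)).
exact: (@mD_Y _ _ _ _ _ _ _ Y [set (k, 0%N)] (k, 0%N)).
Qed.

Lemma mD_Z n : mD (past n) (Z n).
Proof.
elim: n => [|m ih]; first exact: (@mD_cst _ _ _ _ _ _ _ Y (past 0) _ nat 0%N).
apply: (@mD_nat_family _ _ _ _ _ _ _ Y _ _ _ (Z m)
   (fun z w => (\sum_(1 <= i < z.+1) X m.+1 i w + xi m.+1 w)%N)).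
  by apply: mD_sub ih => p; rewrite /past /= => /andP[p0 pm]; rewrite p0 (leq_trans pm).
move=> z; apply: mD_addn.
  elim: z => [|z ihz].
    have -> : (fun w => \sum_(1 <= i < 1) X m.+1 i w)%N = fun=> 0%N.
      by apply/funext => w; rewrite big_geq.
    exact: (@mD_cst _ _ _ _ _ _ _ Y _ _ nat 0%N).
  have -> : (fun w => \sum_(1 <= i < z.+2) X m.+1 i w)%N =
     fun w => (\sum_(1 <= i < z.+1) X m.+1 i w + X m.+1 z.+1 w)%N.
    by apply/funext => w; rewrite big_nat_recr.
  apply: mD_addn => //.
  by apply: (@mD_Y _ _ _ _ _ _ _ Y _ (m.+1, z.+1)); rewrite /past /= ltnSn.
by apply: (@mD_Y _ _ _ _ _ _ _ Y _ (m.+1, 0%N)); rewrite /past /= ltnSn.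
Qed.

Lemma mD_ZR n : mD (past n) (fun w => (Z n w)%:R : R).
Proof. exact: (mD_comp (measurable_nat (fun y => y%:R : R)) (mD_Z (n := n))). Qed.

Lemma past_generation k : past k `&` generation k.+1 `<=` set0.
Proof. by move=> p [/= /andP[_ pk] pE]; move: pk; rewrite pE ltnn. Qed.

Lemma past_pos k : past k `<=` pos.
Proof. by move=> p /= /andP[]. Qed.

Lemma generation_pos k : generation k.+1 `<=` pos.
Proof. by move=> p; rewrite /generation /= => ->. Qed.

Lemma generation_past k : generation k.+1 `<=` past k.+1.
Proof. by move=> p; rewrite /generation /past /= => ->; rewrite ltnSn. Qed.

Lemma past_sub j k : (j <= k)%N -> past j `<=` past k.
Proof. by move=> jk p; rewrite /past /= => /andP[p0 pj]; rewrite p0 (leq_trans pj). Qed.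

(** [C] and [Z k] are determined by the past and [Phi] by the next generation, so [freeze0] and
    [L1_freeze] stand in for conditioning. The last conclusion is the martingale difference
    property, expressed as orthogonality to the past. *)
Lemma mart_step k (C : T -> R) (Phi : nat -> T -> R) (g : nat -> R) :
  mD (past k) C -> (forall w, `|C w| <= 1) ->
  (forall z, mD (generation k.+1) (Phi z)) -> (forall z, L2 (Phi z)) ->
  (forall z, Ex (Phi z) = 0) -> (forall z, Ex (fun w => Phi z w ^+ 2) <= g z) ->
  L1 (fun w => g (Z k w)) ->
  let D w := C w * Phi (Z k w) w in
  [/\ mD (past k.+1) D, L2 D, Ex (fun w => D w ^+ 2) <= Ex (fun w => g (Z k w)) &
    forall G, mD (past k) G -> L2 G -> Ex (fun w => G w * D w) = 0].
Proof.
move=> mC C1 mPhi LPhi Phi0 Phi2 Lg D.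
have mZ := mD_Z (n := k).
have D1 := @past_pos k; have D2 := @generation_pos k; have D12 := @past_generation k.
have mPZ : mD (past k.+1) (fun w => Phi (Z k w) w).
  apply: mD_nat_family; first by apply: mD_sub mZ; exact: past_sub.
  by move=> z; apply: mD_sub (mPhi z); exact: generation_past.
have mD' : mD (past k.+1) D.
  by apply: mDM => //; apply: mD_sub mC; exact: past_sub.
have [L2Z E2Z] := @L1_freeze _ _ _ _ _ _ _ Y pos iY _ _ D1 D2 D12 (Z k) mZ
  (fun z w => Phi z w ^+ 2) (fun z => mDX 2 (mPhi z)) (fun z => (LPhi z).2) g
  (fun z w => sqr_ge0 _) Phi2 Lg.
have LPZ : L2 (fun w => Phi (Z k w) w) by split => //; exact: mD_measurable mPZ.
have LD : L2 D by apply: (L2_bmul _ C1) => //; exact: mD_measurable mC.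
split => //.
  apply: le_trans E2Z; apply: Ex_le => //; first by case: LD.
  move=> w; rewrite /D exprMn ler_piMl ?sqr_ge0//.
  by rewrite -(real_normK (num_real (C w))) expr_le1.
move=> G mG LG.
have mGC : mD (past k) (fun w => G w * C w) by exact: mDM.
have LGC : L1 (fun w => G w * C w).
  apply: L2_L1M => //; apply: (@L2_bounded _ _ _ _ _ 1) => //; exact: mD_measurable mC.
have := @freeze0 _ _ _ _ _ _ _ Y pos iY _ _ D1 D2 D12 (Z k) mZ Phi mPhi
  (fun z => L2_L1 (LPhi z)) (fun w => G w * C w) mGC LGC Phi0.
have LGD : L1 (fun w => G w * D w) by exact: L2_L1M.
have e w : G w * C w * Phi (Z k w) w = G w * D w by rewrite /D mulrA.
rewrite (Ex_eq _ e); apply; apply: (L1_eq _ LGD) => w; exact/esym/e.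
Qed.

Lemma mart_sum (C : nat -> T -> R) (Phi : nat -> nat -> T -> R) (g : nat -> nat -> R) n :
  (forall k, mD (past k) (C k)) -> (forall k w, `|C k w| <= 1) ->
  (forall k z, mD (generation k.+1) (Phi k z)) -> (forall k z, L2 (Phi k z)) ->
  (forall k z, Ex (Phi k z) = 0) -> (forall k z, Ex (fun w => Phi k z w ^+ 2) <= g k z) ->
  (forall k, L1 (fun w => g k (Z k w))) ->
  let S w := \sum_(0 <= k < n) C k w * Phi k (Z k w) w in
  [/\ mD (past n) S, L2 S, Ex S = 0 &
    Ex (fun w => S w ^+ 2) <= \sum_(0 <= k < n) Ex (fun w => g k (Z k w))].
Proof.
move=> mC C1 mPhi LPhi Phi0 Phi2 Lg; elim: n => [|n [mS LS S0 S2]].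
  have -> : (fun w => \sum_(0 <= k < 0) C k w * Phi k (Z k w) w) = fun=> 0.
    by apply/funext => w; rewrite big_geq.
  split; [exact: mD_cst|exact: L2_cst|exact: Ex_cst|].
  rewrite big_geq// (@Ex_eq _ _ _ _ _ (fun=> 0)) ?Ex_cst// => w.
  by rewrite expr0n.
have [mD' LD D2 D0] := mart_step (mC n) (C1 n) (mPhi n) (LPhi n) (Phi0 n) (Phi2 n) (Lg n).
move: mS LS S0 S2; set S := fun w => \sum_(0 <= k < n) _ => mS LS S0 S2.
set D := fun w => C n w * _ in mD' LD D2 D0.
have -> : (fun w => \sum_(0 <= k < n.+1) C k w * Phi k (Z k w) w) = fun w => S w + D w.
  by apply/funext => w; rewrite big_nat_recr.
have E1 : Ex D = 0.
  have := D0 (fun=> 1) (@mD_cst _ _ _ _ _ _ _ Y _ _ R 1) (L2_cst P 1).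
  by move=> <-; apply: Ex_eq => w; rewrite mul1r.
split.
- by apply: mDD => //; apply: mD_sub mS; exact: past_sub.
- exact: L2D.
- by rewrite ExD ?S0 ?E1 ?addr0//; exact: L2_L1.
- have -> : Ex (fun w => (S w + D w) ^+ 2) = Ex (fun w => S w ^+ 2 + D w ^+ 2 + 2 * (S w * D w)).
    by apply: Ex_eq => w; ring.
  have LSD : L1 (fun w => S w * D w) by exact: L2_L1M.
  rewrite ExD; [|by apply: L1D; [case: LS|case: LD]|exact: L1Z].
  rewrite ExD; [|by case: LS|by case: LD].
  have E2 : Ex (fun w => S w * D w) = 0 by exact: D0.
  by rewrite ExZ// E2 mulr0 addr0 big_nat_recr//= lerD.
Qed.

Definition Amean n : R := \sum_(1 <= k < n.+1) a k.
(** The sum of the mean conditional variances of the increments, hence a bound for the variance of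
    [Z n]. *)
Definition vbound n : R := \sum_(0 <= k < n) (b2 * Amean k + bt k.+1).

Lemma AmeanS n : Amean n.+1 = Amean n + a n.+1.
Proof. by rewrite /Amean big_nat_recr. Qed.

(** The increment of [Z - Amean] into generation [k.+1] from a population [z]; it is centered
    because the mean offspring number is 1. *)
Definition incr k z w : R := osum X cx k.+1 z w + eps k.+1 w.

Lemma first_offspring_generation k q : first_offspring k q `<=` generation k.
Proof. by move=> p []. Qed.

Lemma xi_generation k : [set (k, 0%N)] `<=` generation k.
Proof. by move=> p ->. Qed.

Lemma offspring_xi k q : first_offspring k q `&` [set (k, 0%N)] `<=` set0.
Proof. by move=> p [[_ /andP[p2 _]] /= pE]; move: p2; rewrite pE. Qed.

Lemma xi_pos k : (0 < k)%N -> [set (k, 0%N)] `<=` pos.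
Proof. by move=> k0 p ->. Qed.

Lemma Z_recr m w : (Z m.+1 w)%:R - Amean m.+1 = ((Z m w)%:R - Amean m) + incr m (Z m w) w.
Proof.
rewrite /incr /eps AmeanS /osum /cx sumrB sumr_const_nat subn0 /=.
rewrite natrD natr_sum big_add1 /=.
by ring.
Qed.

Lemma incr_L2 k z : [/\ mD (generation k.+1) (incr k z), L2 (incr k z), Ex (incr k z) = 0 &
   Ex (fun w => incr k z w ^+ 2) = b2 * z%:R + bt k.+1].
Proof.
have [e1 e2 e3] := Heps (ltn0Sn k).
have [u1 u2 u3 u4] := @osum_L2 _ _ _ _ X xi iY X_distr cx k.+1 z (ltn0Sn k) Hcx Hcx0.
have me : mD [set (k.+1, 0%N)] (eps k.+1) by exact: (@mD_xi k.+1 (fun y => y%:R - a k.+1)).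
split.
- apply: mDD; first by apply: mD_sub u1; exact: first_offspring_generation.
  by apply: mD_sub me; exact: xi_generation.
- exact: L2D.
- by rewrite ExD ?u3 ?e2 ?addr0//; exact: L2_L1.
have [c1 c2] := Ex_mulD iY (@first_offspring_pos k.+1 z (ltn0Sn k)) (@xi_pos k.+1 (ltn0Sn k))
  (@offspring_xi k.+1 z) u1 me (L2_L1 u2) (L2_L1 e1).
have -> : Ex (fun w => incr k z w ^+ 2) =
    Ex (fun w => osum X cx k.+1 z w ^+ 2 + eps k.+1 w ^+ 2 + 2 * (osum X cx k.+1 z w * eps k.+1 w)).
  by apply: Ex_eq => w; rewrite /incr; ring.
rewrite ExD; [|by apply: L1D; [case: u2|case: e1]|exact: L1Z].
rewrite ExD; [|by case: u2|by case: e1].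
by rewrite ExZ// c2 e2 !mulr0 addr0 u4 Hcx2 e3 mulrC.
Qed.

Lemma Z_moments n : [/\ L2 (fun w => (Z n w)%:R - Amean n), Ex (fun w => (Z n w)%:R) = Amean n &
  Ex (fun w => ((Z n w)%:R - Amean n) ^+ 2) <= vbound n].
Proof.
elim: n => [|n [LZ EZ VZ]].
  have A0 : Amean 0 = 0 by rewrite /Amean big_geq.
  split.
  - by rewrite A0; exact: (L2_cst P (0%:R - 0)).
  - by rewrite A0; exact: (Ex_cst P 0%:R).
  - rewrite /vbound big_geq// (@Ex_eq _ _ _ _ _ (fun=> 0)) ?Ex_cst// => w.
    by rewrite A0 subr0 expr0n.
have L1Z' : L1 (fun w => (Z n w)%:R).
  apply: (@L1_eq _ _ _ _ (fun w => ((Z n w)%:R - Amean n) + Amean n)).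
    by move=> w; rewrite subrK.
  by apply: L1D; [exact: L2_L1|exact: L1_cst].
have [|||||||_ LD D2 D0] := @mart_step n (fun=> 1) (incr n) (fun z => b2 * z%:R + bt n.+1).
- exact: mD_cst.
- by move=> w; rewrite normr1.
- by move=> z; have [] := incr_L2 n z.
- by move=> z; have [] := incr_L2 n z.
- by move=> z; have [] := incr_L2 n z.
- by move=> z; have [_ _ _ ->] := incr_L2 n z.
- by apply: L1D; [exact: L1Z|exact: L1_cst].
set D := fun w => 1 * _ in LD D2 D0.
have ZE w : (Z n.+1 w)%:R - Amean n.+1 = ((Z n w)%:R - Amean n) + D w.
  by rewrite Z_recr /D mul1r.
have E1 : Ex D = 0.
  have := D0 (fun=> 1) (@mD_cst _ _ _ _ _ _ _ Y _ _ R 1) (L2_cst P 1).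
  by move=> <-; apply: Ex_eq => w; rewrite mul1r.
have mZA : mD (past n) (fun w => (Z n w)%:R - Amean n).
  by apply: mDB; [exact: mD_ZR|exact: mD_cst].
have LZ1 : L2 (fun w => (Z n.+1 w)%:R - Amean n.+1).
  by have -> : (fun w => (Z n.+1 w)%:R - Amean n.+1) = fun w => ((Z n w)%:R - Amean n) + D w;
     [apply/funext|exact: L2D].
have L1ZA : L1 (fun w => (Z n w)%:R - Amean n) by exact: L2_L1.
split => //.
- have -> : Ex (fun w => (Z n.+1 w)%:R) = Ex (fun w => ((Z n w)%:R - Amean n) + D w + Amean n.+1).
    by apply: Ex_eq => w; rewrite -ZE subrK.
  rewrite ExD; [|by apply: L1D => //; exact: L2_L1|exact: L1_cst].
  rewrite ExD//; last exact: L2_L1.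
  rewrite ExB//; last exact: L1_cst.
  by rewrite EZ !Ex_cst E1 subrr !add0r.
- have -> : Ex (fun w => ((Z n.+1 w)%:R - Amean n.+1) ^+ 2) =
     Ex (fun w => ((Z n w)%:R - Amean n) ^+ 2 + D w ^+ 2 + 2 * (((Z n w)%:R - Amean n) * D w)).
    by apply: Ex_eq => w; rewrite ZE; ring.
  have LSD : L1 (fun w => ((Z n w)%:R - Amean n) * D w) by exact: L2_L1M.
  rewrite ExD; [|by apply: L1D; [case: LZ|case: LD]|exact: L1Z].
  rewrite ExD; [|by case: LZ|by case: LD].
  have E2 : Ex (fun w => ((Z n w)%:R - Amean n) * D w) = 0 by exact: D0.
  rewrite ExZ// E2 mulr0 addr0 /vbound big_nat_recr//= lerD//.
  apply: (le_trans D2); rewrite ExD; [|exact: L1Z|exact: L1_cst].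
  by rewrite ExZ// EZ Ex_cst.
Qed.

Lemma L2_Z n : L2 (fun w => (Z n w)%:R : R).
Proof.
have [LZ _ _] := Z_moments n.
have -> : (fun w => (Z n w)%:R : R) = fun w => ((Z n w)%:R - Amean n) + Amean n.
  by apply/funext => w; rewrite subrK.
by apply: L2D => //; exact: L2_cst.
Qed.

(** Kolmogorov's maximal inequality, by stopping the martingale Z - A at its
    first exit from [-lam, lam]. *)
Lemma maximal_inequality (lam : R) n : 0 < lam ->
  exists Good : set T, [/\ measurable Good,
    (forall w, Good w -> forall k, (k <= n)%N -> `|(Z k w)%:R - Amean k| <= lam) &
    fine (P (~` Good)) <= vbound n / lam ^+ 2].
Proof.
move=> lam0.
(* The indicator that no exit has occurred up to and including time [k]. It depends on the past of
   [k], so it may multiply the increment into generation [k.+1]. *)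
pose C k w : R := \prod_(0 <= j < k.+1) (`|(Z j w)%:R - Amean j| <= lam)%R%:R.
have C1 k w : (forall j, (j <= k)%N -> `|(Z j w)%:R - Amean j| <= lam) -> C k w = 1.
  move=> h; rewrite /C big_nat_cond big1// => j; rewrite andbT ltnS => /andP[_ jk].
  by rewrite h.
have C0 k w j : (j <= k)%N -> lam < `|(Z j w)%:R - Amean j| -> C k w = 0.
  move=> jk h; rewrite /C big_mkord (bigD1 (Ordinal (n := k.+1) (m := j) jk)) //=.
  by rewrite leNgt h mul0r.
have C01 k w : C k w = 0 \/ C k w = 1.
  case: (pselect (forall j, (j <= k)%N -> `|(Z j w)%:R - Amean j| <= lam)) => h.
    by right; exact: C1.
  left; move/existsNP: h => [j /not_implyP[jk /negP]]; rewrite -ltNge; exact: C0.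
have mind j : mD (past j) (fun w => (`|(Z j w)%:R - Amean j| <= lam)%R%:R : R).
  exact: (mD_comp (measurable_nat (fun y : nat => (`|y%:R - Amean j| <= lam)%R%:R : R)) (mD_Z (n := j))).
have mC k : mD (past k) (C k).
  suff gen j : (j <= k.+1)%N -> mD (past k) (fun w => \prod_(0 <= i < j) (`|(Z i w)%:R - Amean i| <= lam)%R%:R : R).
    exact: gen.
  elim: j => [|j ih] jk.
    have -> : (fun w => \prod_(0 <= i < 0) (`|(Z i w)%:R - Amean i| <= lam)%R%:R) = fun=> (1 : R).
      by apply/funext => w; rewrite big_geq.
    exact: (@mD_cst _ _ _ _ _ _ _ Y _ _ R 1).
  have -> : (fun w => \prod_(0 <= i < j.+1) (`|(Z i w)%:R - Amean i| <= lam)%R%:R : R) =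
    fun w => (\prod_(0 <= i < j) (`|(Z i w)%:R - Amean i| <= lam)%R%:R) * (`|(Z j w)%:R - Amean j| <= lam)%R%:R.
    by apply/funext => w; rewrite big_nat_recr.
  apply: mDM; first by apply: ih; exact: ltnW.
  by apply: mD_sub (mind j); exact: past_sub.
have [||||||_ LS _ S2] := @mart_sum C incr (fun k z => b2 * z%:R + bt k.+1) n mC.
- by move=> k w; have [->|->] := C01 k w; rewrite ?normr0 ?normr1.
- by move=> k z; have [] := incr_L2 k z.
- by move=> k z; have [] := incr_L2 k z.
- by move=> k z; have [] := incr_L2 k z.
- by move=> k z; have [_ _ _ ->] := incr_L2 k z.
- move=> k; apply: L1D; [apply: L1Z|exact: L1_cst].
  exact: L2_L1 (L2_Z k).
set S := fun w => \sum_(0 <= k < n) _ in LS S2.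
have mG : measurable (C n @^-1` [set 1]).
  rewrite -[X in measurable X]setTI.
  by apply: (mD_measurable (mC n)) => //; exact: measurable_set1.
exists (C n @^-1` [set 1]); split => //.
  move=> w /= Cw k kn; rewrite leNgt; apply/negP => h.
  by move: Cw; rewrite (C0 n w k kn h) => /eqP; rewrite eq_sym oner_eq0.
have sub : ~` (C n @^-1` [set 1]) `<=` [set w | lam < `|S w|].
  move=> w /= Cw.
  have exk : exists k, (k <= n)%N && (lam < `|(Z k w)%:R - Amean k|).
    apply: contrapT => nex; apply: Cw; apply: C1 => j jn.
    by rewrite leNgt; apply/negP => h; apply: nex; exists j; rewrite jn.
  (* At the first exit time [k] the multipliers before [k] are 1 and those from [k] on are 0, so the
     stopped sum equals the deviation at time [k]. *)
  case: (ex_minnP exk) => k /andP[kn hk] kmin.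
  suff -> : S w = (Z k w)%:R - Amean k by [].
  have tel j : (j <= k)%N -> \sum_(0 <= i < j) C i w * incr i (Z i w) w = (Z j w)%:R - Amean j.
    elim: j => [|j ih] jk.
      by rewrite big_geq// /Amean big_geq// subr0.
    rewrite big_nat_recr//= ih; last exact: ltnW.
    rewrite C1 ?mul1r -?Z_recr// => i ij; rewrite leNgt; apply/negP => h.
    have := kmin i; rewrite h (leq_trans ij (leq_trans (ltnW jk) kn)) => /(_ isT).
    by rewrite leqNgt (leq_ltn_trans ij jk).
  rewrite /S (big_cat_nat (leq0n k) kn) /= tel//.
  rewrite big_nat_cond big1 ?addr0// => i; rewrite andbT => /andP[ki _].
  by rewrite (C0 i w k ki hk) mul0r.
apply: (@le_trans _ _ (fine (P [set w | lam < `|S w|]))).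
  have mS : measurable [set w | lam < `|S w|].
    have -> : [set w | lam < `|S w|] = setT `&` (fun w => `|S w|) @^-1` `]lam, +oo[%classic.
      by rewrite setTI; apply/seteqP; split => w /=; rewrite in_itv /= andbT.
    have mn : measurable_fun setT (fun w => `|S w|) by apply: measurableT_comp => //; case: LS.
    by apply: mn => //; exact: measurable_itv.
  rewrite fine_le ?fin_num_measure//; first exact: measurableC.
  by apply: le_measure; rewrite ?inE//; exact: measurableC.
apply: (le_trans (markov2 lam0 LS)).
rewrite ler_pM2r ?invr_gt0 ?exprn_gt0//; apply: (le_trans S2).
rewrite /vbound; apply: ler_sum_nat => k _.
have [_ EZ _] := Z_moments k.
rewrite ExD; [|by apply: L1Z; exact: L2_L1 (L2_Z k)|exact: L1_cst].
by rewrite ExZ ?EZ ?Ex_cst//; exact: L2_L1 (L2_Z k).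
Qed.

Hypothesis a_ge0 : forall k, (0 < k)%N -> 0 <= a k.

Lemma Amean_ge0 n : 0 <= Amean n.
Proof.
by rewrite /Amean big_nat_cond sumr_ge0// => k; rewrite andbT => /andP[k0 _]; exact: a_ge0.
Qed.

Lemma Amean_le j k : (j <= k)%N -> Amean j <= Amean k.
Proof.
elim: k => [|k ih]; first by rewrite leqn0 => /eqP ->.
rewrite leq_eqVlt => /orP[/eqP -> //|jk].
by rewrite AmeanS (le_trans (ih jk))// lerDl a_ge0.
Qed.

(** With U z the centered offspring sum of z individuals, the squared increment
    (U z + eps) ^+ 2 minus its mean splits into four uncorrelated terms. *)
Definition fluct k z w : R :=
  2 * cross_sum X cx cx k.+1 z w + osum X qx k.+1 z w
  + 2 * (osum X cx k.+1 z w * eps k.+1 w) + eta k.+1 w.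

Lemma incr_sqr k z w : incr k z w ^+ 2 - bt k.+1 - b2 * z%:R = fluct k z w.
Proof.
rewrite /incr /fluct /eta sqrrD osum_sqr.
have -> : osum X qx k.+1 z w = \sum_(0 <= q < z) cx (X k.+1 q.+1 w) ^+ 2 - b2 * z%:R.
  by rewrite /osum /qx sumrB sumr_const_nat subn0 mulr_natr.
by rewrite -mulr_natl; ring.
Qed.

Lemma mD_cross k z : [/\ mD (generation k.+1) (fun w => osum X cx k.+1 z w * eps k.+1 w),
  L2 (fun w => osum X cx k.+1 z w * eps k.+1 w),
  Ex (fun w => osum X cx k.+1 z w * eps k.+1 w) = 0 &
  Ex (fun w => (osum X cx k.+1 z w * eps k.+1 w) ^+ 2) = b2 * z%:R * bt k.+1].
Proof.
have [e1 e2 e3] := Heps (ltn0Sn k).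
have [u1 u2 u3 u4] := @osum_L2 _ _ _ _ X xi iY X_distr cx k.+1 z (ltn0Sn k) Hcx Hcx0.
have me : mD [set (k.+1, 0%N)] (eps k.+1) by exact: (@mD_xi k.+1 (fun y => y%:R - a k.+1)).
have [c1 c2] := Ex_mulD iY (@first_offspring_pos k.+1 z (ltn0Sn k)) (@xi_pos k.+1 (ltn0Sn k))
  (@offspring_xi k.+1 z) u1 me (L2_L1 u2) (L2_L1 e1).
have [c3 c4] := Ex_mulD iY (@first_offspring_pos k.+1 z (ltn0Sn k)) (@xi_pos k.+1 (ltn0Sn k))
  (@offspring_xi k.+1 z) (mDX 2 u1) (mDX 2 me) u2.2 e1.2.
have mm : mD (generation k.+1) (fun w => osum X cx k.+1 z w * eps k.+1 w).
  apply: mDM; first by apply: mD_sub u1; exact: first_offspring_generation.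
  by apply: mD_sub me; exact: xi_generation.
split => //.
- split; first exact: mD_measurable mm.
  by apply: (L1_eq _ c3) => w; rewrite exprMn.
- by rewrite c2 e2 mulr0.
- have -> : Ex (fun w => (osum X cx k.+1 z w * eps k.+1 w) ^+ 2) =
      Ex (fun w => osum X cx k.+1 z w ^+ 2 * eps k.+1 w ^+ 2).
    by apply: Ex_eq => w; rewrite exprMn.
  by rewrite c4 u4 Hcx2 e3; ring.
Qed.

Lemma cross_sum_facts k z : [/\ mD (generation k.+1) (cross_sum X cx cx k.+1 z),
  L2 (cross_sum X cx cx k.+1 z), Ex (cross_sum X cx cx k.+1 z) = 0 &
  Ex (fun w => cross_sum X cx cx k.+1 z w ^+ 2) = b2 ^+ 2 * pairs z].
Proof.
have [h1 h2 h3 h4] := @cross_sum_L2 _ _ _ _ X xi iY X_distr cx cx k.+1 z (ltn0Sn k) Hcx Hcx0 Hcx Hcx0.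
split => //; first by apply: mD_sub h1; exact: first_offspring_generation.
by rewrite h4 Hcx2 expr2.
Qed.

Lemma qsum_facts k z : [/\ mD (generation k.+1) (osum X qx k.+1 z),
  L2 (osum X qx k.+1 z), Ex (osum X qx k.+1 z) = 0 &
  Ex (fun w => osum X qx k.+1 z w ^+ 2) = kap * z%:R].
Proof.
have [h1 h2 h3 h4] := @osum_L2 _ _ _ _ X xi iY X_distr qx k.+1 z (ltn0Sn k) Hqx Hqx0.
split => //; first by apply: mD_sub h1; exact: first_offspring_generation.
by rewrite h4 Hqx2 mulrC.
Qed.

Lemma eta_facts k : [/\ mD (generation k.+1) (eta k.+1), L2 (eta k.+1), Ex (eta k.+1) = 0 &
  Ex (fun w => eta k.+1 w ^+ 2) = g4 k.+1].
Proof.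
have [h1 h2 h3] := Heta (ltn0Sn k); split => //.
apply: mD_sub (@mD_xi k.+1 (fun y => (y%:R - a k.+1) ^+ 2 - bt k.+1)).
exact: xi_generation.
Qed.

(** The deterministic number of individuals used in place of the population [Z k]. *)
Definition mfloor k : nat := Num.truncn (Amean k).

(** * Replacing the population by its mean *)

Section comparison.
Variable del : R.
Hypothesis del0 : 0 <= del.

Let near_mean k (z : nat) : R := (`|z%:R - Amean k| <= del)%R%:R.

(** While [z] is within [del] of [Amean k], this is the difference between the increment [z * fluct]
    and the independent term, see [comp_termE]. The cutoff bounds the factor [z - Amean k] and
    depends on [z] alone, so the term stays centered for each fixed [z]. *)
Definition comp_term k z w : R :=
  near_mean k z * (z%:R - Amean k) * fluct k z w +
  Amean k * (2 * (cross_sum X cx cx k.+1 z w - cross_sum X cx cx k.+1 (mfloor k) w)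
    + osum X qx k.+1 z w + 2 * (osum X cx k.+1 z w * eps k.+1 w)).

(** 8 is 2 times 4 and 6 is 2 times 3: the square of the sum of the two blocks costs a factor 2, and
    the blocks have four and three terms. *)
Definition comp_var k (z : nat) : R :=
  8 * del ^+ 2 * (4 * (b2 ^+ 2 * pairs z) + kap * z%:R + 4 * (b2 * z%:R * bt k.+1) + g4 k.+1) +
  6 * Amean k ^+ 2 * (4 * (b2 ^+ 2 * `|pairs z - pairs (mfloor k)|) + kap * z%:R
     + 4 * (b2 * z%:R * bt k.+1)).

Lemma comp_term_facts k z : [/\ mD (generation k.+1) (comp_term k z), L2 (comp_term k z),
  Ex (comp_term k z) = 0 & Ex (fun w => comp_term k z w ^+ 2) <= comp_var k z].
Proof.
have [x1 x2 x3 x4] := mD_cross k z.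
have [y1 y2 y3 y4] := cross_sum_facts k z.
have [m1 m2 m3 m4] := cross_sum_facts k (mfloor k).
have [q1 q2 q3 q4] := qsum_facts k z.
have [e1 e2 e3 e4] := eta_facts k.
have dd := @cross_sum_diff_L2 _ _ _ _ X xi iY X_distr cx cx k.+1 (mfloor k) z (ltn0Sn k) Hcx Hcx0 Hcx Hcx0.
rewrite !Hcx2 in dd.
set c := near_mean k z * (z%:R - Amean k).
have c2 : c ^+ 2 <= del ^+ 2.
  rewrite /c /near_mean; case: (boolP (_ <= del)) => h; rewrite ?mul1r ?mul0r.
    by rewrite -(real_normK (num_real (_ - _))) ler_pXn2r// nnegrE.
  by rewrite expr0n sqr_ge0.
set u := fun w => osum X cx k.+1 z w * eps k.+1 w in x1 x2 x3 x4.
set l := cross_sum X cx cx k.+1 z in y1 y2 y3 y4 dd.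
set lm := cross_sum X cx cx k.+1 (mfloor k) in m1 m2 m3 m4 dd.
set q := osum X qx k.+1 z in q1 q2 q3 q4.
set e := eta k.+1 in e1 e2 e3 e4.
have tE : comp_term k z = fun w => c * (2 * l w + q w + 2 * u w + e w) +
   Amean k * (2 * (l w - lm w) + q w + 2 * u w) by [].
have Ll2 := L2Z 2 y2; have Lu2 := L2Z 2 x2; have Ld2 := L2Z 2 (L2B y2 m2).
have LG : L2 (fun w => 2 * l w + q w + 2 * u w + e w).
  by apply: L2D => //; apply: L2D => //; exact: L2D.
have LH : L2 (fun w => 2 * (l w - lm w) + q w + 2 * u w).
  by apply: L2D => //; exact: L2D.
have LT : L2 (comp_term k z) by rewrite tE; apply: L2D; exact: L2Z.
have mDZ (x : R) f : mD (generation k.+1) f -> mD (generation k.+1) (fun w => x * f w).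
  by move=> mf; apply: mDM => //; exact: (@mD_cst _ _ _ _ _ _ _ Y _ _ R x).
split => //.
- rewrite tE; apply: mDD; apply: (mDZ _ _).
    exact: (mDD (mDD (mDD (mDZ 2 _ y1) q1) (mDZ 2 _ x1)) e1).
  exact: (mDD (mDD (mDZ 2 _ (mDB y1 m1)) q1) (mDZ 2 _ x1)).
- rewrite tE ExD; [|by apply: L1Z; exact: L2_L1|by apply: L1Z; exact: L2_L1].
  rewrite !ExZ; [|exact: L2_L1|exact: L2_L1].
  have -> : Ex (fun w => 2 * l w + q w + 2 * u w + e w) = 0.
    rewrite ExD; [|by apply: L2_L1; apply: L2D => //; exact: L2D|exact: L2_L1].
    rewrite ExD; [|by apply: L2_L1; exact: L2D|exact: L2_L1].
    rewrite ExD; [|exact: L2_L1|exact: L2_L1].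
    rewrite !ExZ; [|exact: L2_L1|exact: L2_L1].
    by rewrite y3 q3 x3 e3; ring.
  have -> : Ex (fun w => 2 * (l w - lm w) + q w + 2 * u w) = 0.
    rewrite ExD; [|by apply: L2_L1; exact: L2D|exact: L2_L1].
    rewrite ExD; [|exact: L2_L1|exact: L2_L1].
    rewrite !ExZ; [|exact: L2_L1|by apply: L2_L1; exact: L2B].
    by rewrite ExB; [rewrite y3 m3 q3 x3; ring|exact: L2_L1|exact: L2_L1].
  by rewrite !mulr0 addr0.
- have le1 w : comp_term k z w ^+ 2 <=
     8 * del ^+ 2 * (4 * l w ^+ 2 + q w ^+ 2 + 4 * u w ^+ 2 + e w ^+ 2) +
     6 * Amean k ^+ 2 * (4 * (l w - lm w) ^+ 2 + q w ^+ 2 + 4 * u w ^+ 2).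
    rewrite tE; move: (l w) (lm w) (q w) (u w) (e w) => L M Q U E.
    have s2 (x y : R) : (x + y) ^+ 2 <= 2 * x ^+ 2 + 2 * y ^+ 2.
      by have := sqr_ge0 (x - y); rewrite sqrrB sqrrD; lra.
    apply: (le_trans (s2 _ _)); rewrite !exprMn lerD//.
      have g0 : (2 * L + Q + 2 * U + E) ^+ 2 <= 4 * (4 * L ^+ 2 + Q ^+ 2 + 4 * U ^+ 2 + E ^+ 2).
        have := s2 (2 * L + Q) (2 * U + E); have := s2 (2 * L) Q; have := s2 (2 * U) E.
        by rewrite !exprMn addrA; lra.
      have := ler_pM (sqr_ge0 c) (sqr_ge0 (2 * L + Q + 2 * U + E)) c2 g0.
      by rewrite exprMn; lra.
    have g0 : (2 * (L - M) + Q + 2 * U) ^+ 2 <= 3 * (4 * (L - M) ^+ 2 + Q ^+ 2 + 4 * U ^+ 2).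
      move: (L - M) => D.
      have := sqr_ge0 (2 * D - Q); have := sqr_ge0 (2 * D - 2 * U); have := sqr_ge0 (Q - 2 * U).
      by rewrite !sqrrB !sqrrD !exprMn; lra.
    have := ler_wpM2l (sqr_ge0 (Amean k)) g0; lra.
  have Lsq f : L2 f -> L1 (fun w => f w ^+ 2) by case.
  have LB : L1 (fun w => l w - lm w) by apply: L2_L1; exact: L2B.
  have LB2 : L1 (fun w => (l w - lm w) ^+ 2) by apply: Lsq; exact: L2B.
  have R1 : L1 (fun w => 4 * l w ^+ 2 + q w ^+ 2 + 4 * u w ^+ 2 + e w ^+ 2).
    by apply: L1D; [apply: L1D; [apply: L1D|]|]; try apply: L1Z; exact: Lsq.
  have R2 : L1 (fun w => 4 * (l w - lm w) ^+ 2 + q w ^+ 2 + 4 * u w ^+ 2).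
    by apply: L1D; [apply: L1D; [apply: L1Z|exact: Lsq]|apply: L1Z; exact: Lsq].
  apply: (le_trans (Ex_le (Lsq _ LT) _ le1)).
    by apply: L1D; exact: L1Z.
  rewrite ExD; [|exact: L1Z|exact: L1Z].
  rewrite !ExZ// /comp_var lerD//.
    rewrite ExD; [|by apply: L1D; [apply: L1D|]; try apply: L1Z; exact: Lsq|exact: Lsq].
    rewrite ExD; [|by apply: L1D; try apply: L1Z; exact: Lsq|by apply: L1Z; exact: Lsq].
    rewrite ExD; [|by apply: L1Z; exact: Lsq|exact: Lsq].
    by rewrite !ExZ; [rewrite y4 q4 x4 e4|exact: Lsq|exact: Lsq].
  rewrite ExD; [|by apply: L1D; [exact: L1Z|exact: Lsq]|by apply: L1Z; exact: Lsq].
  rewrite ExD; [|exact: L1Z|exact: Lsq].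
  by rewrite !ExZ//; [rewrite dd q4 x4 expr2|exact: Lsq].
Qed.

Lemma mfloor_itv k : (mfloor k)%:R <= Amean k < (mfloor k)%:R + 1.
Proof. by rewrite /mfloor natr1 truncn_itv// Amean_ge0. Qed.

Variable mu : R.
Hypothesis mu0 : 0 < mu.

Lemma weighted_am_gm (x y : R) : 2 * (x * y) <= x ^+ 2 / mu + mu * y ^+ 2.
Proof.
rewrite -subr_ge0.
have -> : x ^+ 2 / mu + mu * y ^+ 2 - 2 * (x * y) = mu * (x / mu - y) ^+ 2.
  by field; rewrite gt_eqF.
by rewrite mulr_ge0 ?sqr_ge0// ltW.
Qed.

(** The dominant part of the difference is [(z - Amean k) * Amean k]. The weight [mu] splits it into
    a small multiple of [Amean k ^+ 2] and a large multiple of [(z - Amean k) ^+ 2], whose mean at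
    [z = Z k] is of smaller order. *)
Lemma pairs_diff_le k z : `|pairs z - pairs (mfloor k)| <=
  (((2 + mu^-1) * (z%:R - Amean k) ^+ 2 + mu * Amean k ^+ 2 + 2 * Amean k + 4)) / 2.
Proof.
have /andP[] := mfloor_itv k; have := Amean_ge0 k; rewrite /pair_count.
move: (mfloor k)%:R (z%:R : R) (Amean k) => m y A A0 mA Am.
have := weighted_am_gm (y - A) A; have := weighted_am_gm (A - y) A.
have -> : (A - y) ^+ 2 = (y - A) ^+ 2 by ring.
have -> : (A - y) * A = - ((y - A) * A) by ring.
have -> : (2 + mu^-1) * (y - A) ^+ 2 = 2 * (y - A) ^+ 2 + (y - A) ^+ 2 / mu by ring.
have -> : y * (y - 1) / 2 - m * (m - 1) / 2 =
  ((y - A) ^+ 2 + 2 * ((y - A) * A) - (y - A) + 2 * (A * (A - m)) - (A - m) ^+ 2 - (A - m)) / 2.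
  by field.
have := sqr_ge0 (y - A).
have : 0 <= (y - A) ^+ 2 + 2 * (y - A) + 1.
  by have := sqr_ge0 (y - A + 1); rewrite sqrrD mulr1 expr1n; lra.
have : 0 <= (y - A) ^+ 2 - 2 * (y - A) + 1.
  by have := sqr_ge0 (y - A - 1); rewrite sqrrB mulr1 expr1n; lra.
have : 0 <= A * (A - m) <= A.
  by rewrite mulr_ge0 ?subr_ge0//= ler_piMr// lerBlDr; lra.
have : 0 <= (A - m) ^+ 2 <= 1.
  by rewrite sqr_ge0 expr_le1 ?subr_ge0// lerBlDr; lra.
move: ((y - A) ^+ 2) (A * (A - m)) ((A - m) ^+ 2) (mu * A ^+ 2) ((y - A) * A) ((y - A) ^+ 2 / mu) => a2 a3 a4 a5 a6 a1.
by move=> /andP[? ?] /andP[? ?] ? ? ? ? ?; rewrite ler_norml; apply/andP; split; lra.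
Qed.

Definition comp_bound k : R :=
  8 * del ^+ 2 * (2 * b2 ^+ 2 * (Amean k ^+ 2 + vbound k) + kap * Amean k
    + 4 * b2 * Amean k * bt k.+1 + g4 k.+1) +
  6 * Amean k ^+ 2 * (2 * b2 ^+ 2 * ((2 + mu^-1) * vbound k + mu * Amean k ^+ 2 + 2 * Amean k + 4)
    + kap * Amean k + 4 * b2 * Amean k * bt k.+1).

Lemma mu_inv_ge0 : 0 <= mu^-1. Proof. by rewrite invr_ge0 ltW. Qed.

Lemma comp_sum n :
  let S w := \sum_(0 <= k < n) comp_term k (Z k w) w in
  L2 S /\ Ex (fun w => S w ^+ 2) <= \sum_(0 <= k < n) comp_bound k.
Proof.
(* The bound on [comp_var] is arranged as a polynomial in [z - Amean k] and [z], by [z ^+ 2 = (z -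
   A) ^+ 2 + 2 * A * z - A ^+ 2], so that [Z_moments] gives its mean. *)
pose c2 k := 16 * del ^+ 2 * b2 ^+ 2 + 12 * Amean k ^+ 2 * b2 ^+ 2 * (2 + mu^-1).
pose c1 k := 8 * del ^+ 2 * (4 * b2 ^+ 2 * Amean k + kap + 4 * b2 * bt k.+1)
  + 6 * Amean k ^+ 2 * (kap + 4 * b2 * bt k.+1).
pose c0 k := 8 * del ^+ 2 * (g4 k.+1 - 2 * b2 ^+ 2 * Amean k ^+ 2)
  + 12 * Amean k ^+ 2 * b2 ^+ 2 * (mu * Amean k ^+ 2 + 2 * Amean k + 4).
pose g k (z : nat) := c2 k * (z%:R - Amean k) ^+ 2 + c1 k * z%:R + c0 k.
have cg k z : comp_var k z <= g k z.
  have h1 := pairs_diff_le k z.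
  have h2 : pairs z <= z%:R ^+ 2 / 2.
    by rewrite /pair_count expr2 ler_pM2r ?invr_gt0// ler_wpM2l// lerBlDr lerDl.
  have b0 := sqr_ge0 b2.
  have k1 := ler_wpM2l (mulr_ge0 (sqr_ge0 del) b0) h2.
  have k2 := ler_wpM2l (mulr_ge0 (sqr_ge0 (Amean k)) b0) h1.
  rewrite -subr_ge0 in k1; rewrite -subr_ge0 in k2.
  rewrite -subr_ge0 /comp_var.
  have -> : g k z - (8 * del ^+ 2 * (4 * (b2 ^+ 2 * pairs z) + kap * z%:R + 4 * (b2 * z%:R * bt k.+1) + g4 k.+1) +
     6 * Amean k ^+ 2 * (4 * (b2 ^+ 2 * `|pairs z - pairs (mfloor k)|) + kap * z%:R + 4 * (b2 * z%:R * bt k.+1))) =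
     32 * (del ^+ 2 * b2 ^+ 2 * (z%:R ^+ 2 / 2) - del ^+ 2 * b2 ^+ 2 * pairs z) +
     24 * (Amean k ^+ 2 * b2 ^+ 2 * (((2 + mu^-1) * (z%:R - Amean k) ^+ 2 + mu * Amean k ^+ 2 + 2 * Amean k + 4) / 2)
       - Amean k ^+ 2 * b2 ^+ 2 * `|pairs z - pairs (mfloor k)|).
    by rewrite /g /c2 /c1 /c0; field; rewrite gt_eqF.
  by rewrite addr_ge0// mulr_ge0.
have gE k : L1 (fun w => g k (Z k w)) /\ Ex (fun w => g k (Z k w)) <= comp_bound k.
  have [LZ EZ VZ] := Z_moments k.
  have L1Z' := L2_L1 (L2_Z k).
  have g1 : L1 (fun w => c2 k * ((Z k w)%:R - Amean k) ^+ 2) by apply: L1Z; case: LZ.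
  have g2 : L1 (fun w => c1 k * (Z k w)%:R) by exact: L1Z.
  split; first by rewrite /g; apply: L1D (L1_cst _ _); exact: L1D.
  rewrite /g ExD; [|exact: L1D|exact: L1_cst].
  rewrite ExD// Ex_cst ExZ; last by case: LZ.
  rewrite ExZ// EZ.
  have c2p : 0 <= c2 k by rewrite /c2 ?(sqr_ge0, addr_ge0, mulr_ge0, mu_inv_ge0).
  have := ler_wpM2l c2p VZ; rewrite -subr_ge0 => h.
  rewrite -subr_ge0.
  suff -> : comp_bound k - (c2 k * Ex (fun w => ((Z k w)%:R - Amean k) ^+ 2) + c1 k * Amean k + c0 k) =
    c2 k * vbound k - c2 k * Ex (fun w => ((Z k w)%:R - Amean k) ^+ 2) by [].
  by rewrite /comp_bound /c2 /c1 /c0; ring.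
have [|||||||_ LS _ S2] := @mart_sum (fun _ _ => 1) comp_term g n.
- by move=> k; exact: (@mD_cst _ _ _ _ _ _ _ Y _ _ R 1).
- by move=> k w; rewrite normr1.
- by move=> k z; have [] := comp_term_facts k z.
- by move=> k z; have [] := comp_term_facts k z.
- by move=> k z; have [] := comp_term_facts k z.
- by move=> k z; have [_ _ _ /le_trans] := comp_term_facts k z; apply.
- by move=> k; have [] := gE k.
have SE : (fun w => \sum_(0 <= k < n) 1 * comp_term k (Z k w) w) =
    fun w => \sum_(0 <= k < n) comp_term k (Z k w) w.
  by apply/funext => w; apply: eq_bigr => k _; rewrite mul1r.
rewrite SE in LS; split => //.
apply: le_trans (_ : _ <= \sum_(0 <= k < n) Ex (fun w => g k (Z k w))) _.
  by apply: le_trans S2; rewrite (_ : (fun w => _) = (fun w => (\sum_(0 <= k < n) 1 * comp_term k (Z k w) w) ^+ 2)) //;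
    apply/funext => w; congr (_ ^+ 2); apply: eq_bigr => k _; rewrite mul1r.
by apply: ler_sum_nat => k _; have [] := gE k.
Qed.

Lemma comp_termE k z w : `|z%:R - Amean k| <= del ->
  comp_term k z w = z%:R * fluct k z w -
    Amean k * (2 * cross_sum X cx cx k.+1 (mfloor k) w + eta k.+1 w).
Proof. by move=> h; rewrite /comp_term /near_mean h mul1r /fluct; ring. Qed.

End comparison.

Definition residual n w : R := \sum_(0 <= k < n) (Z k w)%:R * fluct k (Z k w) w.
Definition main_term k w : R :=
  Amean k * (2 * cross_sum X cx cx k.+1 (mfloor k) w + eta k.+1 w).

Lemma measurable_lt_norm (f : T -> R) e : measurable_fun setT f ->
  measurable [set w | e < `|f w|].
Proof.
move=> mf.
have -> : [set w | e < `|f w|] = setT `&` (fun w => `|f w|) @^-1` `]e, +oo[%classic.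
  by rewrite setTI; apply/seteqP; split => w /=; rewrite in_itv /= andbT.
have mn : measurable_fun setT (fun w => `|f w|) by exact: measurableT_comp.
by apply: mn => //; exact: measurable_itv.
Qed.

Lemma comparison (del mu e : R) n : 0 < del -> 0 < mu -> 0 < e ->
  exists Good : set T, [/\ measurable Good,
    fine (P (~` Good)) <= vbound n / del ^+ 2 + (\sum_(0 <= k < n) comp_bound del mu k) / e ^+ 2,
    (forall w, Good w -> forall k, (k <= n)%N -> `|(Z k w)%:R - Amean k| <= del) &
    (forall w, Good w -> `|residual n w - \sum_(0 <= k < n) main_term k w| <= e)].
Proof.
move=> del0 mu0 e0.
have [G1 [mG1 hG1 PG1]] := maximal_inequality n del0.
have [LS S2] := comp_sum (ltW del0) mu0 n.
have mS := measurable_lt_norm e LS.1.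
exists (G1 `&` ~` [set w | e < `|\sum_(0 <= k < n) comp_term del k (Z k w) w|]); split.
- by apply: measurableI => //; exact: measurableC.
- rewrite setCI setCK.
  apply: (@le_trans _ _ (fine (P (~` G1)) + fine (P [set w | e < `|\sum_(0 <= k < n) comp_term del k (Z k w) w|]))).
    rewrite -fineD ?fin_num_measure//; last exact: measurableC.
    have mU : measurable (~` G1 `|` [set w | e < `|\sum_(0 <= k < n) comp_term del k (Z k w) w|]).
      by apply: measurableU => //; exact: measurableC.
    have mG1' := measurableC mG1.
    by rewrite fine_le ?fin_numD ?fin_num_measure//; exact: measureU2.
  rewrite lerD// (le_trans (markov2 e0 LS))// ler_pM2r ?invr_gt0 ?exprn_gt0//.
- by move=> w [] /hG1.
- move=> w [/hG1 h /negP]; rewrite -leNgt; congr (`|_| <= _).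
  rewrite /residual -sumrB; apply: eq_big_nat => k /andP[_ kn].
  by rewrite comp_termE// h// ltnW.
Qed.

Lemma eta_cross_sum k m : L1 (fun w => cross_sum X cx cx k.+1 m w * eta k.+1 w) /\
  Ex (fun w => cross_sum X cx cx k.+1 m w * eta k.+1 w) = 0.
Proof.
have [e1 e2 e3] := Heta (ltn0Sn k).
have [h1 h2 h3 h4] := @cross_sum_L2 _ _ _ _ X xi iY X_distr cx cx k.+1 m (ltn0Sn k) Hcx Hcx0 Hcx Hcx0.
have me : mD [set (k.+1, 0%N)] (eta k.+1).
  exact: (@mD_xi k.+1 (fun y => (y%:R - a k.+1) ^+ 2 - bt k.+1)).
have [c1 c2] := Ex_mulD iY (@first_offspring_pos k.+1 m (ltn0Sn k)) (@xi_pos k.+1 (ltn0Sn k))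
  (@offspring_xi k.+1 m) h1 me (L2_L1 h2) (L2_L1 e1).
by split => //; rewrite c2 e2 mulr0.
Qed.

Lemma main_term_facts k : [/\ mD (generation k.+1) (main_term k), L2 (main_term k), Ex (main_term k) = 0 &
  Ex (fun w => main_term k w ^+ 2) = Amean k ^+ 2 * (4 * (b2 ^+ 2 * pairs (mfloor k)) + g4 k.+1)].
Proof.
have [m1 m2 m3 m4] := cross_sum_facts k (mfloor k).
have [e1 e2 e3 e4] := eta_facts k.
have [c1 c2] := eta_cross_sum k (mfloor k).
move: m1 m2 m3 m4 c1 c2; set l := cross_sum X cx cx k.+1 (mfloor k) => m1 m2 m3 m4 c1 c2.
have mcst x : mD (generation k.+1) (fun=> x : R) by exact: (@mD_cst _ _ _ _ _ _ _ Y _ _ R x).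
have L2l := L2Z 2 m2; have L2r := L2D L2l e2.
split.
- exact: mDM (mcst _) (mDD (mDM (mcst 2) m1) e1).
- exact: L2Z.
- rewrite /main_term ExZ; last exact: L2_L1.
  rewrite ExD; [|exact: L2_L1|exact: L2_L1].
  by rewrite ExZ; [rewrite m3 e3 mulr0 addr0 mulr0|exact: L2_L1].
- rewrite (@Ex_eq _ _ _ _ _ (fun w => Amean k ^+ 2 * ((4 * l w ^+ 2 + eta k.+1 w ^+ 2) + 4 * (l w * eta k.+1 w))));
    last by move=> w; rewrite /main_term -/l; ring.
  have q1 : L1 (fun w => 4 * l w ^+ 2) by apply: L1Z; case: m2.
  have q2 : L1 (fun w => eta k.+1 w ^+ 2) by case: e2.
  have q3 := L1D q1 q2; have q4 := L1Z 4 c1.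
  rewrite ExZ; last exact: L1D.
  rewrite ExD// ExD// !ExZ//; last by case: m2.
  by rewrite c2 m4 e4 mulr0 addr0.
Qed.

Lemma mD_main_terms (c : R) k : mD (past k) (fun w => \sum_(i < k) c * main_term i w).
Proof.
have mcst D x : mD D (fun=> x : R) by exact: (@mD_cst _ _ _ _ _ _ _ Y _ _ R x).
elim: k => [|k ih].
  have -> : (fun w => \sum_(i < 0) c * main_term i w) = fun=> 0 by apply/funext => w; rewrite big_ord0.
  exact: mcst.
have -> : (fun w => \sum_(i < k.+1) c * main_term i w) = fun w => \sum_(i < k) c * main_term i w + c * main_term k w.
  by apply/funext => w; rewrite big_ord_recr.
apply: mDD; first by apply: mD_sub ih; exact: past_sub.
apply: mDM => //; have [h _ _ _] := main_term_facts k.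
by apply: mD_sub h; exact: generation_past.
Qed.

(** Since [mfloor] is deterministic, [main_term k] depends on generation [k.+1] only. *)
Lemma main_terms_indep (c : R) k : indep P (fun w => \sum_(i < k) c * main_term i w) (fun w => c * main_term k w).
Proof.
have [h _ _ _] := main_term_facts k.
apply: (mD_indep iY (@past_pos k) (@generation_pos k) (@past_generation k)) => //; first exact: mD_main_terms.
by apply: mDM => //; exact: (@mD_cst _ _ _ _ _ _ _ Y _ _ R c).
Qed.

Lemma tail_scale (s t c x : R) : 0 <= c -> c * t <= s -> tail s (c * x) <= c ^+ 2 * tail t x.
Proof.
move=> c0 cts; rewrite {1}/tail; case: ltP => h; rewrite ?mul0r ?mul1r; last first.
  by rewrite mulr_ge0 ?sqr_ge0 ?tail_ge0.
have : c * t < c * `|x| by move: h; rewrite normrM (ger0_norm c0); exact: le_lt_trans.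
rewrite /tail; have [xt|tx] := leP `|x| t; last by rewrite mul1r exprMn.
by rewrite ltNge ler_wpM2l.
Qed.

(** Each summand is split by [tail_add] into its cross sum and its immigration part. The first is
    controlled by [cross_sum_tail] with at most [Amean n] individuals; for the second, rescaling
    turns the level [e / 2] into the level [t] for [eta], with the same [t] for all [k] because
    [Amean] is monotone. *)
Lemma main_term_tails (rho : R) : 0 < rho -> exists2 C, 0 <= C &
  forall n c e t, 0 <= c -> 0 < e -> 0 <= t -> c * Amean n * t <= e / 2 ->
  \sum_(k < n) Ex (fun w => tail e (c * main_term k w)) <=
    n%:R * (rho * (c * Amean n ^+ 2) ^+ 2 + C * (c * Amean n ^+ 2) ^+ 3 / e) +
    4 * (c * Amean n) ^+ 2 * \sum_(k < n) Ex (fun w => tail t (eta k.+1 w)).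
Proof.
(* 16 is the factor 4 of [tail_add] times the square of the coefficient 2 of the cross sum. *)
move=> rho0; have [|C C0 hC] := @cross_sum_tail _ _ _ _ X xi iY X_distr cx (rho / 16) _ Hcx Hcx0.
  by rewrite divr_gt0.
exists (64 * C); first by rewrite mulr_ge0.
move=> n c e t c0 e0 t0 cAt.
have e20 : 0 < e / 2 by rewrite divr_gt0.
rewrite mulr_natl -[X in _ <= _ *+ X + _](card_ord n) -sumr_const mulr_sumr -big_split /=.
apply: ler_sum => k _.
have Ak0 := Amean_ge0 k; have Akn : Amean k <= Amean n by apply: Amean_le; exact: ltnW.
have [_ l2 _ _] := cross_sum_facts k (mfloor k).
have [_ e2 _ _] := eta_facts k.
set c1 := c * Amean k.
have c10 : 0 <= c1 by rewrite mulr_ge0.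
have c1n : c1 <= c * Amean n by rewrite ler_wpM2l.
have rE w : c * main_term k w = c1 * 2 * cross_sum X cx cx k.+1 (mfloor k) w + c1 * eta k.+1 w.
  by rewrite /main_term /c1; ring.
have Ll := L2Z (c1 * 2) l2; have Le := L2Z c1 e2.
apply: (@le_trans _ _ (4 * Ex (fun w => tail (e / 2) (c1 * 2 * cross_sum X cx cx k.+1 (mfloor k) w)) +
   4 * Ex (fun w => tail (e / 2) (c1 * eta k.+1 w)))).
  have t1 := L1_tail (e / 2) Ll; have t2 := L1_tail (e / 2) Le.
  rewrite -!ExZ// -ExD; [|exact: L1Z|exact: L1Z].
  apply: Ex_le; [|by apply: L1D; exact: L1Z|].
    by apply: L1_tail; apply: L2Z; have [] := main_term_facts k.
  by move=> w; rewrite rE; exact: tail_add.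
apply: lerD.
  have := ler_wpM2l (ler0n R 4) (hC k.+1 (mfloor k) (c1 * 2) _ (ltn0Sn k) e20).
  move=> /le_trans; apply.
  have m0 : 0 <= (mfloor k)%:R :> R by [].
  have mA : (mfloor k)%:R <= Amean n.
    by have /andP[h _] := mfloor_itv k; exact: le_trans h Akn.
  have cm : c1 * (mfloor k)%:R <= c * Amean n ^+ 2.
    by rewrite expr2 mulrA ler_pM.
  have cm0 : 0 <= c1 * (mfloor k)%:R by rewrite mulr_ge0.
  have cm2 : (c1 * (mfloor k)%:R) ^+ 2 <= (c * Amean n ^+ 2) ^+ 2.
    by rewrite lerXn2r ?nnegrE// (le_trans cm0).
  have cm3 : (c1 * (mfloor k)%:R) ^+ 3 <= (c * Amean n ^+ 2) ^+ 3.
    by rewrite lerXn2r ?nnegrE// (le_trans cm0).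
  rewrite ger0_norm ?mulr_ge0//.
  have -> : 4 * (rho / 16 * (c1 * 2) ^+ 2 * (mfloor k)%:R ^+ 2 + C * (c1 * 2) ^+ 3 * (mfloor k)%:R ^+ 3 / (e / 2)) =
    rho * (c1 * (mfloor k)%:R) ^+ 2 + 64 * C / e * (c1 * (mfloor k)%:R) ^+ 3.
    by field; rewrite gt_eqF.
  have -> : 64 * C * (c * Amean n ^+ 2) ^+ 3 / e = 64 * C / e * (c * Amean n ^+ 2) ^+ 3 by ring.
  apply: lerD; first by rewrite ler_wpM2l// ltW.
  by rewrite ler_wpM2l// divr_ge0 ?mulr_ge0// ltW.
rewrite -mulrA ler_wpM2l//.
apply: (@le_trans _ _ (c1 ^+ 2 * Ex (fun w => tail t (eta k.+1 w)))).
  rewrite -ExZ; last exact: L1_tail.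
  apply: Ex_le; [exact: L1_tail|by apply: L1Z; exact: L1_tail|] => w.
  by apply: tail_scale => //; apply: le_trans cAt; rewrite ler_wpM2r.
rewrite ler_wpM2r//; first by apply: Ex_ge0 => w; exact: tail_ge0.
by rewrite lerXn2r ?nnegrE// (le_trans c10).
Qed.

End process.

(** * Asymptotics of the deterministic sequences *)

Section sequence_limits.
Variable R : realType.
Implicit Types (f g : nat -> R) (l : R).

Lemma near_seq_cvg f g l : (\forall n \near \oo, f n = g n) ->
  f n @[n --> \oo] --> l -> g n @[n --> \oo] --> l.
Proof. by move=> fg; apply: cvg_trans; apply: near_eq_cvg. Qed.

Lemma seqM f g l l' : f n @[n --> \oo] --> l -> g n @[n --> \oo] --> l' ->
  f n * g n @[n --> \oo] --> l * l'.
Proof. by move=> h h'; exact: cvgM. Qed.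

Lemma seqD f g l l' : f n @[n --> \oo] --> l -> g n @[n --> \oo] --> l' ->
  f n + g n @[n --> \oo] --> l + l'.
Proof. by move=> h h'; exact: cvgD. Qed.

Lemma seqC l : (l : R) @[n --> \oo] --> l.
Proof. exact: cvg_cst. Qed.

Lemma seqZ (c : R) f l : f n @[n --> \oo] --> l -> c * f n @[n --> \oo] --> c * l.
Proof. by move=> h; exact: cvgMr. Qed.

Lemma seqV f l : l != 0 -> f n @[n --> \oo] --> l -> (f n)^-1 @[n --> \oo] --> l^-1.
Proof. by move=> h h'; exact: cvgV. Qed.

Lemma seqX f l k : f n @[n --> \oo] --> l -> f n ^+ k @[n --> \oo] --> l ^+ k.
Proof. by move=> h; exact: (cvg_comp _ _ h (@exprn_continuous _ k l)). Qed.

Lemma seq_squeeze0 f g : (\forall n \near \oo, 0 <= f n <= g n) ->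
  g n @[n --> \oo] --> (0 : R) -> f n @[n --> \oo] --> (0 : R).
Proof. by move=> fg h; apply: (squeeze_cvgr fg) h; exact: cvg_cst. Qed.

Lemma sum_cst (x : R) n : \sum_(0 <= k < n) x = n%:R * x.
Proof. by rewrite sumr_const_nat subn0 mulr_natl. Qed.

Lemma natr_cvg : (n%:R : R) @[n --> \oo] --> +oo.
Proof.
apply/cvgryPge => M; near=> n.
apply: (le_trans (ltW (truncnS_gt M))); rewrite ler_nat; near: n; exact: nbhs_infty_ge.
Unshelve. all: by end_near.
Qed.

Lemma nat_pos : \forall n \near \oo, 0 < n%:R :> R.
Proof. by exists 1%N => //= n; rewrite ltr0n. Qed.

End sequence_limits.

(** * Growth rates of means and variances *)

Section rates.
Variable R : realType.
Variables (a b g : nat -> R) (alpha beta gamma b2 kap theta : R).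
Notation pairs := (pair_count R).
Hypothesis a_ge0 : forall k, 0 <= a k.
Hypothesis b_ge0 : forall k, 0 <= b k.
Hypothesis g_ge0 : forall k, 0 <= g k.
Hypothesis b2_ge0 : 0 <= b2.
Hypothesis kap_ge0 : 0 <= kap.
Hypothesis alpha_ge0 : 0 <= alpha.
Hypothesis beta_ge0 : 0 <= beta.
Hypothesis gamma_ge0 : 0 <= gamma.
Hypothesis ha : rvs alpha a.
Hypothesis hb : rvs beta b.
Hypothesis hg : rvs gamma g.
Hypothesis a_infty : a n @[n --> \oo] --> +oo.
Hypothesis b_small : b n / (n%:R * a n) @[n --> \oo] --> (0 : R) \/
  (b n / (n%:R * a n ^+ 2) @[n --> \oo] --> (0 : R) /\
   n%:R * a n * b n / g n @[n --> \oo] --> (0 : R)).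
Notation A := (Amean a).
Notation v := (vbound a b b2).
Notation m := (mfloor a).
Definition partial_sum f n : R := \sum_(1 <= k < n.+1) f k.
Notation G := (partial_sum g).
Notation Bt := (partial_sum b).
(** The order of the variance of the sum of independent terms: [n%:R * A n ^+ 4] from the offspring
    and [A n ^+ 2 * G n] from the immigration. *)
Definition norm2 n : R := n%:R * A n ^+ 4 + A n ^+ 2 * G n.
Let theta_n n := n%:R * A n ^+ 2 / (n%:R * A n ^+ 2 + G n).
Hypothesis theta_cvg : theta_n n @[n --> \oo] --> theta.

Lemma rvs_Amean : rvs (alpha + 1) A.
Proof. exact: rvs_sum. Qed.

Lemma Amean_pos : \forall n \near \oo, 0 < A n.
Proof. by case: rvs_Amean. Qed.

Lemma Amean_cvg : A n @[n --> \oo] --> +oo.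
Proof.
apply/cvgryPge => M; near=> n.
apply: (@le_trans _ _ (a n)).
  by near: n; move/cvgryPge: a_infty; exact.
have n0 : (0 < n)%N by near: n; exact: nbhs_infty_gt.
by rewrite /Amean big_nat_recr//= lerDr sumr_ge0.
Unshelve. all: by end_near.
Qed.

Lemma Amean_inv : (A n)^-1 @[n --> \oo] --> (0 : R).
Proof. by apply/gtr0_cvgV0; [exact: Amean_pos|exact: Amean_cvg]. Qed.

Lemma rvs_shift rho (f : nat -> R) : rvs rho f -> rvs rho (fun n => f n.-1).
Proof. by move=> hf; exact: (rvs_equiv ltr01 hf (rvs_pred hf)). Qed.

Lemma rvs_expn rho (f : nat -> R) k : rvs rho f -> rvs (k.+1%:R * rho) (fun n => f n ^+ k.+1).
Proof.
move=> hf; elim: k => [|k ih]; first by rewrite mul1r.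
rewrite -natr1 mulrDl mul1r; have := rvs_mul ih hf.
by congr rvs; apply/funext => n; rewrite -exprSr.
Qed.

Lemma sum_shift (F : nat -> R) n : \sum_(0 <= k < n) F k = \sum_(1 <= k < n.+1) F k.-1.
Proof. by rewrite big_add1. Qed.

Lemma pred_ratio rho (f : nat -> R) k : rvs rho f -> f n.-1 ^+ k / f n ^+ k @[n --> \oo] --> (1 : R).
Proof.
move=> hf; have := @seqX _ _ _ k (rvs_pred hf).
rewrite expr1n; apply: near_seq_cvg; apply: nearW => n /=.
by rewrite exprMn exprVn.
Qed.

(** The indices of regular variation add up, so this is Karamata's theorem for the product;
    replacing [A n.-1] by [A n] in its normalisation is harmless. *)
Lemma weighted_sum rho (f : nat -> R) j : 0 <= rho -> (forall k, 0 <= f k) -> rvs rho f ->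
  (\sum_(1 <= k < n.+1) A k.-1 ^+ j.+1 * f k) / (A n ^+ j.+1 * (n%:R * f n))
     @[n --> \oo] --> (j.+1%:R * (alpha + 1) + rho + 1)^-1.
Proof.
move=> rho0 f0 hf.
have hA := rvs_expn j (rvs_shift rvs_Amean).
have hw := rvs_mul hA hf.
have A0 k : 0 <= A k by exact: sumr_ge0.
have := karamata _ _ hw.
rewrite addr_ge0 ?mulr_ge0 ?addr_ge0// => /(_ isT) /(_ (fun k => mulr_ge0 (exprn_ge0 _ (A0 _)) (f0 _))).
move=> h; rewrite -[X in _ --> X]mulr1.
apply: near_seq_cvg (seqM h (pred_ratio j.+1 rvs_Amean)); near=> n.
have An1 : 0 < A n.-1.
  near: n; case: Amean_pos => N _ hN; exists N.+1 => // k /= Nk.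
  by apply: hN => /=; rewrite -ltnS prednK// (leq_ltn_trans _ Nk).
have An : 0 < A n by near: n; exact: Amean_pos.
have fn : 0 < f n by near: n; case: hf.
have n0 : 0 < n%:R :> R by near: n; exact: nat_pos.
move: (\sum_(_ <= _ < _) _) => S.
by field; rewrite !expf_neq0 ?gt_eqF.
Unshelve. all: by end_near.
Qed.

Lemma rvs_cst : rvs 0 (fun=> 1 : R).
Proof.
split; first exact: nearW.
move=> eta eta0; exists 1%N => k n k1 kn.
rewrite subrr sub0r mul0r oppr0 normr0 mulr_ge0 ?ltW//.
by rewrite ltr_wpDr// subr_ge0 ln_nat_le.
Qed.

Lemma Amean_pow_sum j : (\sum_(0 <= k < n) A k ^+ j.+1) / (n%:R * A n ^+ j.+1)
  @[n --> \oo] --> (j.+1%:R * (alpha + 1) + 1)^-1.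
Proof.
have := @weighted_sum 0 (fun=> 1) j (lexx 0) (fun=> ler01) rvs_cst.
rewrite addr0; apply: near_seq_cvg; near=> n.
rewrite sum_shift mulr1 [X in X^-1]mulrC; congr (_ / _).
by apply: eq_bigr => k _; rewrite mulr1.
Unshelve. all: by end_near.
Qed.

Lemma Amean_asym : A n / (n%:R * a n) @[n --> \oo] --> (alpha + 1)^-1.
Proof. exact: karamata. Qed.

Lemma G_asym : G n / (n%:R * g n) @[n --> \oo] --> (gamma + 1)^-1.
Proof. exact: karamata. Qed.

Lemma Bt_asym : Bt n / (n%:R * b n) @[n --> \oo] --> (beta + 1)^-1.
Proof. exact: karamata. Qed.

Lemma G_pos : \forall n \near \oo, 0 < G n.
Proof. by have [] := rvs_sum gamma_ge0 g_ge0 hg. Qed.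

Lemma norm2_pos : \forall n \near \oo, 0 < norm2 n.
Proof.
near=> n.
have An : 0 < A n by near: n; exact: Amean_pos.
have Gn : 0 < G n by near: n; exact: G_pos.
by rewrite /norm2 ltr_wpDl ?mulr_gt0 ?exprn_gt0// mulr_ge0// exprn_ge0// ltW.
Unshelve. all: by end_near.
Qed.

Lemma theta_normE : \forall n \near \oo, n%:R * A n ^+ 4 / norm2 n = theta_n n /\
  A n ^+ 2 * G n / norm2 n = 1 - theta_n n.
Proof.
near=> n.
have An : 0 < A n by near: n; exact: Amean_pos.
have Gn : 0 < G n by near: n; exact: G_pos.
have n0 : 0 < n%:R :> R by near: n; exact: nat_pos.
have D0 : 0 < n%:R * A n ^+ 2 + G n by rewrite ltr_wpDl// mulr_ge0 ?sqr_ge0.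
have -> : norm2 n = A n ^+ 2 * (n%:R * A n ^+ 2 + G n) by rewrite /norm2; ring.
by rewrite /theta_n; split; field; rewrite !gt_eqF.
Unshelve. all: by end_near.
Qed.

Lemma weighted_G : (\sum_(1 <= k < n.+1) A k.-1 ^+ 2 * g k) / (A n ^+ 2 * G n)
  @[n --> \oo] --> (gamma + 1) / (2 * alpha + 3 + gamma).
Proof.
have h1 := @weighted_sum gamma g 1 gamma_ge0 g_ge0 hg.
have G1 : (gamma + 1)^-1 != 0 by rewrite invr_eq0 gt_eqF// ltr_wpDl.
have h2 := seqM h1 (seqV G1 G_asym).
have -> : (gamma + 1) / (2 * alpha + 3 + gamma) =
    (2 * (alpha + 1) + gamma + 1)^-1 * (gamma + 1)^-1^-1.
  by rewrite invrK mulrC; congr (_^-1 * _); ring.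
apply: near_seq_cvg h2; near=> n.
have An : 0 < A n by near: n; exact: Amean_pos.
have gn : 0 < g n by near: n; case: hg.
have Gn : 0 < G n by near: n; exact: G_pos.
have n0 : 0 < n%:R :> R by near: n; exact: nat_pos.
move: (\sum_(_ <= _ < _) _) => S.
by rewrite /=; field; rewrite !gt_eqF.
Unshelve. all: by end_near.
Qed.

Lemma ratio_cvg0_Amean : n%:R * a n / A n @[n --> \oo] --> alpha + 1.
Proof.
have a1 : (alpha + 1)^-1 != 0 by rewrite invr_eq0 gt_eqF// ltr_wpDl.
have := seqV a1 Amean_asym; rewrite invrK; apply: near_seq_cvg; apply: nearW => n.
by rewrite invf_div.
Qed.

Lemma Bt_ge0 n : 0 <= Bt n. Proof. exact: sumr_ge0. Qed.
Lemma G_ge0 n : 0 <= G n. Proof. exact: sumr_ge0. Qed.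
Lemma A_ge0 n : 0 <= A n. Proof. exact: sumr_ge0. Qed.

Lemma b_small_weak : b n / (n%:R * a n ^+ 2) @[n --> \oo] --> (0 : R).
Proof.
case: b_small => [h|[]//].
have ai : (a n)^-1 @[n --> \oo] --> (0 : R) by apply/gtr0_cvgV0 => //; case: ha.
have := seqM h ai; rewrite mulr0; apply: near_seq_cvg; apply: nearW => n.
by rewrite -mulrA -invfM expr2 mulrA.
Qed.

(** By Karamata's theorem [Bt n] is of order [n * b n] and [A n] of order [n * a n], so the quotient
    is of order [b n / (n * a n ^+ 2)]. *)
Lemma Bt_small : Bt n / A n ^+ 2 @[n --> \oo] --> (0 : R).
Proof.
have := seqM (seqM Bt_asym b_small_weak) (@seqX _ _ _ 2 ratio_cvg0_Amean).
rewrite mulr0 mul0r; apply: near_seq_cvg; near=> n.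
have An : 0 < A n by near: n; exact: Amean_pos.
have an : 0 < a n by near: n; case: ha.
have bn : 0 < b n by near: n; case: hb.
have n0 : 0 < n%:R :> R by near: n; exact: nat_pos.
by field; rewrite !gt_eqF.
Unshelve. all: by end_near.
Qed.

Lemma n_over_A : n%:R / A n @[n --> \oo] --> (0 : R).
Proof.
have ai : (a n)^-1 @[n --> \oo] --> (0 : R) by apply/gtr0_cvgV0 => //; case: ha.
have := seqM ratio_cvg0_Amean ai.
rewrite mulr0; apply: near_seq_cvg; near=> n.
have an : 0 < a n by near: n; case: ha.
have An : 0 < A n by near: n; exact: Amean_pos.
by field; rewrite !gt_eqF.
Unshelve. all: by end_near.
Qed.

Lemma Amean_mono j k : (j <= k)%N -> A j <= A k.
Proof.
move=> jk; rewrite /Amean (@big_cat_nat _ _ _ j.+1 1 k.+1) //= lerDl; exact: sumr_ge0.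
Qed.

Lemma BtE n : \sum_(0 <= k < n) b k.+1 = Bt n.
Proof. by rewrite /partial_sum big_add1. Qed.

Lemma v_le n : v n <= b2 * (n%:R * A n) + Bt n.
Proof.
rewrite /vbound big_split /= BtE lerD2r -mulr_sumr ler_wpM2l//.
apply: (@le_trans _ _ (\sum_(0 <= k < n) A n)).
  by apply: ler_sum_nat => k /andP[_ kn]; apply: Amean_mono; exact: ltnW.
by rewrite sum_cst.
Qed.

Lemma v_ge0 n : 0 <= v n.
Proof. by apply: sumr_ge0 => k _; rewrite addr_ge0// mulr_ge0// A_ge0. Qed.

(** Together with Kolmogorov's inequality this confines the process to within [del * A n] of its
    mean, for every fixed [del], with probability tending to 1. *)
Lemma v_small : v n / A n ^+ 2 @[n --> \oo] --> (0 : R).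
Proof.
have h := seqD (@seqZ _ b2 _ _ n_over_A) Bt_small; rewrite mulr0 add0r in h.
apply: seq_squeeze0 h; near=> n.
have An : 0 < A n by near: n; exact: Amean_pos.
rewrite divr_ge0 ?v_ge0 ?sqr_ge0//= ler_pdivrMr ?exprn_gt0//.
apply: (le_trans (v_le n)); rewrite le_eqVlt; apply/orP; left; apply/eqP.
by field; rewrite gt_eqF.
Unshelve. all: by end_near.
Qed.

(** The numerator is the order of the variance of the products of offspring and immigration
    fluctuations. The first alternative compares it with the offspring part of [norm2], the second
    with the immigration part. *)
Lemma cross_small : A n ^+ 3 * Bt n / norm2 n @[n --> \oo] --> (0 : R).
Proof.
case: b_small => [h|[_ h]].
- have := seqM (seqM Bt_asym h) ratio_cvg0_Amean.
  rewrite mulr0 mul0r; apply: seq_squeeze0; near=> n.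
  have An : 0 < A n by near: n; exact: Amean_pos.
  have an : 0 < a n by near: n; case: ha.
  have bn : 0 < b n by near: n; case: hb.
  have n0 : 0 < n%:R :> R by near: n; exact: nat_pos.
  have N0 : 0 < norm2 n by near: n; exact: norm2_pos.
  rewrite divr_ge0 ?mulr_ge0 ?exprn_ge0 ?Bt_ge0 ?(ltW An) ?(ltW N0)//=.
  have -> : Bt n / (n%:R * b n) * (b n / (n%:R * a n)) * (n%:R * a n / A n) =
    A n ^+ 3 * Bt n / (n%:R * A n ^+ 4) by field; rewrite !gt_eqF.
  rewrite ler_wpM2l ?mulr_ge0 ?exprn_ge0 ?Bt_ge0 ?(ltW An)//.
  rewrite lef_pV2 ?posrE ?mulr_gt0 ?exprn_gt0//.
  by rewrite /norm2 lerDl mulr_ge0 ?sqr_ge0 ?G_ge0.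
- have G1 : (gamma + 1)^-1 != 0 by rewrite invr_eq0 gt_eqF// ltr_wpDl.
  have := seqM (seqM (seqM Bt_asym h) Amean_asym) (seqV G1 G_asym).
  rewrite mulr0 !mul0r; apply: seq_squeeze0; near=> n.
  have An : 0 < A n by near: n; exact: Amean_pos.
  have an : 0 < a n by near: n; case: ha.
  have bn : 0 < b n by near: n; case: hb.
  have gn : 0 < g n by near: n; case: hg.
  have Gn : 0 < G n by near: n; exact: G_pos.
  have n0 : 0 < n%:R :> R by near: n; exact: nat_pos.
  have N0 : 0 < norm2 n by near: n; exact: norm2_pos.
  rewrite divr_ge0 ?mulr_ge0 ?exprn_ge0 ?Bt_ge0 ?(ltW An) ?(ltW N0)//=.
  have -> : Bt n / (n%:R * b n) * (n%:R * a n * b n / g n) * (A n / (n%:R * a n)) / (G n / (n%:R * g n)) =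
    A n ^+ 3 * Bt n / (A n ^+ 2 * G n) by field; rewrite !gt_eqF.
  rewrite ler_wpM2l ?mulr_ge0 ?exprn_ge0 ?Bt_ge0 ?(ltW An)//.
  rewrite lef_pV2 ?posrE ?mulr_gt0 ?exprn_gt0//.
  by rewrite /norm2 lerDr mulr_ge0 ?exprn_ge0// A_ge0.
Unshelve. all: by end_near.
Qed.

Lemma comp_bound_sum del mu n : 0 < mu ->
  \sum_(0 <= k < n) comp_bound a b g b2 kap del mu k <=
  8 * del ^+ 2 * (n%:R * (2 * b2 ^+ 2 * (A n ^+ 2 + v n) + kap * A n) + 4 * b2 * A n * Bt n + G n) +
  6 * A n ^+ 2 * (n%:R * (2 * b2 ^+ 2 * ((2 + mu^-1) * v n + mu * A n ^+ 2 + 2 * A n + 4) + kap * A n)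
    + 4 * b2 * A n * Bt n).
Proof.
move=> mu0; have mi : 0 <= mu^-1 by rewrite invr_ge0 ltW.
have vle k : (k <= n)%N -> v k <= v n.
  move=> kn; rewrite /vbound (@big_cat_nat _ _ _ k 0 n) //= lerDl; apply: sumr_ge0 => j _.
  by rewrite addr_ge0// mulr_ge0// A_ge0.
pose U := 2 * b2 ^+ 2 * (A n ^+ 2 + v n) + kap * A n.
pose V := 2 * b2 ^+ 2 * ((2 + mu^-1) * v n + mu * A n ^+ 2 + 2 * A n + 4) + kap * A n.
apply: (@le_trans _ _ (\sum_(0 <= k < n) (8 * del ^+ 2 * (U + 4 * b2 * A n * b k.+1 + g k.+1) +
   6 * A n ^+ 2 * (V + 4 * b2 * A n * b k.+1)))).
  apply: ler_sum_nat => k /andP[_ kn].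
  have Ak0 := A_ge0 k; have Akn := Amean_mono (ltnW kn); have vk := vle _ (ltnW kn).
  have v0 := v_ge0 k.
  have An0 := A_ge0 n.
  have A2 : A k ^+ 2 <= A n ^+ 2 by rewrite lerXn2r ?nnegrE.
  have bA : 4 * b2 * A k * b k.+1 <= 4 * b2 * A n * b k.+1.
    by rewrite ler_wpM2r// ler_wpM2l// mulr_ge0.
  have kA : kap * A k <= kap * A n by rewrite ler_wpM2l.
  have b22 : 0 <= 2 * b2 ^+ 2 by rewrite mulr_ge0 ?sqr_ge0.
  rewrite /comp_bound; apply: lerD.
    apply: ler_wpM2l; first by rewrite mulr_ge0 ?sqr_ge0.
    by rewrite lerD2r lerD// lerD// ler_wpM2l// lerD.
  apply: ler_pM; last 2 first.
  - by rewrite ler_wpM2l.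
  - rewrite lerD// lerD// ler_wpM2l// lerD2r lerD//; last by rewrite ler_wpM2l.
    by rewrite lerD// ler_wpM2l// ?(ltW mu0)// addr_ge0.
  - by rewrite mulr_ge0 ?sqr_ge0.
  - by rewrite ?(sqr_ge0, addr_ge0, mulr_ge0, ltW mu0).
rewrite -/U -/V; clearbody U V.
rewrite big_split /= -!mulr_sumr !big_split /= -!mulr_sumr BtE.
have -> : \sum_(0 <= k < n) g k.+1 = G n by rewrite /partial_sum big_add1.
by rewrite !sum_cst.
Qed.

(** The normalised variance of the truncated comparison error, for truncation
    level [del] times the mean. *)
Lemma comp_bound_limit del mu : 0 < mu -> 0 < del ->
  \forall n \near \oo,
   (\sum_(0 <= k < n) comp_bound a b g b2 kap (del * A n) mu k) / norm2 n <=
   8 * del ^+ 2 * (2 * b2 ^+ 2 + 2) + 12 * b2 ^+ 2 * mu + mu.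
Proof.
move=> mu0 del0; have mi : 0 <= mu^-1 by rewrite invr_ge0 ltW.
pose q n := 4 * b2 * (A n ^+ 3 * Bt n / norm2 n).
have hq : q n @[n --> \oo] --> (0 : R).
  by have := @seqZ _ (4 * b2) _ _ cross_small; rewrite mulr0.
(* Collects the contributions that vanish. What remains is of order [del ^+ 2] and [mu], because the
   two parts of [norm2] have shares at most 1. *)
pose err n := 8 * del ^+ 2 * (2 * b2 ^+ 2 * (v n / A n ^+ 2) + kap * (A n)^-1 + q n) +
  6 * (2 * b2 ^+ 2 * ((2 + mu^-1) * (v n / A n ^+ 2) + (2 * (A n)^-1 + 4 * (A n)^-1 ^+ 2)) + kap * (A n)^-1 + q n).
have he : err n @[n --> \oo] --> (0 : R).
  have zero c (f : nat -> R) : f n @[n --> \oo] --> (0 : R) -> c * f n @[n --> \oo] --> (0 : R).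
    by move=> h; have := @seqZ _ c _ _ h; rewrite mulr0.
  have plus (f h : nat -> R) : f n @[n --> \oo] --> (0 : R) -> h n @[n --> \oo] --> (0 : R) ->
      f n + h n @[n --> \oo] --> (0 : R).
    by move=> h1 h2; have := seqD h1 h2; rewrite addr0.
  have i2 : (A n)^-1 ^+ 2 @[n --> \oo] --> (0 : R).
    by have := @seqX _ _ _ 2 Amean_inv; rewrite expr0n.
  apply: (plus); apply: (zero).
    by apply: (plus) => //; apply: (plus); apply: (zero); [exact: v_small|exact: Amean_inv].
  apply: (plus) => //; apply: (plus); apply: (zero); last exact: Amean_inv.
  by apply: (plus); [apply: (zero); exact: v_small|apply: (plus); apply: (zero) => //; exact: Amean_inv].
near=> n.
have An : 0 < A n by near: n; exact: Amean_pos.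
have Gn : 0 < G n by near: n; exact: G_pos.
have n0 : 0 < n%:R :> R by near: n; exact: nat_pos.
have N0 : 0 < norm2 n by near: n; exact: norm2_pos.
have errn : err n <= mu by apply: ltW; near: n; exact: (cvgr_lt 0).
have th1 : n%:R * A n ^+ 4 / norm2 n <= 1.
  by rewrite ler_pdivrMr// mul1r /norm2 lerDl mulr_ge0 ?sqr_ge0 ?G_ge0.
have th2 : A n ^+ 2 * G n / norm2 n <= 1.
  by rewrite ler_pdivrMr// mul1r /norm2 lerDr mulr_ge0 ?exprn_ge0// A_ge0.
set t1 := n%:R * A n ^+ 4 / norm2 n in th1; set t2 := A n ^+ 2 * G n / norm2 n in th2.
have t10 : 0 <= t1 by rewrite divr_ge0 ?mulr_ge0 ?exprn_ge0 ?A_ge0 ?(ltW N0).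
have v0 : 0 <= v n / A n ^+ 2 by rewrite divr_ge0 ?v_ge0 ?sqr_ge0.
have Ai : 0 <= (A n)^-1 by rewrite invr_ge0 ltW.
apply: (@le_trans _ _ (8 * del ^+ 2 * (t1 * (2 * b2 ^+ 2 * (1 + v n / A n ^+ 2) + kap * (A n)^-1) + q n + t2) +
  6 * (t1 * (2 * b2 ^+ 2 * ((2 + mu^-1) * (v n / A n ^+ 2) + mu + (2 * (A n)^-1 + 4 * (A n)^-1 ^+ 2)) + kap * (A n)^-1) + q n))).
  rewrite ler_pdivrMr//; apply: (le_trans (comp_bound_sum (del * A n) n mu0)).
  rewrite le_eqVlt; apply/orP; left; apply/eqP; rewrite /q /t1 /t2; field.
  by rewrite !gt_eqF.
have b20 : 0 <= 2 * b2 ^+ 2 by rewrite mulr_ge0 ?sqr_ge0.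
set X := 2 * b2 ^+ 2 * (1 + v n / A n ^+ 2) + kap * (A n)^-1.
set W := 2 * b2 ^+ 2 * ((2 + mu^-1) * (v n / A n ^+ 2) + mu + (2 * (A n)^-1 + 4 * (A n)^-1 ^+ 2)) + kap * (A n)^-1.
have X0 : 0 <= X by rewrite /X ?(v0, Ai, sqr_ge0, addr_ge0, mulr_ge0).
have W0 : 0 <= W by rewrite /W ?(v0, Ai, mi, sqr_ge0, addr_ge0, mulr_ge0, ltW mu0).
have tX : t1 * X <= X by rewrite ler_piMl.
have tW : t1 * W <= W by rewrite ler_piMl.
apply: (@le_trans _ _ (8 * del ^+ 2 * (X + q n + 1) + 6 * (W + q n))).
  apply: lerD.
    apply: ler_wpM2l; first by rewrite mulr_ge0 ?sqr_ge0.
    by rewrite lerD// lerD2r.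
  by rewrite ler_wpM2l// lerD2r.
have -> : 8 * del ^+ 2 * (X + q n + 1) + 6 * (W + q n) =
   8 * del ^+ 2 * (2 * b2 ^+ 2 + 1) + 12 * b2 ^+ 2 * mu + err n by rewrite /X /W /err; ring.
have := sqr_ge0 del; lra.
Unshelve. all: by end_near.
Qed.

(** Twice the number of pairs is [m * (m - 1)] with [m] the integer part of [A k], so the error is
    of the order of [A k], negligible against its square. *)
Lemma pairs_mfloor k : 0 <= A k ^+ 2 - 2 * pairs (m k) <= 3 * A k.
Proof.
have /andP[h1 h2] := mfloor_itv (a := a) (fun k _ => a_ge0 k) k.
have mm : (m k)%:R = 0 :> R \/ 1 <= (m k)%:R :> R.
  by case: (m k) => [|j]; [left|right; rewrite ler1n].
have A0 := A_ge0 k.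
have -> : 2 * pairs (m k) = (m k)%:R * ((m k)%:R - 1) by rewrite /pair_count; field.
move: (m k)%:R (A k) h1 h2 mm A0 => r x h1 h2 [r0|r1] x0; apply/andP; rewrite expr2.
  rewrite r0 in h1 h2 *.
  have : 0 <= x * (1 - x) by rewrite mulr_ge0// subr_ge0; lra.
  have := mulr_ge0 x0 x0; rewrite mul0r [x * (1 - x)]mulrBr mulr1; split; lra.
have p1 : 0 <= (x - r) * (x + r) by apply: mulr_ge0; lra.
have p2 : 0 <= (1 - (x - r)) * (x + r).
  by apply: mulr_ge0; lra.
rewrite !(mulrBl, mulrDr) in p1 p2; rewrite !mulrBr (mulrC r x) in p1 p2 *.
split; lra.
Qed.

(** [4 * alpha + 5] is [4 * (alpha + 1) + 1], from Karamata's theorem for the fourth powers of the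
    means. The ratio with [gamma] is the quotient of the Karamata constants for [A ^+ 2 * g] and for
    [g]. The error of [mfloor] is the vanishing sum [Se]. *)
Lemma variance_sum : let c := 2 * alpha + 3 in
  c ^+ 2 * (\sum_(0 <= k < n) A k ^+ 2 * (4 * (b2 ^+ 2 * pairs (m k)) + g k.+1)) / norm2 n
   @[n --> \oo] --> c ^+ 2 * (theta * (2 * b2 ^+ 2 / (4 * alpha + 5)) +
     (1 - theta) * ((gamma + 1) / (2 * alpha + 3 + gamma))).
Proof.
move=> c.
pose S4 n := \sum_(0 <= k < n) A k ^+ 4.
pose Sg n := \sum_(1 <= k < n.+1) A k.-1 ^+ 2 * g k.
pose Se n := \sum_(0 <= k < n) A k ^+ 2 * (A k ^+ 2 - 2 * pairs (m k)).
have hS4 : S4 n / (n%:R * A n ^+ 4) @[n --> \oo] --> (4 * alpha + 5)^-1.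
  have -> : (4 * alpha + 5)^-1 = (4 * (alpha + 1) + 1)^-1 by congr (_^-1); ring.
  exact: (@Amean_pow_sum 3).
have hSg : Sg n / (A n ^+ 2 * G n) @[n --> \oo] --> (gamma + 1) / (2 * alpha + 3 + gamma) by exact: weighted_G.
have hSe : Se n / (n%:R * A n ^+ 4) @[n --> \oo] --> (0 : R).
  have := @seqZ _ 3 _ _ Amean_inv; rewrite mulr0; apply: seq_squeeze0; near=> n.
  have An : 0 < A n by near: n; exact: Amean_pos.
  have n0 : 0 < n%:R :> R by near: n; exact: nat_pos.
  apply/andP; split.
    rewrite divr_ge0 ?mulr_ge0 ?exprn_ge0 ?(ltW An)//; apply: sumr_ge0 => k _.
    by rewrite mulr_ge0 ?sqr_ge0//; have /andP[] := pairs_mfloor k.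
  rewrite ler_pdivrMr ?mulr_gt0 ?exprn_gt0//.
  have -> : 3 * (A n)^-1 * (n%:R * A n ^+ 4) = n%:R * (A n ^+ 2 * (3 * A n)) by field; rewrite gt_eqF.
  apply: (@le_trans _ _ (\sum_(0 <= k < n) A n ^+ 2 * (3 * A n))).
    apply: ler_sum_nat => k /andP[_ kn]; have Akn := Amean_mono (ltnW kn).
    have /andP[p1 p2] := pairs_mfloor k; apply: ler_pM; rewrite ?sqr_ge0//.
      by rewrite lerXn2r ?nnegrE ?A_ge0.
    by apply: (le_trans p2); rewrite ler_wpM2l.
  by rewrite sum_cst.
have lim := @seqZ _ (c ^+ 2) _ _ (seqD (seqM theta_cvg (@seqZ _ (2 * b2 ^+ 2) _ _ (seqD hS4 (@seqZ _ (-1) _ _ hSe))))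
  (seqM (seqD (@seqC R 1) (@seqZ _ (-1) _ _ theta_cvg)) hSg)).
have -> : c ^+ 2 * (theta * (2 * b2 ^+ 2 / (4 * alpha + 5)) + (1 - theta) * ((gamma + 1) / (2 * alpha + 3 + gamma))) =
  c ^+ 2 * (theta * (2 * b2 ^+ 2 * ((4 * alpha + 5)^-1 + -1 * 0)) + (1 + -1 * theta) * ((gamma + 1) / (2 * alpha + 3 + gamma))).
  by rewrite mulr0 addr0 mulN1r.
apply: near_seq_cvg lim; near=> n.
have An : 0 < A n by near: n; exact: Amean_pos.
have Gn : 0 < G n by near: n; exact: G_pos.
have n0 : 0 < n%:R :> R by near: n; exact: nat_pos.
have N0 : 0 < norm2 n by near: n; exact: norm2_pos.
have [t1 t2] : n%:R * A n ^+ 4 / norm2 n = theta_n n /\ A n ^+ 2 * G n / norm2 n = 1 - theta_n n.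
  by near: n; exact: theta_normE.
have -> : 1 + -1 * theta_n n = 1 - theta_n n by rewrite mulN1r.
rewrite -t2 -t1.
have -> : \sum_(0 <= k < n) A k ^+ 2 * (4 * (b2 ^+ 2 * pairs (m k)) + g k.+1) =
   2 * b2 ^+ 2 * (S4 n - Se n) + Sg n.
  have -> : Sg n = \sum_(0 <= k < n) A k ^+ 2 * g k.+1 by rewrite /Sg big_add1.
  rewrite /S4 /Se -sumrB mulr_sumr -big_split /=; apply: eq_bigr => k _; ring.
by field; rewrite !gt_eqF.
Unshelve. all: by end_near.
Qed.

Lemma denominator_limit : (\sum_(0 <= k < n) A k ^+ 2) / (n%:R * A n ^+ 2)
  @[n --> \oo] --> (2 * alpha + 3)^-1.
Proof.
have -> : (2 * alpha + 3)^-1 = (2 * (alpha + 1) + 1)^-1 by congr (_^-1); ring.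
exact: (@Amean_pow_sum 1).
Qed.

End rates.

(** * Weak convergence of the estimator *)

Section statistic.
Context d (T : measurableType d) (R : realType) (P : probability T R).
Variables (X : nat -> nat -> {RV P >-> nat}) (xi : nat -> {RV P >-> nat}).
Notation Y := (merged X xi).
Notation Ex := (Ex P).
Notation L1 := (L1 P).
Notation L2 := (L2 P).
Notation mD := (mD Y).
Notation pos := [set p : nat * nat | (0 < p.1)%N].
Notation Z := (Z X xi).
Variables (a bt : nat -> R) (b2 : R).

(** [b2_estimator] with the immigration mean and variance abstracted to [a] and [bt]. *)
Definition estimator n w : R :=
  (\sum_(1 <= k < n.+1)
     (((Z k w)%:R - (Z k.-1 w)%:R - a k) ^+ 2 - bt k) * (Z k.-1 w)%:R) /
  (\sum_(1 <= k < n.+1) (Z k.-1 w)%:R ^+ 2).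

Lemma measurable_Z k : measurable_fun setT (Z k).
Proof. exact: mD_measurable (@mD_Z _ _ _ _ X xi k). Qed.

Lemma measurable_ZR k : measurable_fun setT (fun w => (Z k w)%:R : R).
Proof. by apply: (measurableT_comp (f := fun y : nat => y%:R : R)) => //; exact: measurable_Z. Qed.

(** The denominator is taken in [nat], where its reciprocal, with value 0 at 0, is a function on a
    discrete space and so measurable. *)
Lemma measurable_denominator n : measurable_fun setT (fun w => (\sum_(1 <= k < n.+1) Z k.-1 w ^ 2)%N).
Proof.
suff : mD (past n) (fun w => (\sum_(1 <= k < n.+1) Z k.-1 w ^ 2)%N) by exact: mD_measurable.
elim: n => [|n ih].
  have -> : (fun w => \sum_(1 <= k < 1) Z k.-1 w ^ 2)%N = fun=> 0%N by apply/funext => w; rewrite big_geq.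
  exact: (@mD_cst _ _ _ _ _ _ _ Y _ _ nat 0%N).
have -> : (fun w => \sum_(1 <= k < n.+2) Z k.-1 w ^ 2)%N =
    fun w => (\sum_(1 <= k < n.+1) Z k.-1 w ^ 2 + Z n w ^ 2)%N.
  by apply/funext => w; rewrite big_nat_recr.
apply: mD_addn; first by apply: mD_sub ih; exact: past_sub.
apply: (mD_comp (measurable_nat (fun y => (y ^ 2)%N))).
by apply: mD_sub (@mD_Z _ _ _ _ X xi n); exact: past_sub.
Qed.

Lemma measurable_estimator n : measurable_fun setT (estimator n).
Proof.
have mZ := measurable_ZR.
rewrite /estimator; apply: measurable_funM.
  apply: measurable_sum => k; apply: measurable_funM => //.
  apply: measurable_funB => //; apply: measurable_funX; apply: measurable_funB => //.
  exact: measurable_funB.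
have -> : (fun w => (\sum_(1 <= k < n.+1) (Z k.-1 w)%:R ^+ 2)^-1) =
    (fun y : nat => (y%:R : R)^-1) \o (fun w => (\sum_(1 <= k < n.+1) Z k.-1 w ^ 2)%N).
  by apply/funext => w /=; rewrite natr_sum; congr (_^-1); apply: eq_bigr => k _; rewrite natrX.
by apply: (measurableT_comp (f := fun y : nat => (y%:R : R)^-1)) => //; exact: measurable_denominator.
Qed.

Lemma incrE k w : incr X xi a k (Z k w) w = (Z k.+1 w)%:R - (Z k w)%:R - a k.+1.
Proof.
have := Z_recr X xi a k w; rewrite AmeanS => h.
by apply: (addrI ((Z k w)%:R - Amean a k)); rewrite -h; ring.
Qed.

Lemma estimator_residual n w : let D := \sum_(0 <= k < n) (Z k w)%:R ^+ 2 in
  D != 0 -> estimator n w - b2 = residual X xi a bt b2 n w / D.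
Proof.
move=> D D0; rewrite /estimator [X in _ / X - _]big_add1 /= -/D.
rewrite -{1}(mulfK D0 b2) -mulrBl; congr (_ / _).
rewrite big_add1 /= /residual /D mulr_sumr -sumrB; apply: eq_bigr => k _.
rewrite -incr_sqr incrE -[in LHS]/(Z k.+1 w); ring.
Qed.

(** Deterministic core of the comparison between the normalised estimator and
    the sum of independent terms. *)
Lemma ratio_perturbation (N B c D Q S S0 del eta M : R) :
  0 < N -> 0 < B -> 0 < c -> 0 <= M -> 0 < del -> 0 <= eta -> 8 * c * del <= 1 ->
  `|D - S0| <= 3 * del * N -> `|S0 / N - c^-1| <= del ->
  `|Q - S| <= eta * B -> `|c * S| <= M * B ->
  D != 0 /\ `|N / B * (Q / D) - c / B * S| <= 2 * c * eta + 8 * c * del * M.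
Proof.
move=> N0 B0 c0 M0 d0 e0 cd h1 h2 h3 h4.
have Ni : 0 < N^-1 by rewrite invr_gt0.
have x1 : `|D / N - c^-1| <= 4 * del.
  have -> : D / N - c^-1 = (D - S0) / N + (S0 / N - c^-1) by ring.
  apply: (le_trans (ler_normD _ _)); have -> : 4 * del = 3 * del + del by ring.
  by apply: lerD => //; rewrite normrM (ger0_norm (ltW Ni)) ler_pdivrMr.
have ci : 0 < c^-1 by rewrite invr_gt0.
have dc : 4 * del <= c^-1 / 2.
  by rewrite ler_pdivlMr// -[c^-1]mul1r ler_pdivlMr//; lra.
have x2 : c^-1 / 2 <= D / N.
  by have := le_trans x1 dc; rewrite ler_norml => /andP[]; lra.
have x0 : 0 < D / N by apply: lt_le_trans x2; rewrite divr_gt0.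
have D0 : 0 < D by rewrite -(pmulr_lgt0 _ Ni).
split; first by rewrite gt_eqF.
set y := N / D.
have y0 : 0 < y by rewrite divr_gt0.
have y1 : y <= 2 * c.
  have -> : y = (D / N)^-1 by rewrite invf_div.
  have -> : 2 * c = (c^-1 / 2)^-1 by field; rewrite gt_eqF.
  by rewrite lef_pV2 ?posrE// divr_gt0.
have y2 : `|y - c| <= 8 * c * del * c.
  have -> : y - c = - (y * c * (D / N - c^-1)) by rewrite /y; field; rewrite !gt_eqF.
  rewrite normrN normrM (ger0_norm (ltW (mulr_gt0 y0 c0))).
  have -> : 8 * c * del * c = 2 * c * c * (4 * del) by ring.
  by apply: ler_pM => //; [rewrite mulr_ge0// ltW|rewrite ler_wpM2r// ltW].
(* The first summand carries the error of the numerator, the second that of the denominator. *)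
have -> : N / B * (Q / D) - c / B * S = y * ((Q - S) / B) + (y - c) / c * (c * S / B).
  by rewrite /y; field; rewrite !gt_eqF.
apply: (le_trans (ler_normD _ _)); apply: lerD; rewrite normrM.
  rewrite (ger0_norm (ltW y0)); apply: ler_pM => //; first exact: ltW.
  by rewrite normrM normfV (ger0_norm (ltW B0)) ler_pdivrMr.
apply: ler_pM => //; rewrite normrM normfV.
  by rewrite (ger0_norm (ltW c0)) ler_pdivrMr.
by rewrite (ger0_norm (ltW B0)) ler_pdivrMr.
Qed.

End statistic.

(** * The limit theorem for the normalised statistic *)

Section weak_limit.
Context d (T : measurableType d) (R : realType) (P : probability T R).
Variables (X : nat -> nat -> {RV P >-> nat}) (xi : nat -> {RV P >-> nat}).
Notation Y := (merged X xi).
Notation Ex := (Ex P).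
Notation L1 := (L1 P).
Notation L2 := (L2 P).
Notation mD := (mD Y).
Notation pos := [set p : nat * nat | (0 < p.1)%N].
Notation Z := (Z X xi).
Notation pairs := (pair_count R).
Hypothesis iY : independent_RVs pos Y.
Hypothesis X_distr : forall n i : nat, (0 < n)%N -> (0 < i)%N ->
     distribution P (X n i) = distribution P (X 1%N 1%N).
Variables (a bt g4 : nat -> R) (b2 kap : R).
Let eps k w : R := (xi k w)%:R - a k.
Let eta k w : R := eps k w ^+ 2 - bt k.
Hypothesis Hcx : L2 (fun w => cx R (X 1%N 1%N w)).
Hypothesis Hcx0 : Ex (fun w => cx R (X 1%N 1%N w)) = 0.
Hypothesis Hcx2 : Ex (fun w => cx R (X 1%N 1%N w) ^+ 2) = b2.
Hypothesis Hqx : L2 (fun w => cx R (X 1%N 1%N w) ^+ 2 - b2).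
Hypothesis Hqx0 : Ex (fun w => cx R (X 1%N 1%N w) ^+ 2 - b2) = 0.
Hypothesis Hqx2 : Ex (fun w => (cx R (X 1%N 1%N w) ^+ 2 - b2) ^+ 2) = kap.
Hypothesis Heps : forall k, (0 < k)%N -> [/\ L2 (eps k), Ex (eps k) = 0 &
  Ex (fun w => eps k w ^+ 2) = bt k].
Hypothesis Heta : forall k, (0 < k)%N -> [/\ L2 (eta k), Ex (eta k) = 0 &
  Ex (fun w => eta k w ^+ 2) = g4 k].
Variables (alpha beta gamma theta : R).
Hypothesis a_ge0 : forall k, 0 <= a k.
Hypothesis bt_ge0 : forall k, 0 <= bt k.
Hypothesis g4_ge0 : forall k, 0 <= g4 k.
Hypothesis alpha_ge0 : 0 <= alpha.
Hypothesis beta_ge0 : 0 <= beta.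
Hypothesis gamma_ge0 : 0 <= gamma.
Hypothesis ha : rvs alpha a.
Hypothesis hb : rvs beta bt.
Hypothesis hg : rvs gamma g4.
Hypothesis a_infty : a n @[n --> \oo] --> +oo.
Hypothesis b_small : bt n / (n%:R * a n) @[n --> \oo] --> (0 : R) \/
  (bt n / (n%:R * a n ^+ 2) @[n --> \oo] --> (0 : R) /\
   n%:R * a n * bt n / g4 n @[n --> \oo] --> (0 : R)).
Notation A := (Amean a).
Notation v := (vbound a bt b2).
Notation G := (partial_sum g4).
Notation N2 := (norm2 a g4).
Hypothesis theta_cvg : n%:R * A n ^+ 2 / (n%:R * A n ^+ 2 + G n) @[n --> \oo] --> theta.
Hypothesis lind : forall e, 0 < e ->
  (\sum_(k < n) Ex (fun w => tail (e * Num.sqrt (G n)) (eta k.+1 w))) / G n @[n --> \oo] --> (0 : R).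
Notation c := (2 * alpha + 3).
Notation main_term := (main_term X xi a bt).
(** The factor [c] enters because the denominator of the estimator is asymptotically
    [n * A n ^+ 2 / c], see [denominator_limit]. *)
Let W n k w := c / Num.sqrt (N2 n) * main_term k w.
Let sigma2 := c ^+ 2 * (theta * (2 * b2 ^+ 2 / (4 * alpha + 5)) +
     (1 - theta) * ((gamma + 1) / (2 * alpha + 3 + gamma))).

Let c_gt0 : 0 < c.
Proof. by rewrite ltr_wpDl ?mulr_ge0. Qed.

Let facts k := main_term_facts iY X_distr Hcx Hcx0 Hcx2 Heta k.

Let b2_ge0' : 0 <= b2.
Proof. by rewrite -Hcx2; apply: Ex_ge0 => w; exact: sqr_ge0. Qed.

Let kap_ge0' : 0 <= kap.
Proof. by rewrite -Hqx2; apply: Ex_ge0 => w; exact: sqr_ge0. Qed.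

Lemma norm2_ge0 n : 0 <= N2 n.
Proof.
by rewrite /norm2 addr_ge0// mulr_ge0 ?sqr_ge0 ?exprn_ge0//; apply: sumr_ge0.
Qed.

Lemma W_variance : \sum_(k < n) Ex (fun w => W n k w ^+ 2) @[n --> \oo] --> sigma2.
Proof.
apply: near_seq_cvg (variance_sum a_ge0 g4_ge0 alpha_ge0 gamma_ge0 ha hg a_infty theta_cvg).
apply: nearW => n.
rewrite big_mkord mulr_sumr mulr_suml; apply: eq_bigr => k _.
have [_ [_ l2] _ E] := facts k.
rewrite (@Ex_eq _ _ _ _ _ (fun w => c ^+ 2 / N2 n * main_term k w ^+ 2)); last first.
  by move=> w; rewrite /W !exprMn exprVn sqr_sqrtr ?norm2_ge0.
by rewrite ExZ// E; ring.
Qed.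

(** [mart_sum] for increments that do not depend on the population. *)
Lemma row_sum_variance n : let S w := \sum_(0 <= k < n) main_term k w in
  L2 S /\ Ex (fun w => S w ^+ 2) <= \sum_(0 <= k < n) Ex (fun w => main_term k w ^+ 2).
Proof.
have [|||||||_ LS _ S2] := @mart_sum _ _ _ _ X xi iY (fun _ _ => 1) (fun k _ => main_term k)
  (fun k _ => Ex (fun w => main_term k w ^+ 2)) n.
- by move=> k; exact: (@mD_cst _ _ _ _ _ _ _ Y _ _ R 1).
- by move=> k w; rewrite normr1.
- by move=> k z; have [] := facts k.
- by move=> k z; have [] := facts k.
- by move=> k z; have [] := facts k.
- by move=> k z.
- by move=> k; exact: L1_cst.
have SE : (fun w => \sum_(0 <= k < n) 1 * main_term k w) = fun w => \sum_(0 <= k < n) main_term k w.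
  by apply/funext => w; apply: eq_bigr => k _; rewrite mul1r.
move=> S; rewrite SE in LS; split => //; apply: (le_trans (y := Ex (fun w => (\sum_(0 <= k < n) 1 * main_term k w) ^+ 2))).
  by rewrite le_eqVlt; apply/orP; left; apply/eqP; apply: Ex_eq => w; congr (_ ^+ 2); apply: eq_bigr => k _; rewrite mul1r.
apply: (le_trans S2); apply: ler_sum => k _; by rewrite Ex_cst.
Qed.

Lemma W_lindeberg e : 0 < e ->
  \sum_(k < n) Ex (fun w => tail e (W n k w)) @[n --> \oo] --> (0 : R).
Proof.
move=> e0; apply/cvgrPdist_le => r r0.
(* Three error terms are each brought below [r / 3]; this [rho] serves for the first, as
   [n * x ^+ 2 <= c ^+ 2] for the [x] introduced below. *)
pose rho := r / (3 * c ^+ 2).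
have rho0 : 0 < rho by rewrite divr_gt0// mulr_gt0// exprn_gt0.
have [C C0 hC] := main_term_tails iY X_distr Hcx Hcx0 Hcx2 Heta (fun k _ => a_ge0 k) rho0.
(* As [A n * Num.sqrt (G n) <= B], the level [t0 * Num.sqrt (G n)] meets the requirement of
   [main_term_tails], and it has the form that the Lindeberg hypothesis controls. *)
pose t0 := e / (2 * c).
have t00 : 0 < t0 by rewrite divr_gt0// mulr_gt0.
have sq : C * c ^+ 3 / e * (Num.sqrt (n%:R : R))^-1 @[n --> \oo] --> (0 : R).
  have h : (Num.sqrt (n%:R : R))^-1 @[n --> \oo] --> (0 : R).
    apply/gtr0_cvgV0; first by near=> n; rewrite sqrtr_gt0 ltr0n; near: n; exact: nbhs_infty_gt.
    apply/cvgryPge => M; near=> n.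
    rewrite (le_trans (ler_norm M))// -sqrtr_sqr ler_wsqrtr//.
    by near: n; have /cvgryPge := @natr_cvg R; apply.
  by have := @seqZ _ (C * c ^+ 3 / e) _ _ h; rewrite mulr0.
have ln := @seqZ _ (4 * c ^+ 2) _ _ (lind t00); rewrite mulr0 in ln.
near=> n.
have An : 0 < A n by near: n; exact: Amean_pos a_ge0 alpha_ge0 ha.
have n0 : 0 < n%:R :> R by near: n; exact: nat_pos.
have N0 : 0 < N2 n by near: n; exact: norm2_pos a_ge0 g4_ge0 alpha_ge0 gamma_ge0 ha hg.
have Gn : 0 < G n by near: n; exact: G_pos g4_ge0 gamma_ge0 hg.
rewrite sub0r normrN ger0_norm; last by apply: sumr_ge0 => k _; apply: Ex_ge0 => w; exact: tail_ge0.
set B := Num.sqrt (N2 n).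
have B0 : 0 < B by rewrite sqrtr_gt0.
have BB : B ^+ 2 = N2 n by rewrite sqr_sqrtr// ltW.
set t := t0 * Num.sqrt (G n).
have AG : A n * Num.sqrt (G n) <= B.
  rewrite -(ger0_norm (ltW An)) -sqrtr_sqr -sqrtrM ?sqr_ge0// ler_wsqrtr// /norm2 lerDr.
  by rewrite mulr_ge0// exprn_ge0// ltW.
have cond : c / B * A n * t <= e / 2.
  have -> : c / B * A n * t = e / 2 * (A n * Num.sqrt (G n) / B) by rewrite /t /t0; field; rewrite !gt_eqF.
  by rewrite ler_piMr ?(ltW (divr_gt0 _ _))// ler_pdivrMr// mul1r.
have := hC n (c / B) e t (ltW (divr_gt0 c_gt0 B0)) e0 (mulr_ge0 (ltW t00) (sqrtr_ge0 _)) cond.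
move=> /le_trans; apply.
have r1 : n%:R * A n ^+ 4 <= B ^+ 2 by rewrite BB /norm2 lerDl mulr_ge0 ?sqr_ge0// ltW.
have r2 : A n ^+ 2 * G n <= B ^+ 2 by rewrite BB /norm2 lerDr mulr_ge0// exprn_ge0// ltW.
(* From [n * A n ^+ 4 <= B ^+ 2], [x] is at most [c] divided by the square root of [n]: the
   quadratic terms stay bounded in sum and the cubic ones vanish. *)
set x := c / B * A n ^+ 2.
have x0 : 0 <= x by rewrite mulr_ge0 ?sqr_ge0// ltW// divr_gt0.
have nx : n%:R * x ^+ 2 <= c ^+ 2.
  have -> : n%:R * x ^+ 2 = c ^+ 2 * (n%:R * A n ^+ 4 / B ^+ 2) by rewrite /x; field; rewrite gt_eqF.
  by rewrite ler_piMr ?sqr_ge0// ler_pdivrMr ?exprn_gt0// mul1r.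
have s0 : 0 < Num.sqrt (n%:R : R) by rewrite sqrtr_gt0.
have xs : x <= c / Num.sqrt n%:R.
  rewrite ler_pdivlMr// -(ger0_norm x0) -sqrtr_sqr -sqrtrM ?sqr_ge0//.
  by rewrite -[leRHS](ger0_norm (ltW c_gt0)) -sqrtr_sqr ler_wsqrtr// mulrC.
have part1 : n%:R * (rho * x ^+ 2) <= r / 3.
  have -> : n%:R * (rho * x ^+ 2) = rho * (n%:R * x ^+ 2) by ring.
  apply: (le_trans (ler_wpM2l (ltW rho0) nx)); rewrite le_eqVlt; apply/orP; left; apply/eqP.
  by rewrite /rho; field; rewrite gt_eqF.
have part2 : n%:R * (C * x ^+ 3 / e) <= r / 3.
  have Ce : 0 <= C / e by rewrite divr_ge0// ltW.
  have -> : n%:R * (C * x ^+ 3 / e) = C / e * (n%:R * x ^+ 2 * x) by ring.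
  apply: (le_trans (ler_wpM2l Ce (ler_pM _ x0 nx xs))); first by rewrite mulr_ge0 ?sqr_ge0// ltW.
  have -> : C / e * (c ^+ 2 * (c / Num.sqrt n%:R)) = C * c ^+ 3 / e * (Num.sqrt (n%:R : R))^-1 by ring.
  by apply: ltW; near: n; apply: (cvgr_lt 0 sq); rewrite divr_gt0.
have part3 : 4 * (c / B * A n) ^+ 2 * \sum_(k < n) Ex (fun w => tail t (eta k.+1 w)) <= r / 3.
  apply: (@le_trans _ _ (4 * c ^+ 2 * ((\sum_(k < n) Ex (fun w => tail t (eta k.+1 w))) / G n))).
    have T0 : 0 <= \sum_(k < n) Ex (fun w => tail t (eta k.+1 w)).
      by apply: sumr_ge0 => k _; apply: Ex_ge0 => w; exact: tail_ge0.
    have -> : 4 * (c / B * A n) ^+ 2 * \sum_(k < n) Ex (fun w => tail t (eta k.+1 w)) =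
      4 * c ^+ 2 * ((\sum_(k < n) Ex (fun w => tail t (eta k.+1 w))) * (A n ^+ 2 / B ^+ 2)).
      by field; rewrite gt_eqF.
    apply: ler_wpM2l; first by rewrite mulr_ge0 ?sqr_ge0.
    apply: ler_wpM2l => //.
    by rewrite ler_pdivrMr ?exprn_gt0// mulrC ler_pdivlMr.
  by apply: ltW; rewrite /t; near: n; apply: (cvgr_lt 0 ln); rewrite divr_gt0.
rewrite mulrDr; lra.
Unshelve. all: by end_near.
Qed.

Definition statistic n w : R :=
  n%:R * A n ^+ 2 / Num.sqrt (N2 n) * (estimator X xi a bt n w - b2).

Lemma measurable_statistic n : measurable_fun setT (statistic n).
Proof.
apply: measurable_funM => //; apply: measurable_funB => //.
exact: measurable_estimator.
Qed.

Lemma prob_le_add (A1 B1 C1 : set T) : measurable A1 -> measurable B1 -> measurable C1 ->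
  A1 `<=` B1 `|` C1 -> fine (P A1) <= fine (P B1) + fine (P C1).
Proof.
move=> mA mB mC sub; rewrite -fineD ?fin_num_measure//.
rewrite fine_le ?fin_numD ?fin_num_measure//.
apply: (@le_trans _ _ (P (B1 `|` C1))); last exact: measureU2.
by apply: le_measure; rewrite ?inE//; exact: measurableU.
Qed.

(** In the difference of squares the first factor is at most [del * A n], and the second at most
    [3 * A n] as [del <= 1]. *)
Lemma denominator_close n del w : 0 < del -> del <= 1 ->
  (forall k, (k <= n)%N -> `|(Z k w)%:R - A k| <= del * A n) ->
  `|\sum_(0 <= k < n) (Z k w)%:R ^+ 2 - \sum_(0 <= k < n) A k ^+ 2| <= 3 * del * (n%:R * A n ^+ 2).
Proof.
move=> d0 d1 h.
have A0 k : 0 <= A k by exact: sumr_ge0.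
rewrite -sumrB; apply: (le_trans (ler_norm_sum _ _ _)).
apply: (@le_trans _ _ (\sum_(0 <= k < n) 3 * del * A n ^+ 2)); last by rewrite sum_cst; lra.
apply: ler_sum_nat => k /andP[_ kn].
have hk := h k (ltnW kn); have Akn := Amean_mono a_ge0 (ltnW kn).
rewrite subr_sqr normrM.
have -> : 3 * del * A n ^+ 2 = del * A n * (3 * A n) by ring.
apply: ler_pM => //.
have -> : (Z k w)%:R + A k = ((Z k w)%:R - A k) + 2 * A k by ring.
apply: (le_trans (ler_normD _ _)).
rewrite [X in _ + X]ger0_norm ?mulr_ge0//.
have : del * A n <= A n by rewrite ler_piMl.
lra.
Qed.

Lemma statistic_close e : 0 < e ->
  fine (P [set w | e < `|statistic n w - \sum_(i < n) W n i w|]) @[n --> \oo] --> (0 : R).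
Proof.
move=> e0; apply/cvgrPdist_le => r r0.
have c0 := c_gt0.
pose K := sigma2 + 1.
(* Chebyshev's inequality leaves [K / M ^+ 2] for the event that [c * S] exceeds [M * B];
   [M >= 4 * K / r] and [M >= 1] bring this below [r / 4]. *)
pose M := `|4 * K / r| + 1.
have M1 : 1 <= M by rewrite lerDr.
have M0 : 0 < M by apply: lt_le_trans M1.
pose et := e / (4 * c).
have et0 : 0 < et by rewrite divr_gt0// mulr_gt0.
(* The four bounds serve for [denominator_close], for [ratio_perturbation], for
   [8 * c * M * del <= e / 2], and for the comparison error. The last one is taken with [mu = del],
   where [28 * b2 ^+ 2 + 17] collects the coefficients of [comp_bound_limit] after
   [del ^+ 2 <= del]. *)
pose del := Num.min 1 (Num.min (8 * c)^-1 (Num.min (e / (16 * c * M)) (et ^+ 2 * r / (4 * (28 * b2 ^+ 2 + 17))))).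
have bb : 0 < 28 * b2 ^+ 2 + 17 by rewrite ltr_wpDl ?mulr_ge0 ?sqr_ge0.
have del0 : 0 < del.
  have x2 : 0 < (8 * c)^-1 by rewrite invr_gt0 mulr_gt0.
  have x3 : 0 < e / (16 * c * M) by rewrite divr_gt0// !mulr_gt0.
  have x4 : 0 < et ^+ 2 * r / (4 * (28 * b2 ^+ 2 + 17)).
    by apply: divr_gt0; rewrite mulr_gt0// exprn_gt0.
  by rewrite !lt_min ltr01 x2 x3 x4.
have dle1 : del <= 1 by rewrite /del ge_min lexx.
have dle2 : del <= (8 * c)^-1 by rewrite /del !ge_min lexx orbT.
have dle3 : del <= e / (16 * c * M) by rewrite /del !ge_min lexx !orbT.
have dle4 : del <= et ^+ 2 * r / (4 * (28 * b2 ^+ 2 + 17)) by rewrite /del !ge_min lexx !orbT.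
have hv := v_small a_ge0 bt_ge0 b2_ge0' alpha_ge0 beta_ge0 ha hb a_infty b_small.
have hcb := comp_bound_limit a_ge0 bt_ge0 g4_ge0 b2_ge0' kap_ge0' alpha_ge0 beta_ge0 gamma_ge0 ha hb hg
  a_infty b_small del0 del0.
have hden := denominator_limit a_ge0 alpha_ge0 ha.
near=> n.
have An : 0 < A n by near: n; exact: Amean_pos a_ge0 alpha_ge0 ha.
have n0 : 0 < n%:R :> R by near: n; exact: nat_pos.
have N0 : 0 < N2 n by near: n; exact: norm2_pos a_ge0 g4_ge0 alpha_ge0 gamma_ge0 ha hg.
set B := Num.sqrt (N2 n).
have B0 : 0 < B by rewrite sqrtr_gt0.
have BB : B ^+ 2 = N2 n by rewrite sqr_sqrtr// ltW.
have dA : 0 < del * A n by rewrite mulr_gt0.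
have eB : 0 < et * B by rewrite mulr_gt0.
have [Good [mG PG G1 G2]] := comparison iY X_distr Hcx Hcx0 Hcx2 Hqx Hqx0 Hqx2 Heps Heta
  (fun k _ => a_ge0 k) n dA del0 eB.
have [LS ES] := row_sum_variance n.
set S := fun w => \sum_(0 <= k < n) main_term k w in LS ES.
have LcS := L2Z c LS.
have MB0 : 0 < M * B by rewrite mulr_gt0.
have PS := markov2 MB0 LcS.
have mS := measurable_lt_norm (M * B) LcS.1.
have sWE w : \sum_(i < n) W n i w = c / B * S w.
  by rewrite /S big_mkord mulr_sumr.
have mdiff : measurable_fun setT (fun w => statistic n w - c / B * S w).
  apply: measurable_funB; first exact: measurable_statistic.
  by apply: measurable_funM => //; case: LS.
have mE := measurable_lt_norm e mdiff.
have -> : [set w | e < `|statistic n w - \sum_(i < n) W n i w|] = [set w | e < `|statistic n w - c / B * S w|].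
  by apply/funext => w /=; rewrite sWE.
have sub : [set w | e < `|statistic n w - c / B * S w|] `<=` ~` Good `|` [set w | M * B < `|c * S w|].
  move=> w /= ew; apply: contrapT => /not_orP[/contrapT gw /negP]; rewrite -leNgt => Sw.
  have NN : 0 < n%:R * A n ^+ 2 by rewrite mulr_gt0// exprn_gt0.
  have hd := denominator_close del0 dle1 (G1 w gw).
  have hS0 : `|(\sum_(0 <= k < n) A k ^+ 2) / (n%:R * A n ^+ 2) - c^-1| <= del.
    near: n; have /cvgrPdist_le := hden; move=> /(_ _ del0); apply: filterS => k.
    by rewrite distrC.
  have cd : 8 * c * del <= 1 by have := ler_wpM2l (ltW (mulr_gt0 (ltr0n R 8) c0)) dle2; rewrite divff// gt_eqF// mulr_gt0.
  have [D0 hh] := ratio_perturbation NN B0 c0 (ltW M0) del0 (ltW et0) cd hd hS0 (G2 w gw) Sw.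
  move: ew; rewrite ltNge => /negP; apply.
  rewrite /statistic (estimator_residual a bt b2 D0).
  apply: (le_trans hh).
  have -> : 2 * c * et = e / 2 by rewrite /et; field; rewrite gt_eqF.
  have : 8 * c * M * del <= e / 2.
    apply: (le_trans (ler_wpM2l _ dle3)); first by rewrite !mulr_ge0// ltW.
    by rewrite le_eqVlt; apply/orP; left; apply/eqP; field; rewrite !gt_eqF.
  lra.
rewrite sub0r normrN ger0_norm ?fine_ge0//.
have mGc := measurableC mG.
apply: (le_trans (prob_le_add mE mGc mS sub)).
have pS : fine (P [set w | M * B < `|c * S w|]) <= r / 4.
  apply: (le_trans PS).
  have -> : Ex (fun w => (c * S w) ^+ 2) = c ^+ 2 * Ex (fun w => S w ^+ 2).
    rewrite -ExZ; last by case: LS.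
    by apply: Ex_eq => w; rewrite exprMn.
  rewrite exprMn BB ler_pdivrMr ?mulr_gt0 ?exprn_gt0//.
  have vK : c ^+ 2 * (\sum_(0 <= k < n) Ex (fun w => main_term k w ^+ 2)) <= K * N2 n.
    have : \sum_(k < n) Ex (fun w => W n k w ^+ 2) <= K.
      by apply: ltW; near: n; apply: (cvgr_lt _ W_variance); rewrite ltrDl.
    have -> : \sum_(k < n) Ex (fun w => W n k w ^+ 2) =
        c ^+ 2 * (\sum_(0 <= k < n) Ex (fun w => main_term k w ^+ 2)) / N2 n.
      rewrite big_mkord mulr_sumr mulr_suml; apply: eq_bigr => k _.
      have [_ [_ l2] _ _] := facts k.
      rewrite (@Ex_eq _ _ _ _ _ (fun w => c ^+ 2 / N2 n * main_term k w ^+ 2)); last first.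
        by move=> w; rewrite /W !exprMn exprVn sqr_sqrtr ?norm2_ge0.
      by rewrite ExZ//; ring.
    by rewrite ler_pdivrMr.
  apply: (le_trans (ler_wpM2l (sqr_ge0 c) ES)); apply: (le_trans vK).
  have -> : r / 4 * (M ^+ 2 * N2 n) = r / 4 * M ^+ 2 * N2 n by ring.
  rewrite ler_wpM2r ?(ltW N0)//.
  have KM : K <= r / 4 * M.
    have h : 4 * K / r <= M by rewrite (le_trans (ler_norm _))// lerDl.
    have := ler_wpM2l (ltW (divr_gt0 r0 (ltr0n R 4))) h.
    by apply: le_trans; rewrite le_eqVlt; apply/orP; left; apply/eqP; field; rewrite gt_eqF.
  apply: (le_trans KM); rewrite ler_wpM2l ?(ltW (divr_gt0 _ _))//.
  by rewrite expr2 ler_peMl// ltW.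
have pG1 : v n / (del * A n) ^+ 2 <= r / 4.
  have -> : v n / (del * A n) ^+ 2 = (v n / A n ^+ 2) / del ^+ 2 by field; rewrite !gt_eqF.
  rewrite ler_pdivrMr ?exprn_gt0//; apply: ltW; near: n; apply: (cvgr_lt 0 hv).
  by rewrite mulr_gt0 ?exprn_gt0// divr_gt0.
have pG2 : (\sum_(0 <= k < n) comp_bound a bt g4 b2 kap (del * A n) del k) / (et * B) ^+ 2 <= r / 4.
  have hc : (\sum_(0 <= k < n) comp_bound a bt g4 b2 kap (del * A n) del k) / N2 n <=
      8 * del ^+ 2 * (2 * b2 ^+ 2 + 2) + 12 * b2 ^+ 2 * del + del by near: n.
  have -> : (\sum_(0 <= k < n) comp_bound a bt g4 b2 kap (del * A n) del k) / (et * B) ^+ 2 =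
      (\sum_(0 <= k < n) comp_bound a bt g4 b2 kap (del * A n) del k) / N2 n / et ^+ 2.
    by rewrite exprMn BB; field; rewrite !gt_eqF.
  rewrite ler_pdivrMr ?exprn_gt0//; apply: (le_trans hc).
  apply: (@le_trans _ _ (del * (28 * b2 ^+ 2 + 17))).
    have d2 : del ^+ 2 <= del by rewrite expr2 ler_piMr// ltW.
    have b0 : 0 <= 2 * b2 ^+ 2 + 2 by rewrite addr_ge0 ?mulr_ge0 ?sqr_ge0.
    have := ler_wpM2r b0 d2; lra.
  have := ler_wpM2r (ltW bb) dle4; move/le_trans; apply.
  by rewrite le_eqVlt; apply/orP; left; apply/eqP; field; rewrite gt_eqF.
have := le_trans PG (lerD pG1 pG2); lra.
Unshelve. all: by end_near.
Qed.

Hypothesis theta_itv : 0 <= theta <= 1.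

Lemma sigma2_ge0 : 0 <= sigma2.
Proof.
have /andP[t0 t1] := theta_itv.
rewrite /sigma2 mulr_ge0 ?sqr_ge0// addr_ge0// mulr_ge0 ?subr_ge0//.
  by rewrite divr_ge0 ?mulr_ge0 ?sqr_ge0// addr_ge0 ?mulr_ge0.
by rewrite divr_ge0 ?addr_ge0 ?mulr_ge0.
Qed.

Lemma centered_normal_fin_num (s x : R) : centered_normal s `]-oo, x]%classic \is a fin_num.
Proof.
rewrite /centered_normal; case: ifP => _; last exact: (@fin_num_measure _ _ _ (normal_prob 0 (Num.sqrt s))).
by rewrite diracE.
Qed.

Lemma statistic_cvg x :
  {for x, continuous (fun y : R => centered_normal sigma2 `]-oo, y]%classic)} ->
  P (statistic n @^-1` `]-oo, x]%classic) @[n --> \oo] --> centered_normal sigma2 `]-oo, x]%classic.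
Proof.
move=> cx.
have WL2 n k : L2 (W n k) by apply: L2Z; have [] := facts k.
have W0 n k : Ex (W n k) = 0.
  by have [_ l2 e0 _] := facts k; rewrite /W ExZ ?e0 ?mulr0//; exact: L2_L1.
have Wi n k : indep P (fun w => \sum_(i < k) W n i w) (W n k).
  exact: (main_terms_indep iY X_distr Hcx Hcx0 Hcx2 Heta).
have Hp := smoothing_limit 2 sigma2_ge0 cx.
have Hm : H (r ^+ 4 + sigma2) (x - 2 * r) @[r --> 0^'+] --> fine (centered_normal sigma2 `]-oo, x]%classic).
  have := smoothing_limit (- 2) sigma2_ge0 cx; apply: cvg_trans; apply: near_eq_cvg; apply: nearW => r.
  by rewrite mulNr.
have h := lindeberg_slutsky WL2 W0 Wi W_variance W_lindeberg measurable_statistic statistic_close Hp Hm.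
rewrite -(fineK (centered_normal_fin_num sigma2 x)).
apply: cvg_EFin => //; apply: nearW => n; apply: fin_num_measure.
rewrite -[X in measurable X]setTI; apply: (measurable_statistic n) => //.
Qed.

End weak_limit.

(** * Moments of the model as real expectations *)

Section moments.
Context d (T : measurableType d) (R : realType) (P : probability T R).
Notation Ex := (Ex P).
Notation L1 := (L1 P).
Notation L2 := (L2 P).

Lemma expectationE (f : T -> R) : fine 'E_P[f] = Ex f.
Proof. by rewrite unlock. Qed.

Lemma L1_expectation (f : T -> R) : measurable_fun setT f -> (forall w, 0 <= f w) ->
  ('E_P[f] < +oo)%E -> L1 f.
Proof.
move=> mf f0; rewrite unlock => h; apply/integrableP; split; first exact/measurable_EFinP.
apply: le_lt_trans h; rewrite le_eqVlt; apply/orP; left; apply/eqP.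
by apply: eq_integral => w _ /=; rewrite ger0_norm.
Qed.

Lemma variance_centered (f : T -> R) : ('V_P[f] = 'E_P[fun w => ((f w - Ex f) ^+ 2)%R])%E.
Proof.
by rewrite /variance unlock expectationE; congr expectation.
Qed.

Lemma centered_L2 (f : T -> R) : measurable_fun setT f ->
  'V_P[f] \is a fin_num -> L2 (fun w => f w - Ex f) /\
  Ex (fun w => (f w - Ex f) ^+ 2) = fine 'V_P[f].
Proof.
move=> mf; rewrite variance_centered => h.
have mc : measurable_fun setT (fun w => f w - Ex f) by exact: measurable_funB.
split; last by rewrite expectationE.
split => //; apply: L1_expectation; [exact: measurable_funX|by move=> w; exact: sqr_ge0|].
by rewrite ltey_eq h.
Qed.

Lemma centered_L1 (f : T -> R) : L1 f -> Ex (fun w => f w - Ex f) = 0.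
Proof. by move=> h; rewrite ExB ?Ex_cst ?subrr//; exact: L1_cst. Qed.

Lemma measurable_natR (f : T -> nat) : measurable_fun setT f ->
  measurable_fun setT (fun w => (f w)%:R : R).
Proof. by move=> mf; apply: (measurableT_comp (measurable_nat (fun y => y%:R : R))). Qed.

Lemma expectation_ge0' (f : T -> R) : (forall w, 0 <= f w) -> 0 <= fine 'E_P[f].
Proof. by move=> f0; rewrite expectationE; exact: Ex_ge0. Qed.

Lemma variance_fine_ge0 (f : T -> R) : 0 <= fine 'V_P[f].
Proof. by rewrite variance_centered; apply: expectation_ge0' => w; exact: sqr_ge0. Qed.

End moments.

(** [theta_n * n] is the square of [n * A ^+ 2] divided by [norm2]: the normalisation of the theorem
    is that of [statistic]. *)
Lemma sqrt_theta_norm (R : realType) (n : nat) (A G : R) : 0 <= A -> 0 <= G ->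
  Num.sqrt (n%:R * A ^+ 2 / (n%:R * A ^+ 2 + G) * n%:R) =
  n%:R * A ^+ 2 / Num.sqrt (n%:R * A ^+ 4 + A ^+ 2 * G).
Proof.
rewrite le_eqVlt => /orP[/eqP <-|A0] G0.
  by rewrite expr0n !mulr0 !mul0r sqrtr0.
have -> : n%:R * A ^+ 4 + A ^+ 2 * G = A ^+ 2 * (n%:R * A ^+ 2 + G) by ring.
have D0 : 0 <= n%:R * A ^+ 2 + G by rewrite addr_ge0// mulr_ge0 ?sqr_ge0.
have -> : n%:R * A ^+ 2 / (n%:R * A ^+ 2 + G) * n%:R = (n%:R * A) ^+ 2 * (n%:R * A ^+ 2 + G)^-1 by ring.
rewrite (sqrtrM _ (sqr_ge0 (n%:R * A))) (sqrtrM _ (sqr_ge0 A)) !sqrtr_sqr !ger0_norm ?mulr_ge0 ?(ltW A0)// sqrtrV//.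
move: (Num.sqrt _) => r.
have -> : n%:R * A ^+ 2 / (A * r) = n%:R * A / r * (A / A) by rewrite invfM; ring.
by rewrite divff ?mulr1// gt_eqF.
Qed.

Theorem theorem1 (d : measure_display) (T : measurableType d) (R : realType)
  (P : probability T R)
  (X : nat -> nat -> {RV P >-> nat}) (xi : nat -> {RV P >-> nat})
  (alpha beta gamma : R) (Lalpha Lbeta Lgamma : R -> R) (theta : R)
  (X_indep : independent_RVs [set p : nat * nat | (0 < p.1)%N /\ (0 < p.2)%N]
               (fun p : nat * nat => X p.1 p.2))
  (xi_indep : independent_RVs [set n : nat | (0 < n)%N] xi)
  (X_xi_indep : independent_families
     [set p : nat * nat | (0 < p.1)%N /\ (0 < p.2)%N] [set n : nat | (0 < n)%N]
     (fun p : nat * nat => X p.1 p.2) xi)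
  (X_distr : forall n i : nat, (0 < n)%N -> (0 < i)%N ->
     distribution P (X n i) = distribution P (X 1%N 1%N))
  (X_mean : ('E_P[fun w => (X 1%N 1%N w)%:R] = 1)%E)
  (X_moment4 : ('E_P[fun w => ((X 1%N 1%N w)%:R ^+ 4)%R] < +oo)%E)
  (alpha_fin : forall n : nat, (0 < n)%N ->
     ('E_P[fun w => (xi n w)%:R])%E \is a fin_num)
  (beta_fin : forall n : nat, (0 < n)%N ->
     'V_P[fun w => (xi n w)%:R] \is a fin_num)
  (gamma_fin : forall n : nat, (0 < n)%N ->
     'V_P[fun w => ((xi n w)%:R - immigration_mean xi n) ^+ 2]
       \is a fin_num)
  (alpha_ge0 : 0 <= alpha) (beta_ge0 : 0 <= beta) (gamma_ge0 : 0 <= gamma)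
  (Lalpha_sv : slowly_varying Lalpha) (Lbeta_sv : slowly_varying Lbeta)
  (Lgamma_sv : slowly_varying Lgamma)
  (alpha_rv : forall n : nat, (0 < n)%N ->
     immigration_mean xi n = n%:R `^ alpha * Lalpha n%:R)
  (beta_rv : forall n : nat, (0 < n)%N ->
     immigration_variance xi n = n%:R `^ beta * Lbeta n%:R)
  (gamma_rv : forall n : nat, (0 < n)%N ->
     immigration_gamma4 xi n = n%:R `^ gamma * Lgamma n%:R)
  (alpha_infty : immigration_mean xi n @[n --> \oo] --> +oo)
  (beta_small :
     immigration_variance xi n / (n%:R * immigration_mean xi n)
       @[n --> \oo] --> (0 : R)
     \/
     (immigration_variance xi n / (n%:R * immigration_mean xi n ^+ 2)
        @[n --> \oo] --> (0 : R) /\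
      n%:R * immigration_mean xi n * immigration_variance xi n
        / immigration_gamma4 xi n @[n --> \oo] --> (0 : R)))
  (lindeberg : lindeberg_condition xi)
  (theta_itv : 0 <= theta <= 1)
  (theta_cvg : theta_seq X xi n @[n --> \oo] --> theta) :
  let b2 := offspring_variance X in
  let sigma2 := (2 * alpha + 3) ^+ 2 *
    (theta * (2 * b2 ^+ 2 / (4 * alpha + 5)) +
     (1 - theta) * ((gamma + 1) / (2 * alpha + 3 + gamma))) in
  converges_in_distribution P
    (fun n w => Num.sqrt (theta_seq X xi n * n%:R) *
                (b2_estimator X xi n w - b2))
    (centered_normal sigma2).

Proof.
move=> b2 sigma2.
set a := immigration_mean xi in alpha_rv alpha_infty beta_small gamma_fin *.
set bt := immigration_variance xi in beta_rv beta_small.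
set g4 := immigration_gamma4 xi in gamma_rv beta_small.
have mX k i := measurable_natR (R := R) (measurable_funPT (X k i)).
have mxi k := measurable_natR (R := R) (measurable_funPT (xi k)).
have iY := merged_indep X_indep xi_indep X_xi_indep.
have aE k : a k = Ex P (fun w => (xi k w)%:R) by exact: expectationE.
have a_ge0 k : 0 <= a k by exact: expectation_ge0'.
have bt_ge0 k : 0 <= bt k by exact: variance_fine_ge0.
have g4_ge0 k : 0 <= g4 k by exact: variance_fine_ge0.
have ha : rvs alpha a := rvs_slowly_varying Lalpha_sv alpha_rv.
have hb : rvs beta bt := rvs_slowly_varying Lbeta_sv beta_rv.
have hg : rvs gamma g4 := rvs_slowly_varying Lgamma_sv gamma_rv.
have L1xi k : (0 < k)%N -> L1 P (fun w => (xi k w)%:R).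
  move=> k0; apply: L1_expectation => //.
  by have := alpha_fin k k0; rewrite fin_numElt => /andP[].
have Heps k : (0 < k)%N -> [/\ L2 P (fun w => (xi k w)%:R - a k),
    Ex P (fun w => (xi k w)%:R - a k) = 0 & Ex P (fun w => ((xi k w)%:R - a k) ^+ 2) = bt k].
  move=> k0; have [h1 h2] := centered_L2 (mxi k) (beta_fin k k0).
  by rewrite aE; split => //; exact: centered_L1 (L1xi k k0).
have Heta k : (0 < k)%N -> [/\ L2 P (fun w => ((xi k w)%:R - a k) ^+ 2 - bt k),
    Ex P (fun w => ((xi k w)%:R - a k) ^+ 2 - bt k) = 0 &
    Ex P (fun w => (((xi k w)%:R - a k) ^+ 2 - bt k) ^+ 2) = g4 k].
  move=> k0; have [[m1 h1] _ h3] := Heps k k0.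
  have [h4 h5] := centered_L2 (measurable_funX 2 m1) (gamma_fin k k0).
  by rewrite -h3; split => //; exact: centered_L1 h1.
have L1X4 : L1 P (fun w => (X 1%N 1%N w)%:R ^+ 4).
  by apply: L1_expectation => //; exact: measurable_funX.
have mcx : measurable_fun setT (fun w => cx R (X 1%N 1%N w)) by exact: measurable_funB.
(* Integrability of the lower powers is drawn from the fourth moment by these pointwise bounds. *)
have nat_le2 (y : nat) : (y%:R : R) ^+ 2 <= y%:R ^+ 4 + 1.
  have := sqr_ge0 ((y%:R : R) ^+ 2 - 1); have := sqr_ge0 ((y%:R : R) ^+ 2).
  by rewrite sqrrB -!exprM !mulr1 expr1n; lra.
have nat_le1 (y : nat) : (y%:R : R) <= y%:R ^+ 4 + 2.
  have := nat_le2 y; have := sqr_ge0 ((y%:R : R) - 1); have := exprn_ge0 4 (ler0n R y).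
  by rewrite sqrrB !mulr1 expr1n; lra.
have cx2_le (y : nat) : cx R y ^+ 2 <= y%:R ^+ 2 + 1.
  by rewrite /cx sqrrB mulr1 expr1n lerD2r gerBl mulrn_wge0.
have L1X : L1 P (fun w => (X 1%N 1%N w)%:R).
  apply: (L1_dom (g := fun w => (X 1%N 1%N w)%:R ^+ 4 + 2)) => //; last by apply: L1D => //; exact: L1_cst.
  by move=> w; rewrite ger0_norm.
have Hcx : L2 P (fun w => cx R (X 1%N 1%N w)).
  split => //; apply: (L1_dom (g := fun w => (X 1%N 1%N w)%:R ^+ 4 + 2)); first exact: measurable_funX.
    by move=> w; rewrite ger0_norm ?sqr_ge0// (le_trans (cx2_le _))//; have := nat_le2 (X 1%N 1%N w); lra.
  by apply: L1D => //; exact: L1_cst.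
have EX1 : Ex P (fun w => (X 1%N 1%N w)%:R) = 1 by rewrite -expectationE X_mean.
have Hcx0 : Ex P (fun w => cx R (X 1%N 1%N w)) = 0.
  by rewrite /cx ExB ?Ex_cst ?EX1 ?subrr//; exact: L1_cst.
have Hcx2 : Ex P (fun w => cx R (X 1%N 1%N w) ^+ 2) = b2.
  by rewrite /b2 /offspring_variance variance_centered expectationE EX1.
have Hqx : L2 P (fun w => cx R (X 1%N 1%N w) ^+ 2 - b2).
  have mq : measurable_fun setT (fun w => cx R (X 1%N 1%N w) ^+ 2 - b2).
    by apply: measurable_funB => //; exact: measurable_funX.
  split => //; apply: (L1_dom (g := fun w => 4 * (X 1%N 1%N w)%:R ^+ 4 + (4 + 2 * b2 ^+ 2))); first exact: measurable_funX.
    move=> w; rewrite ger0_norm ?sqr_ge0//.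
    have h := cx2_le (X 1%N 1%N w); have h0 := sqr_ge0 (cx R (X 1%N 1%N w)).
    have : (cx R (X 1%N 1%N w) ^+ 2) ^+ 2 <= ((X 1%N 1%N w)%:R ^+ 2 + 1) ^+ 2.
      by rewrite lerXn2r ?nnegrE// (le_trans h0).
    move: (cx R (X 1%N 1%N w) ^+ 2) => u hu.
    have e4 : ((X 1%N 1%N w)%:R : R) ^+ 4 = ((X 1%N 1%N w)%:R ^+ 2) ^+ 2 by rewrite -exprM.
    rewrite e4; move: ((X 1%N 1%N w)%:R ^+ 2 : R) hu => y hu.
    have := sqr_ge0 (u + b2); have := sqr_ge0 (y - 1); rewrite !sqrrB sqrrD.
    by move: hu; rewrite sqrrD !mulr1 !expr1n; lra.
  by apply: L1D; [exact: L1Z|exact: L1_cst].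
have Hqx0 : Ex P (fun w => cx R (X 1%N 1%N w) ^+ 2 - b2) = 0.
  by rewrite -Hcx2; apply: centered_L1; case: Hcx.
have AE n : population_mean X xi n = Amean a n.
  have [_ EZ _] := Z_moments iY X_distr Hcx Hcx0 Hcx2 Heps n.
  by rewrite /population_mean expectationE.
have thE n : theta_seq X xi n = n%:R * Amean a n ^+ 2 / (n%:R * Amean a n ^+ 2 + partial_sum g4 n).
  by rewrite /theta_seq AE.
have theta_cvg' : n%:R * Amean a n ^+ 2 / (n%:R * Amean a n ^+ 2 + partial_sum g4 n) @[n --> \oo] --> theta.
  by apply: near_seq_cvg theta_cvg; apply: nearW => n; exact: thE.
have lind e : 0 < e -> (\sum_(k < n) Ex P (fun w => tail (e * Num.sqrt (partial_sum g4 n))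
     (((xi k.+1 w)%:R - a k.+1) ^+ 2 - bt k.+1))) / partial_sum g4 n @[n --> \oo] --> (0 : R).
  move=> e0; have := lindeberg e e0.
  (* The hypothesis is an extended-real statement with an indicator; its expectations are those of
     [tail], finite because [eta] is square integrable. *)
  have E n : (((tau2 xi n)^-1)%:E * \sum_(1 <= k < n.+1)
       'E_P[fun w => (Defs.eta xi k w ^+ 2 * \1_[set w' | e * Num.sqrt (tau2 xi n) < `|Defs.eta xi k w'|] w)%R])%E =
      ((\sum_(k < n) Ex P (fun w => tail (e * Num.sqrt (partial_sum g4 n))
     (((xi k.+1 w)%:R - a k.+1) ^+ 2 - bt k.+1))) / partial_sum g4 n)%:E.
    rewrite [RHS]EFinM muleC; congr (_ * _)%E.
    rewrite -sumEFin big_add1 /= big_mkord; apply: eq_bigr => k _.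
    have [h _ _] := Heta k.+1 (ltn0Sn k).
    rewrite -ExE; last exact: L1_tail.
    rewrite unlock; apply: eq_integral => w _; rewrite /tail mulrC indicE; congr (_%:R * _)%:E.
    by congr nat_of_bool; apply/idP/idP => [|hh]; [rewrite inE|rewrite inE].
  under eq_fun do rewrite E.
  by move=> /fine_cvgP[].
(* [erefl] takes for [kap] the second moment of [cx ^+ 2 - b2] itself. *)
have main x := @statistic_cvg _ _ _ _ _ _ iY X_distr _ _ _ _ _ Hcx Hcx0 Hcx2 Hqx Hqx0 erefl Heps Heta _ _ _ _
  a_ge0 bt_ge0 g4_ge0 alpha_ge0 beta_ge0 gamma_ge0 ha hb hg alpha_infty beta_small theta_cvg' lind theta_itv x.
move=> x cx; have := main x cx; apply: cvg_trans; apply: near_eq_cvg; apply: nearW => n.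
suff -> : statistic X xi a bt g4 b2 n = fun w =>
    Num.sqrt (theta_seq X xi n * n%:R) * (b2_estimator X xi n w - b2) by [].
apply/funext => w; rewrite thE sqrt_theta_norm//; exact: sumr_ge0.
Qed.
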